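(* Consider the normal form Hamiltonian $\mathcal H$ of the spatial planetary three-body problem described in the context, with $N=4$. There exist $c_1,\varepsilon_1>0$ such that, for all $T>0$, all $k=(k_1,k_2)\in\mathbb Z^2$ with $\gcd(k_1,k_2)=1$, all $0<\varepsilon\le\min\{\varepsilon_1,\frac{1}{c_1T}\}$ and all $J_0\in U$ satisfying $\omega:=h_0'(J_0)=2\pi k/T$, there exist at least two geometrically distinct $T$-periodic solutions $\zeta_{\psi_0^\pm}=(J_{\psi_0^\pm},\psi_{\psi_0^\pm},z_{\psi_0^\pm})$ (for suitable $\psi_0^{\pm}\in\mathbb T^2$) of the Hamiltonian system $$\dot J=-\partial_\psi\mathcal H,\quad\dot\psi=\partial_J\mathcal H,\quad\dot z=\mathrm i\,\partial_{\overline z}\mathcal H,\quad\dot{\overline z}=-\mathrm i\,\partial_z\mathcal H$$ with $$\sup_{t\in\mathbb R}|\zeta_{\psi_0^\pm}(t)-\hat\zeta_{\psi_0^\pm}(t)|\le c_1\varepsilon^2,$$ where $\hat\zeta_{\psi_0^\pm}(t):=(J_\varepsilon,\psi_0^\pm+\omega t,0,0)$ and $J_\varepsilon=J_0+O(\varepsilon)$ is the unique solution (near $J_0$) of $h_\varepsilon'(J_\varepsilon)=\omega=2\pi k/T$. In particular $\sup_{t\in[0,T]}|\zeta_{\psi_0^\pm}(t)-(J_0,\psi_0^\pm+\omega t,0,0)|=O(\varepsilon)$.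
   Context: Notation: for $A\subset\mathbb R^d$, $A^d_\delta=\{z\in\mathbb C^d:\mathrm{dist}(z,A)<\delta\}$; $\mathbb T^d_s=\{z\in\mathbb C^d:|\mathrm{Im}\,z_j|<s\}$ (real parts mod $2\pi$); $D^d_\rho$ is the complex ball of radius $\rho$ centred at $0$ in $\mathbb C^d$. ''const'' denotes positive constants independent of $\varepsilon$. Solutions are geometrically distinct if they are not time translates of each other. Three-body problem. Bodies $P_0$ (star), $P_1,P_2$ (planets) in $\mathbb R^3$ with masses $m_0,m_1,m_2$ interact through Newtonian gravity (constant $1$), with $\overline\kappa\varepsilon\le m_1/m_0,\,m_2/m_0\le\varepsilon\le1$ for a fixed $0<\overline\kappa\le1$. Let $a_i$ be the major semi-axis of the osculating Keplerian ellipse of $(P_0,P_i)$, $\Lambda_i^*=\kappa_i^*\sqrt{a_i}$, $\kappa_i^*=\frac{m_i}{\varepsilon}\frac{1}{\sqrt{m_0(m_0+m_i)}}$, and, for fixed $0<a_{\min}<a_{\max}$, $\mathcal L=\{\Lambda^*\in\mathbb R^2:a_{\min}\le a_1<a_2\le a_{\max}\}$. By the classical Delaunay–Poincaré theory (small eccentricities and mutual inclinations), given $\Lambda_0^*\in\mathcal L$ there are symplectic variables $(I_0,\varphi_0,p_0,q_0)\in\mathbb R^2\times\mathbb T^2\times\mathbb R^2\times\mathbb R^2$ (form $dI_0\wedge d\varphi_0+dp_0\wedge dq_0$), with $I_0=\Lambda^*\in\mathcal I$, $\mathcal I\subset\mathcal L$ an open square centred at $\Lambda_0^*$, in which the three-body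 Hamiltonian is $\mathcal H_0=h_0(I_0)+f_0$, where $h_0=-\frac12\sum_{i=1}^2\kappa_i I_{0i}^{-2}$, $\kappa_i=(m_i/\varepsilon)^3\frac{1}{m_0^2(m_0+m_i)}$, $f_0=\varepsilon f_1(I_0,p_0,q_0)+\varepsilon f_2(I_0,\varphi_0,p_0,q_0)$, $f_1=f_{1,0}(I_0)+\sum_{j=1}^2\overline\Omega_j(I_0)(p_{0j}^2+q_{0j}^2)+\widetilde f_1$, $\int_{\mathbb T^2}f_2\,d\varphi_0=0$, $|\widetilde f_1|\le\mathrm{const}\,|(p_0,q_0)|^4$ with $\widetilde f_1$ even in $(p_0,q_0)$; $f_1,f_2$ are real analytic and uniformly bounded on $\mathcal I^2_{\sigma_0}\times\mathbb T^2_{s_0}\times D^4_{\rho_0}$ for suitable $\sigma_0,s_0,\rho_0>0$; and $\overline\Omega_j$, $\overline\Omega_2-\overline\Omega_1$ are bounded below by positive constants on $\mathcal I$ (and in modulus on $\mathcal I^2_{\sigma_0}$). Normal form (with $N=4$). For $\varepsilon$ small there is a real-analytic symplectic change of variables, close to the identity up to the complexification $z=(v+\mathrm iu)/\sqrt2$, from $(J,\psi,z,\overline z)\in U^2_{\widetilde r}\times\mathbb T^2_{\widetilde s}\times D^4_{\widetilde\rho}$ (form $dJ\wedge d\psi+\mathrm i\,dz\wedge d\overline z$) into the domain $\mathcal I^2_{\sigma_0}\times\mathbb T^2_{s_0}\times D^4_{\rho_0}$ of the variables $(I_0,\varphi_0,p_0,q_0)$, transforming $\mathcal H_0$ into the real-analytic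 Hamiltonian $$\mathcal H=h_\varepsilon(J)+\varepsilon\sum_j\widetilde\Omega_j(J)z_j\overline z_j+\varepsilon g(J,z,\overline z;\varepsilon)+\varepsilon^N f(J,\psi,z,\overline z;\varepsilon),$$ $h_\varepsilon=h_0+O(\varepsilon)$, $\widetilde r=\mathrm{const}\sqrt\varepsilon$, $\widetilde s,\widetilde\rho=\mathrm{const}$, $U=\{J\in\mathcal I:|h_0'(J)\cdot\ell|\ge\alpha_0\ \forall\ell\in\mathbb Z^2,0<|\ell|\le K\}$ (depending on $\varepsilon$), $K=\frac{6(N-1)}{s_0}\log\frac1\varepsilon$, $\alpha_0=2\sup_{\mathcal I_{\sigma_0}}|h_0''|\,\widetilde rK$; $f$ is bounded uniformly in $\varepsilon$, $|g|\le\mathrm{const}(|z|+|\overline z|)^3$, and $\widetilde\Omega_j\ge\chi_0$, $\widetilde\Omega_2-\widetilde\Omega_1\ge\chi_0$ on $U$ (with the same bounds for moduli on $U^2_{\widetilde r}$) for a constant $\chi_0>0$. *)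

(* Defs.v *)
From mathcomp Require Import all_boot all_order all_algebra.
From mathcomp Require Import all_classical all_reals all_analysis.
From mathcomp Require Import complex.

Set Implicit Arguments.
Unset Strict Implicit.
Unset Printing Implicit Defensive.

Import Order.TTheory GRing.Theory Num.Theory numFieldNormedType.Exports.

Local Open Scope classical_set_scope.
Local Open Scope ring_scope.

(* R[i] packaged as a numClosedFieldType, so that the topology, norm and
   differential calculus of numFieldTypes apply to it, to row vectors over it
   and to products of these. *)
Definition Cx (R : realType) : numClosedFieldType := R[i].

Definition toC (R : realType) (x : R) : Cx R := x%:C%C.
Definition reC (R : realType) (z : Cx R) : R := complex.Re z.
Definition imC (R : realType) (z : Cx R) : R := complex.Im z.
Definition absC (R : realType) (z : Cx R) : R := ComplexField.Normc.normc z.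

Definition rvecC (R : realType) (n : nat) (v : 'rV[R]_n) : 'rV[Cx R]_n :=
  map_mx (@toC R) v.
Definition conjv (R : realType) (n : nat) (z : 'rV[Cx R]_n) : 'rV[Cx R]_n :=
  map_mx (fun a : Cx R => a^*) z.
Definition ivec (R : realType) (n : nat) (v : 'rV[int]_n) : 'rV[R]_n :=
  map_mx (fun a : int => a%:~R) v.

Definition dotp (R : realType) (n : nat) (u v : 'rV[R]_n) : R :=
  \sum_j u 0 j * v 0 j.
Definition enorm (R : realType) (n : nat) (v : 'rV[R]_n) : R :=
  Num.sqrt (dotp v v).
Definition enormC (R : realType) (n : nat) (z : 'rV[Cx R]_n) : R :=
  Num.sqrt (\sum_j absC (z 0 j) ^+ 2).

(* Points (I, phi, p, q) or (J, psi, z, w). In the second case w stands for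
   \bar z: on complex domains z and w are independent, and the real phase space
   is { J, psi real, w = conjugate of z }. Angles are represented by lifts. *)
Definition phase (K : numFieldType) : Type :=
  ('rV[K]_2 * 'rV[K]_2 * 'rV[K]_2 * 'rV[K]_2)%type.
Definition phase_nopsi (K : numFieldType) : Type :=
  ('rV[K]_2 * 'rV[K]_2 * 'rV[K]_2)%type.

Definition slot1 (K : numFieldType) (x : phase K) := x.1.1.1.
Definition slot2 (K : numFieldType) (x : phase K) := x.1.1.2.
Definition slot3 (K : numFieldType) (x : phase K) := x.1.2.
Definition slot4 (K : numFieldType) (x : phase K) := x.2.

Definition forget_angle (K : numFieldType) (x : phase K) : phase_nopsi K :=
  (slot1 x, slot3 x, slot4 x).

Definition mkphase (K : numFieldType) (a b c d : 'rV[K]_2) : phase K :=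
  (a, b, c, d).
Definition unit_vec (K : numFieldType) (j : 'I_2) : 'rV[K]_2 := delta_mx 0 j.
Definition dir1 (K : numFieldType) (j : 'I_2) : phase K :=
  mkphase (unit_vec K j) 0 0 0.
Definition dir2 (K : numFieldType) (j : 'I_2) : phase K :=
  mkphase 0 (unit_vec K j) 0 0.
Definition dir3 (K : numFieldType) (j : 'I_2) : phase K :=
  mkphase 0 0 (unit_vec K j) 0.
Definition dir4 (K : numFieldType) (j : 'I_2) : phase K :=
  mkphase 0 0 0 (unit_vec K j).

Definition shift_angle (K : numFieldType) (x : phase K) (v : 'rV[K]_2) :
  phase K := mkphase (slot1 x) (slot2 x + v) (slot3 x) (slot4 x).

Definition enorm_phase (R : realType) (x : phase (Cx R)) : R :=
  Num.sqrt (enormC (slot1 x) ^+ 2 + enormC (slot2 x) ^+ 2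
            + enormC (slot3 x) ^+ 2 + enormC (slot4 x) ^+ 2).

Definition rphaseC (R : realType) (x : phase R) : phase (Cx R) :=
  mkphase (rvecC (slot1 x)) (rvecC (slot2 x)) (rvecC (slot3 x))
          (rvecC (slot4 x)).

(* dI /\ dphi + dp /\ dq *)
Definition sympl (K : numFieldType) (u v : phase K) : K :=
  \sum_j (slot1 u 0 j * slot2 v 0 j - slot1 v 0 j * slot2 u 0 j)
  + \sum_j (slot3 u 0 j * slot4 v 0 j - slot3 v 0 j * slot4 u 0 j).

(* dJ /\ dpsi + i dz /\ dw *)
Definition sympl_nf (R : realType) (u v : phase (Cx R)) : Cx R :=
  \sum_j (slot1 u 0 j * slot2 v 0 j - slot1 v 0 j * slot2 u 0 j)
  + 'i * \sum_j (slot3 u 0 j * slot4 v 0 j - slot3 v 0 j * slot4 u 0 j).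

(* Heliocentric phase space (x1, x2, X1, X2): positions relative to the star
   and conjugate momenta. *)
Definition helio (R : realType) : Type :=
  ('rV[R]_3 * 'rV[R]_3 * 'rV[R]_3 * 'rV[R]_3)%type.
Definition hpos (R : realType) (w : helio R) (i : 'I_2) : 'rV[R]_3 :=
  if i == 0 then w.1.1.1 else w.1.1.2.
Definition hmom (R : realType) (w : helio R) (i : 'I_2) : 'rV[R]_3 :=
  if i == 0 then w.1.2 else w.2.

(* sum_i dX_i /\ dx_i *)
Definition sympl_helio (R : realType) (u v : helio R) : R :=
  \sum_i (dotp (hmom u i) (hpos v i) - dotp (hmom v i) (hpos u i)).

(* A^d_delta; dist(z, A) < delta means that some point of A is at distance
   less than delta from z. *)
Definition cnbhd (R : realType) (A : set 'rV[R]_2) (delta : R) :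
  set 'rV[Cx R]_2 :=
  [set z | exists2 a, A a & enormC (z - rvecC a) < delta].

Definition strip (R : realType) (s : R) : set 'rV[Cx R]_2 :=
  [set z | forall j, `|imC (z 0 j)| < s].

(* D^4_rho, the points of C^4 = C^2 * C^2 *)
Definition cball4 (R : realType) (rho : R) (z w : 'rV[Cx R]_2) : Prop :=
  Num.sqrt (enormC z ^+ 2 + enormC w ^+ 2) < rho.

Definition cdom (R : realType) (A : set 'rV[R]_2) (delta s rho : R) :
  set (phase (Cx R)) :=
  [set x | [/\ cnbhd A delta (slot1 x), strip s (slot2 x)
             & cball4 rho (slot3 x) (slot4 x)]].
Definition cdom_nopsi (R : realType) (A : set 'rV[R]_2) (delta rho : R) :
  set (phase_nopsi (Cx R)) :=
  [set x | cnbhd A delta x.1.1 /\ cball4 rho x.1.2 x.2].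

Definition holo (R : realType) (V : normedModType (Cx R)) (D : set V)
  (W : normedModType (Cx R)) (F : V -> W) : Prop :=
  forall x, D x -> differentiable F x.

Definition angle_periodic (R : realType) (D : set (phase (Cx R)))
  (F : phase (Cx R) -> Cx R) : Prop :=
  forall x, D x -> forall n : 'rV[int]_2,
    F (shift_angle x (rvecC ((2 * pi) *: ivec R n))) = F x.

Definition grad (R : realType) (h : 'rV[Cx R]_2 -> Cx R) (I : 'rV[Cx R]_2) :
  'rV[Cx R]_2 := \row_j 'D_(unit_vec (Cx R) j) h I.
Definition hess (R : realType) (h : 'rV[Cx R]_2 -> Cx R) (I : 'rV[Cx R]_2) :
  'M[Cx R]_2 :=
  \matrix_(i, j) 'D_(unit_vec (Cx R) j) (fun I' => grad h I' 0 i) I.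

(* Largest modulus of an entry; for the diagonal matrices h_0''(I) this is the
   operator norm. *)
Definition mxnormC (R : realType) (A : 'M[Cx R]_2) : R :=
  \big[Order.max/0]_i \big[Order.max/0]_j absC (A i j).

(* The total momentum is zero, hence the star has momentum - (X1 + X2). *)
Definition newton_ham (R : realType) (m_0 : R) (m : 'I_2 -> R) (w : helio R) :
  R :=
  enorm (hmom w 0 + hmom w 1) ^+ 2 / (2 * m_0)
  + \sum_i enorm (hmom w i) ^+ 2 / (2 * m i)
  - \sum_i m_0 * m i / enorm (hpos w i)
  - m 0 * m 1 / enorm (hpos w 0 - hpos w 1).

Definition collisionless (R : realType) (w : helio R) : Prop :=
  [/\ hpos w 0 != 0, hpos w 1 != 0 & hpos w 0 != hpos w 1].

Definition cross (R : realType) (u v : 'rV[R]_3) : 'rV[R]_3 :=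
  \row_j (u 0 (j + 1) * v 0 (j + 2%:R) - u 0 (j + 2%:R) * v 0 (j + 1)).
Definition ang_mom (R : realType) (w : helio R) : 'rV[R]_3 :=
  \sum_i cross (hpos w i) (hmom w i).

(* Two-body (P_0, P_i) energy, with reduced mass m_0 m_i / (m_0 + m_i). *)
Definition kepler_energy (R : realType) (m_0 : R) (m : 'I_2 -> R) (w : helio R)
  (i : 'I_2) : R :=
  enorm (hmom w i) ^+ 2 / (2 * (m_0 * m i / (m_0 + m i)))
  - m_0 * m i / enorm (hpos w i).
(* Major semi-axis a of the osculating ellipse: energy = - m_0 m_i / (2 a). *)
Definition semi_axis (R : realType) (m_0 : R) (m : 'I_2 -> R) (w : helio R)
  (i : 'I_2) : R := - (m_0 * m i) / (2 * kepler_energy m_0 m w i).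

Definition kappa_star (R : realType) (m_0 : R) (m : 'I_2 -> R) (eps : R)
  (i : 'I_2) : R := m i / eps * (1 / Num.sqrt (m_0 * (m_0 + m i))).
Definition kappa (R : realType) (m_0 : R) (m : 'I_2 -> R) (eps : R)
  (i : 'I_2) : R := (m i / eps) ^+ 3 * (1 / (m_0 ^+ 2 * (m_0 + m i))).

Definition calL (R : realType) (m_0 : R) (m : 'I_2 -> R) (eps amin amax : R) :
  set 'rV[R]_2 :=
  [set L | exists a : 'I_2 -> R,
     [/\ amin <= a 0, a 0 < a 1, a 1 <= amax
       & forall i, L 0 i = kappa_star m_0 m eps i * Num.sqrt (a i)]].

Definition square (R : realType) (L0 : 'rV[R]_2) (eta : R) : set 'rV[R]_2 :=
  [set L | forall i, `|L 0 i - L0 0 i| < eta].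

Definition h0 (R : realType) (m_0 : R) (m : 'I_2 -> R) (eps : R)
  (I : 'rV[Cx R]_2) : Cx R :=
  - (1 / 2) * \sum_i toC (kappa m_0 m eps i) * (I 0 i) ^- 2.

Definition real_dom (R : realType) (A : set 'rV[R]_2) (rho : R) :
  set (phase R) :=
  [set x | A (slot1 x) /\
     Num.sqrt (enorm (slot3 x) ^+ 2 + enorm (slot4 x) ^+ 2) < rho].

(* Integral over T^2 of a 2 pi-periodic complex function. *)
Definition torus_integral (R : realType) (F : 'rV[R]_2 -> Cx R) :
  R * R :=
  let int2 (G : R -> R -> R) : R :=
    Rintegral lebesgue_measure `[0, 2 * pi] (fun a =>
      Rintegral lebesgue_measure `[0, 2 * pi] (fun b => G a b)) in
  let pt (a b : R) : 'rV[R]_2 := \row_j (if j == 0 then a else b) in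
  (int2 (fun a b => reC (F (pt a b))), int2 (fun a b => imC (F (pt a b)))).

Definition Nnf : nat := 4.

(* The quantities independent of eps. [bnd] bounds from above, and [om_min]
   from below, everything that is "const" in the hypotheses; [modulus] measures
   the closeness to the identity of the normal form transformation. *)
Record constants (R : realType) := Constants {
  m_0 : R; kappa_bar : R; a_min : R; a_max : R;
  sigma0 : R; s_0 : R; rho0 : R;
  r_const : R; s_nf : R; rho_nf : R;
  om_min : R; chi0 : R; bnd : R;
  eps0 : R; modulus : R -> R }.

Definition constants_ok (R : realType) (c : constants R) : Prop :=
  [/\ [/\ 0 < m_0 c, 0 < kappa_bar c, kappa_bar c <= 1, 0 < a_min c
        & a_min c < a_max c],
      [/\ 0 < sigma0 c, 0 < s_0 c & 0 < rho0 c],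
      [/\ 0 < r_const c, 0 < s_nf c & 0 < rho_nf c],
      [/\ 0 < om_min c, 0 < chi0 c & 0 < bnd c]
    & [/\ 0 < eps0 c, eps0 c <= 1
        & modulus c eps @[eps --> 0^'+] --> (0 : R)]].

(* The masses, coordinates and functions occurring for one value of eps:
   - [chart] expresses heliocentric variables through (I_0, phi_0, p_0, q_0);
   - [nf_map] is the normal form transformation (J, psi, z, w) |->
     (I_0, phi_0, p_0, q_0). *)
Record system (R : realType) := System {
  mass : 'I_2 -> R;
  Lam0 : 'rV[R]_2;
  side : R;
  chart : phase R -> helio R;
  f_1 : phase_nopsi (Cx R) -> Cx R;
  f_10 : 'rV[Cx R]_2 -> Cx R;
  Omb : 'I_2 -> 'rV[Cx R]_2 -> Cx R;
  f_1t : phase_nopsi (Cx R) -> Cx R;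
  f_2 : phase (Cx R) -> Cx R;
  nf_map : phase (Cx R) -> phase (Cx R);
  heps : 'rV[Cx R]_2 -> Cx R;
  Omt : 'I_2 -> 'rV[Cx R]_2 -> Cx R;
  g_nf : phase_nopsi (Cx R) -> Cx R;
  f_nf : phase (Cx R) -> Cx R }.

Section System.
Variables (R : realType) (c : constants R) (eps : R) (S : system R).

Definition calI : set 'rV[R]_2 := square (Lam0 S) (side S).
Definition h0S : 'rV[Cx R]_2 -> Cx R := h0 (m_0 c) (mass S) eps.

Definition H0 (x : phase (Cx R)) : Cx R :=
  h0S (slot1 x) + toC eps * f_1 S (forget_angle x) + toC eps * f_2 S x.

Definition masses_ok : Prop :=
  forall i, [/\ 0 < mass S i, kappa_bar c * eps <= mass S i / m_0 c
              & mass S i / m_0 c <= eps].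

(* [chart] parametrizes a transversal to the rotations in a level set of the
   angular momentum (reduction of the nodes). With I_0 = Lambda^* and kappa_i
   normalized as above, the symplectic form and the energy are those of the
   physical problem divided by eps m_0^(3/2) and eps m_0^2 respectively, i.e.
   sqrt(m_0) t is the time variable. *)
Definition delaunay_poincare_chart : Prop :=
  let D := real_dom calI (rho0 c) in
  [/\ forall x, D x ->
        [/\ differentiable (chart S) x,
            forall u v, sympl_helio ('d (chart S) x u) ('d (chart S) x v)
                        = eps * (m_0 c * Num.sqrt (m_0 c)) * sympl u v
          & collisionless (chart S x)],
      (forall x, D x -> forall n : 'rV[int]_2,
         chart S (shift_angle x ((2 * pi) *: ivec R n)) = chart S x)
      /\ (forall x y, D x -> D y -> chart S x = chart S y ->
            exists n : 'rV[int]_2, y = shift_angle x ((2 * pi) *: ivec R n)),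
      exists C0 : 'rV[R]_3, forall x, D x -> ang_mom (chart S x) = C0,
      forall x, D x -> forall i,
        kepler_energy (m_0 c) (mass S) (chart S x) i < 0 /\
        slot1 x 0 i = kappa_star (m_0 c) (mass S) eps i
                      * Num.sqrt (semi_axis (m_0 c) (mass S) (chart S x) i)
    & forall x, D x ->
        toC (newton_ham (m_0 c) (mass S) (chart S x))
        = toC (eps * m_0 c ^+ 2) * H0 (rphaseC x)].

Definition perturbation_ok : Prop :=
  let D1 := cdom_nopsi calI (sigma0 c) (rho0 c) in
  let D2 := cdom calI (sigma0 c) (s_0 c) (rho0 c) in
  let DI := cnbhd calI (sigma0 c) in
  [/\ [/\ holo D1 (f_1 S : _ -> Cx R), holo D2 (f_2 S : _ -> Cx R),
          angle_periodic D2 (f_2 S),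
          forall x, D1 x -> absC (f_1 S x) <= bnd c
        & forall x, D2 x -> absC (f_2 S x) <= bnd c],
      forall x : phase R, D2 (rphaseC x) ->
        imC (f_1 S (forget_angle (rphaseC x))) = 0
        /\ imC (f_2 S (rphaseC x)) = 0,
      forall I p q, D1 (I, p, q) ->
        [/\ f_1 S (I, p, q) = f_10 S I
              + \sum_j Omb S j I * ((p 0 j) ^+ 2 + (q 0 j) ^+ 2)
              + f_1t S (I, p, q),
            absC (f_1t S (I, p, q))
              <= bnd c * Num.sqrt (enormC p ^+ 2 + enormC q ^+ 2) ^+ 4,
            f_1t S (I, - p, - q) = f_1t S (I, p, q)
          & torus_integral (fun phi => f_2 S (mkphase I (rvecC phi) p q))
            = (0, 0)],
      forall I, calI I ->
        [/\ imC (Omb S 0 (rvecC I)) = 0, imC (Omb S 1 (rvecC I)) = 0,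
            forall j, om_min c <= reC (Omb S j (rvecC I))
          & om_min c <= reC (Omb S 1 (rvecC I) - Omb S 0 (rvecC I))]
    & forall I, DI I ->
        (forall j, om_min c <= absC (Omb S j I))
        /\ om_min c <= absC (Omb S 1 I - Omb S 0 I)].

Definition three_body_ok : Prop :=
  [/\ masses_ok,
      [/\ calL (m_0 c) (mass S) eps (a_min c) (a_max c) (Lam0 S),
          0 < side S
        & calI `<=` calL (m_0 c) (mass S) eps (a_min c) (a_max c)],
      holo (cnbhd calI (sigma0 c)) (h0S : _ -> Cx R)
      /\ (forall I, cnbhd calI (sigma0 c) I -> mxnormC (hess h0S I) <= bnd c),
      delaunay_poincare_chart
    & perturbation_ok].

Definition r_nf : R := r_const c * Num.sqrt eps.
Definition Kcut : R := 6 * (Nnf - 1)%N%:R / s_0 c * ln (1 / eps).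
Definition alpha0 : R :=
  2 * sup [set mxnormC (hess h0S I) | I in cnbhd calI (sigma0 c)]
    * r_nf * Kcut.

Definition l1norm (l : 'rV[int]_2) : R := \sum_j (absz (l 0 j))%:R.

Definition Uset : set 'rV[R]_2 :=
  [set J | calI J /\ forall l : 'rV[int]_2, 0 < l1norm l -> l1norm l <= Kcut ->
     alpha0 <= absC (\sum_j grad h0S (rvecC J) 0 j * (l 0 j)%:~R)].

Definition nf_dom : set (phase (Cx R)) := cdom Uset r_nf (s_nf c) (rho_nf c).

Definition Hnf (x : phase (Cx R)) : Cx R :=
  heps S (slot1 x)
  + toC eps * \sum_j Omt S j (slot1 x) * slot3 x 0 j * slot4 x 0 j
  + toC eps * g_nf S (forget_angle x)
  + toC eps ^+ Nnf * f_nf S x.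

(* (J, psi, z, w) |-> (J, psi, v, u), the inverse of z = (v + i u) / sqrt 2,
   w = (v - i u) / sqrt 2. *)
Definition decomplexify (x : phase (Cx R)) : phase (Cx R) :=
  mkphase (slot1 x) (slot2 x)
    ((toC (Num.sqrt 2))^-1 *: (slot3 x + slot4 x))
    (('i * toC (Num.sqrt 2))^-1 *: (slot3 x - slot4 x)).

Definition nf_point (J psi : 'rV[R]_2) (z : 'rV[Cx R]_2) : phase (Cx R) :=
  mkphase (rvecC J) (rvecC psi) z (conjv z).

Definition normal_form_map_ok : Prop :=
  [/\ holo nf_dom (nf_map S : _ -> phase (Cx R)),
      forall x, nf_dom x ->
        cdom calI (sigma0 c) (s_0 c) (rho0 c) (nf_map S x)
        /\ (forall n : 'rV[int]_2,
             nf_map S (shift_angle x (rvecC ((2 * pi) *: ivec R n)))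
             = shift_angle (nf_map S x) (rvecC ((2 * pi) *: ivec R n))),
      forall J psi z, nf_dom (nf_point J psi z) ->
        exists y : phase R, nf_map S (nf_point J psi z) = rphaseC y,
      forall x, nf_dom x -> forall u v,
        sympl ('d (nf_map S) x u) ('d (nf_map S) x v) = sympl_nf u v
    & forall x, nf_dom x ->
        enorm_phase (nf_map S x - decomplexify x) <= modulus c eps
        /\ H0 (nf_map S x) = Hnf x].

(* The relation h_eps = h_0 + O(eps) is meant in C^1 on the complex domain
   (r_nf being only O(sqrt eps), a C^0 bound would merely locate the solution of
   h_eps' = omega within O(sqrt eps)), and the frequencies Omt are bounded
   uniformly in eps. *)
Definition normal_form_ok : Prop :=
  let DJ := cnbhd Uset r_nf in
  let DJz := cdom_nopsi Uset r_nf (rho_nf c) in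
  [/\ [/\ holo DJ (heps S : _ -> Cx R),
          (forall j, holo DJ (Omt S j : _ -> Cx R)),
          holo DJz (g_nf S : _ -> Cx R), holo nf_dom (f_nf S : _ -> Cx R)
        & angle_periodic nf_dom (f_nf S)],
      forall J psi z, nf_dom (nf_point J psi z) ->
        [/\ imC (heps S (rvecC J)) = 0,
            forall j, imC (Omt S j (rvecC J)) = 0,
            imC (g_nf S (forget_angle (nf_point J psi z))) = 0
          & imC (f_nf S (nf_point J psi z)) = 0],
      forall J, DJ J ->
        [/\ absC (heps S J - h0S J) <= bnd c * eps,
            enormC (grad (heps S) J - grad h0S J) <= bnd c * eps,
            forall j, chi0 c <= absC (Omt S j J),
            chi0 c <= absC (Omt S 1 J - Omt S 0 J)
          & forall j, absC (Omt S j J) <= bnd c],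
      forall J, Uset J ->
        (forall j, chi0 c <= reC (Omt S j (rvecC J)))
        /\ chi0 c <= reC (Omt S 1 (rvecC J) - Omt S 0 (rvecC J))
    & (forall J z w, DJz (J, z, w) ->
         absC (g_nf S (J, z, w)) <= bnd c * (enormC z + enormC w) ^+ 3)
      /\ (forall x, nf_dom x -> absC (f_nf S x) <= bnd c)].

Definition three_body_normal_form : Prop :=
  [/\ three_body_ok, normal_form_map_ok & normal_form_ok].
End System.

(* Real trajectories t |-> (J, psi, z), the angle psi being lifted to R^2. *)
Definition state (R : realType) : Type :=
  ('rV[R]_2 * 'rV[R]_2 * 'rV[Cx R]_2)%type.
Definition stJ (R : realType) (x : state R) := x.1.1.
Definition stpsi (R : realType) (x : state R) := x.1.2.
Definition stz (R : realType) (x : state R) := x.2.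

Definition stateC (R : realType) (x : state R) : phase (Cx R) :=
  nf_point (stJ x) (stpsi x) (stz x).

Definition has_derivC (R : realType) (F : R -> Cx R) (t : R) (d : Cx R) :
  Prop :=
  is_derive t (1 : R) (fun s => reC (F s)) (reC d) /\
  is_derive t (1 : R) (fun s => imC (F s)) (imC d).

Definition solution (R : realType) (D : set (phase (Cx R)))
  (H : phase (Cx R) -> Cx R) (zeta : R -> state R) : Prop :=
  forall t, D (stateC (zeta t)) /\
  forall j : 'I_2,
  [/\ has_derivC (fun s => slot1 (stateC (zeta s)) 0 j) t
        (- 'D_(dir2 (Cx R) j) H (stateC (zeta t))),
      has_derivC (fun s => slot2 (stateC (zeta s)) 0 j) t
        ('D_(dir1 (Cx R) j) H (stateC (zeta t))),
      has_derivC (fun s => slot3 (stateC (zeta s)) 0 j) t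
        ('i * 'D_(dir4 (Cx R) j) H (stateC (zeta t)))
    & has_derivC (fun s => slot4 (stateC (zeta s)) 0 j) t
        (- ('i * 'D_(dir3 (Cx R) j) H (stateC (zeta t))))].

Definition same_state (R : realType) (x y : state R) : Prop :=
  [/\ stJ x = stJ y,
      exists n : 'rV[int]_2, stpsi x = stpsi y + (2 * pi) *: ivec R n
    & stz x = stz y].

Definition periodic_traj (R : realType) (T : R) (zeta : R -> state R) : Prop :=
  forall t, same_state (zeta (t + T)) (zeta t).

Definition geom_distinct (R : realType) (zeta zeta' : R -> state R) : Prop :=
  ~ exists tau, forall t, same_state (zeta' t) (zeta (t + tau)).

Definition state_dist (R : realType) (x y : state R) : R :=
  Num.sqrt (enorm (stJ x - stJ y) ^+ 2 + enorm (stpsi x - stpsi y) ^+ 2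
            + enormC (stz x - stz y) ^+ 2).

Definition quasi_traj (R : realType) (J psi0 omega : 'rV[R]_2) (t : R) :
  state R := (J, psi0 + t *: omega, 0).

(* Main.v *)
(* Put J_eps for the solution of h_eps' = omega near J_0: h_0'' is diagonal and
   nondegenerate, so J_eps is found by contraction. In coordinates (a, psi, v, u)
   with a = J - J_eps and z = (v + i u)/sqrt 2, the Hamiltonian is
   omega.a + (quadratic in a, v, u) + P, where Cauchy estimates on the polydisc
   |a| <= eps^3, |v|, |u| <= eps^2 make the gradient of P so small that, as
   T <= 1/(c_1 eps), for every initial phase psi_0 the equations have a unique
   small T-periodic solution once the mean of the torque is subtracted from the
   right-hand side (Lyapunov-Schmidt reduction). The action of this solution is a
   function on the torus of phases whose derivative is the subtracted mean, so
   its maximum and its minimum are attained at genuine periodic orbits. If the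
   two values differ, the orbits are distinct since the action does not change
   under time translation; if they agree, every phase gives a periodic orbit and
   one compares two phases which are transverse to the direction of omega. *)
Require Import Defs.
From mathcomp Require Import all_boot all_order all_algebra.
From mathcomp Require Import all_classical all_reals all_analysis.
From mathcomp Require Import complex ring lra zify.

Set Implicit Arguments.
Unset Strict Implicit.
Unset Printing Implicit Defensive.

Import Order.TTheory GRing.Theory Num.Theory numFieldNormedType.Exports.

Local Open Scope classical_set_scope.
Local Open Scope ring_scope.

(** The weights balance the drift over one period: with $T\le 1/(c_1\varepsilon)$ a torque of size
    $\varepsilon^4$ moves the actions by $\varepsilon^3$, and such an action offset moves the angles
    by $\varepsilon^2$. No nonresonance condition on the elliptic frequencies appears, because they
    are $O(\varepsilon)$: the oscillating part of a component is integrated with norm $O(T)$, and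
    its mean is found by dividing the mean force by the frequency. This division costs a factor
    $\varepsilon$, so a force of order $\varepsilon^3$ would not be small enough; the missing factor
    $\sqrt\varepsilon$ comes from the width $\sqrt\varepsilon$ of the action domain compared with
    the distance $O(\varepsilon)$ from $J_0$ to the torus. Holomorphy is assumed only as
    differentiability at each point, so the Cauchy estimates rest on Goursat's bisection. Fixed
    points are sought among plain functions, with period, size and Lipschitz constant as conditions
    that survive pointwise limits. The action is never differentiated: an expansion with quadratic
    error already makes its extrema critical. *)

Local Notation dof := (bool * 'I_2)%type.
Local Notation crd := (bool * dof)%type.

(** * Goursat's theorem for rectangles *)

Section Segment.
Context {R : realType}.
Implicit Types (f g : R -> R) (a b k : R).

Definition ri f a b : R := \int[lebesgue_measure]_(x in `[a, b]) f x.

(** Continuity relative to the segment, written with epsilon and delta: slices of functions of two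
    variables and restrictions to subsegments then inherit it directly, endpoints included. *)
Definition segcont f a b : Prop :=
  forall x, a <= x <= b -> forall e, 0 < e -> exists2 d, 0 < d &
    forall y, a <= y <= b -> `|y - x| < d -> `|f y - f x| <= e.

Lemma segcontP f a b : segcont f a b -> {within `[a, b], continuous f}.
Proof.
move=> cf; apply/subspace_continuousP => x /=; rewrite in_itv/= => xab.
apply/cvgrPdist_le => e e0; have [d d0 H] := cf x xab e e0.
rewrite near_withinE; near=> y => yab; have {}yab : a <= y <= b by move: yab; rewrite /= in_itv.
by rewrite distrC; apply: H => //; rewrite distrC; near: y; exists d.
Unshelve. all: by end_near. Qed.

Lemma segcont_int f a b : segcont f a b ->
  lebesgue_measure.-integrable `[a, b] (EFin \o f).
Proof.
move=> cf; apply: continuous_compact_integrable; first exact: segment_compact.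
exact: segcontP.
Qed.

Lemma segcontS f a b a' b' : a <= a' -> b' <= b -> segcont f a b -> segcont f a' b'.
Proof.
move=> aa bb cf x /andP[ax xb] e e0.
have [|d d0 H] := cf x _ e e0; first by rewrite (le_trans aa) ?(le_trans xb).
by exists d => // y /andP[ay yb]; apply: H; rewrite (le_trans aa) ?(le_trans yb).
Qed.

Lemma segcontD f g a b : segcont f a b -> segcont g a b ->
  segcont (fun x => f x + g x) a b.
Proof.
move=> cf cg x xab e e0; have e20 : 0 < e / 2 by lra.
have [d d0 H] := cf x xab _ e20; have [d' d'0 H'] := cg x xab _ e20.
exists (Num.min d d') => [|y yab]; first by rewrite lt_min d0.
rewrite lt_min => /andP[yd yd'].
have -> : f y + g y - (f x + g x) = (f y - f x) + (g y - g x) by ring.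
rewrite (le_trans (ler_normD _ _))// [e]splitr lerD ?H ?H'//.
Qed.

Lemma segcontN f a b : segcont f a b -> segcont (fun x => - f x) a b.
Proof.
move=> cf x xab e e0; have [d d0 H] := cf x xab _ e0.
exists d => // y yab yd.
by rewrite opprK addrC distrC H.
Qed.

Lemma ri_split f a b c : a <= b -> b <= c -> segcont f a c ->
  ri f a c = ri f a b + ri f b c.
Proof.
move=> ab bc cf; have /segcont_int fi := cf.
have := @Rintegral_itvB R f (BLeft a) (BRight c) b fi.
rewrite !bnd_simp => /(_ ab bc) H.
have E : \int[lebesgue_measure]_(x in `]b, c]) f x = \int[lebesgue_measure]_(x in `[b, c]) f x.
  apply: (@Rintegral_itv_obnd_cbnd R b (BRight c) f).
  apply: integrableS fi => //.
  by apply: subset_itv; rewrite bnd_simp.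
by rewrite /ri -E -H; ring.
Qed.

Lemma riD f g a b : segcont f a b -> segcont g a b ->
  ri (fun x => f x + g x) a b = ri f a b + ri g a b.
Proof.
by move=> cf cg; rewrite /ri RintegralD//; exact: segcont_int.
Qed.

Lemma ri_ub f a b k : a <= b -> segcont f a b ->
  (forall x, a <= x <= b -> f x <= k) -> ri f a b <= k * (b - a).
Proof.
move=> ab cf fk.
have <- : ri (fun=> k) a b = k * (b - a).
  rewrite /ri Rintegral_cst//= lebesgue_measure_itv/= lte_fin.
  case: ltP => [//|ba]/=.
  have -> : a = b by apply/eqP; rewrite eq_le ab.
  by rewrite subrr.
apply: le_Rintegral => //; first exact: segcont_int.
apply: segcont_int => x _ e e0; exists 1 => // y _ _.
by rewrite subrr normr0 ltW.
Qed.

Lemma riN f a b : segcont f a b -> ri (fun x => - f x) a b = - ri f a b.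
Proof.
move=> cf; rewrite /ri.
rewrite (_ : (fun x => - f x) = (fun x => (-1) * f x)); last by apply/funext => x; rewrite mulN1r.
by rewrite RintegralZl//; [rewrite mulN1r|exact: segcont_int].
Qed.

Lemma ri_lb f a b k : a <= b -> segcont f a b ->
  (forall x, a <= x <= b -> k <= f x) -> k * (b - a) <= ri f a b.
Proof.
move=> ab cf fk; rewrite -lerN2 -riN// -mulNr; apply: ri_ub => //.
  exact: segcontN.
by move=> x xab; rewrite lerN2 fk.
Qed.

Lemma ri_ext f g a b : (forall x, a <= x <= b -> f x = g x) -> ri f a b = ri g a b.
Proof.
by move=> fg; apply: eq_Rintegral => x; rewrite inE/= in_itv/=; apply: fg.
Qed.
End Segment.

Section Goursat.
Context {R : realType}.
Implicit Types (P Q : R -> R -> R).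

Definition rectcont P x1 x2 y1 y2 : Prop :=
  forall p q, x1 <= p <= x2 -> y1 <= q <= y2 -> forall e, 0 < e ->
  exists2 d, 0 < d & forall x y, x1 <= x <= x2 -> y1 <= y <= y2 ->
    `|x - p| < d -> `|y - q| < d -> `|P x y - P p q| <= e.

(* The differential of [P dx + Q dy] vanishes at every point of the rectangle;
   the derivatives need not be continuous. *)
Definition closed_form P Q x1 x2 y1 y2 : Prop :=
  forall p q, x1 <= p <= x2 -> y1 <= q <= y2 -> exists al be ga : R,
  forall e, 0 < e -> exists2 d, 0 < d &
  forall x y, x1 <= x <= x2 -> y1 <= y <= y2 -> `|x - p| < d -> `|y - q| < d ->
    `|P x y - P p q - (al * (x - p) + be * (y - q))| <= e * (`|x - p| + `|y - q|) /\
    `|Q x y - Q p q - (be * (x - p) + ga * (y - q))| <= e * (`|x - p| + `|y - q|).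

(** The counterclockwise boundary integral of [P dx + Q dy]. Opposite sides share one integral, so
    that the constant parts of [P] and [Q] cancel under the integral sign. *)
Definition oint P Q x1 x2 y1 y2 : R :=
  ri (fun t => P t y1 - P t y2) x1 x2 + ri (fun t => Q x2 t - Q x1 t) y1 y2.

Lemma rectcont_x P x1 x2 y1 y2 y : rectcont P x1 x2 y1 y2 -> y1 <= y <= y2 ->
  segcont (fun t => P t y) x1 x2.
Proof.
move=> cP yy p pp e e0; have [d d0 H] := cP p y pp yy e e0.
by exists d => // x xx xd; apply: H => //; rewrite subrr normr0.
Qed.

Lemma rectcont_y P x1 x2 y1 y2 x : rectcont P x1 x2 y1 y2 -> x1 <= x <= x2 ->
  segcont (P x) y1 y2.
Proof.
move=> cP xx q qq e e0; have [d d0 H] := cP x q xx qq e e0.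
by exists d => // y yy yd; apply: H => //; rewrite subrr normr0.
Qed.

Lemma rectcontS P x1 x2 y1 y2 x1' x2' y1' y2' : x1 <= x1' -> x2' <= x2 ->
  y1 <= y1' -> y2' <= y2 ->
  rectcont P x1 x2 y1 y2 -> rectcont P x1' x2' y1' y2'.
Proof.
move=> h1 h2 h3 h4 cP p q /andP[p1 p2] /andP[q1 q2] e e0.
have [||d d0 H] := cP p q _ _ e e0; try lra.
by exists d => // x y xx yy; apply: H; lra.
Qed.

Lemma rectcont_affine P x1 x2 y1 y2 :
  (forall p q, x1 <= p <= x2 -> y1 <= q <= y2 -> exists al be : R,
    forall e, 0 < e -> exists2 d, 0 < d &
    forall x y, x1 <= x <= x2 -> y1 <= y <= y2 -> `|x - p| < d -> `|y - q| < d ->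
    `|P x y - P p q - (al * (x - p) + be * (y - q))| <= e * (`|x - p| + `|y - q|)) ->
  rectcont P x1 x2 y1 y2.
Proof.
move=> H p q pp qq e e0; have [al [be]] := H p q pp qq.
move=> /(_ 1 ltr01)[d d0 K].
pose k := `|al| + `|be| + 2.
have k0 : 0 < k by rewrite /k; have := normr_ge0 al; have := normr_ge0 be; lra.
exists (Num.min d (e / k)) => [|x y xx yy].
  by rewrite lt_min d0 divr_gt0.
rewrite !lt_min => /andP[xd xk] /andP[yd yk].
have := K x y xx yy xd yd; rewrite mul1r => {}K.
have -> : P x y - P p q = (P x y - P p q - (al * (x - p) + be * (y - q))) + (al * (x - p) + be * (y - q)) by ring.
rewrite (le_trans (ler_normD _ _))// (le_trans (lerD K (ler_normD _ _)))//.
rewrite !normrM.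
have -> : e = k * (e / k) by rewrite mulrC divfK// gt_eqF.
have : `|al| * `|x - p| <= `|al| * (e/k) by rewrite ler_wpM2l// ltW.
have : `|be| * `|y - q| <= `|be| * (e/k) by rewrite ler_wpM2l// ltW.
rewrite /k; lra.
Qed.

Lemma closed_form_cont P Q x1 x2 y1 y2 : closed_form P Q x1 x2 y1 y2 ->
  rectcont P x1 x2 y1 y2 /\ rectcont Q x1 x2 y1 y2.
Proof.
move=> H; split; apply: rectcont_affine => p q pp qq;
  have [al [be [ga K]]] := H p q pp qq.
- exists al, be => e e0; have [d d0 L] := K e e0; exists d => // x y xx yy xd yd.
  by have [] := L x y xx yy xd yd.
- exists be, ga => e e0; have [d d0 L] := K e e0; exists d => // x y xx yy xd yd.
  by have [] := L x y xx yy xd yd.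
Qed.

Lemma oint_splitx P Q x1 xm x2 y1 y2 : x1 <= xm -> xm <= x2 -> y1 <= y2 ->
  rectcont P x1 x2 y1 y2 -> rectcont Q x1 x2 y1 y2 ->
  oint P Q x1 x2 y1 y2 = oint P Q x1 xm y1 y2 + oint P Q xm x2 y1 y2.
Proof.
move=> h1 h2 h3 cP cQ; rewrite /oint (@ri_split _ _ x1 xm x2)//; last first.
  apply: segcontD; last apply: segcontN; apply: rectcont_x cP _; lra.
rewrite (@ri_ext _ (fun t => Q x2 t - Q x1 t)
  (fun t => (Q xm t - Q x1 t) + (Q x2 t - Q xm t))); last by move=> *; ring.
rewrite (@riD R (fun t => Q xm t - Q x1 t)); first by ring.
- apply: segcontD; last apply: segcontN; apply: rectcont_y cQ _; lra.
- apply: segcontD; last apply: segcontN; apply: rectcont_y cQ _; lra.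
Qed.

Lemma oint_splity P Q x1 x2 y1 ym y2 : y1 <= ym -> ym <= y2 -> x1 <= x2 ->
  rectcont P x1 x2 y1 y2 -> rectcont Q x1 x2 y1 y2 ->
  oint P Q x1 x2 y1 y2 = oint P Q x1 x2 y1 ym + oint P Q x1 x2 ym y2.
Proof.
move=> h1 h2 h3 cP cQ; rewrite /oint (@ri_split _ (fun t => Q x2 t - Q x1 t) y1 ym y2)//; last first.
  apply: segcontD; last apply: segcontN; apply: rectcont_y cQ _; lra.
rewrite (@ri_ext _ (fun t => P t y1 - P t y2)
  (fun t => (P t y1 - P t ym) + (P t ym - P t y2))); last by move=> *; ring.
rewrite (@riD R (fun t => P t y1 - P t ym)); first by ring.
- apply: segcontD; last apply: segcontN; apply: rectcont_x cP _; lra.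
- apply: segcontD; last apply: segcontN; apply: rectcont_x cP _; lra.
Qed.

(** For the affine approximation the paired integrands are the constants [- be * h] and [be * w];
    integrated over lengths [w] and [h] they cancel, because [P] and [Q] share the cross coefficient
    [be]. Only the remainders survive, each at most [e] times the half-perimeter. *)
Lemma oint_small P Q x1 x2 y1 y2 p q al be ga e :
  x1 <= p <= x2 -> y1 <= q <= y2 -> 0 <= e ->
  rectcont P x1 x2 y1 y2 -> rectcont Q x1 x2 y1 y2 ->
  (forall x y, x1 <= x <= x2 -> y1 <= y <= y2 ->
    `|P x y - P p q - (al * (x - p) + be * (y - q))| <= e * (`|x - p| + `|y - q|) /\
    `|Q x y - Q p q - (be * (x - p) + ga * (y - q))| <= e * (`|x - p| + `|y - q|)) ->
  `|oint P Q x1 x2 y1 y2| <= 2 * e * (x2 - x1 + (y2 - y1)) ^+ 2.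
Proof.
move=> pp qq e0 cP cQ H.
set w := x2 - x1; set h := y2 - y1.
have S x y : x1 <= x <= x2 -> y1 <= y <= y2 -> `|x - p| + `|y - q| <= w + h.
  move=> xx yy; apply: lerD; rewrite ler_norml /w /h; lra.
have SP t : x1 <= t <= x2 -> `|P t y1 - P t y2 + be * h| <= 2 * e * (w + h).
  move=> tt; have [] := H t y1 tt; first lra; move=> A _.
  have [] := H t y2 tt; first lra; move=> B _.
  have -> : P t y1 - P t y2 + be * h =
    (P t y1 - P p q - (al * (t - p) + be * (y1 - q))) -
    (P t y2 - P p q - (al * (t - p) + be * (y2 - q))) by rewrite /h; ring.
  rewrite (le_trans (ler_normB _ _))// (le_trans (lerD A B))//.
  have -> : 2 * e * (w + h) = e * (w + h) + e * (w + h) by ring.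
  by apply: lerD; apply: ler_wpM2l => //; apply: S => //; lra.
have SQ t : y1 <= t <= y2 -> `|Q x2 t - Q x1 t - be * w| <= 2 * e * (w + h).
  move=> tt; have [] := H x1 t _ tt; first lra; move=> _ A.
  have [] := H x2 t _ tt; first lra; move=> _ B.
  have -> : Q x2 t - Q x1 t - be * w =
    (Q x2 t - Q p q - (be * (x2 - p) + ga * (t - q))) -
    (Q x1 t - Q p q - (be * (x1 - p) + ga * (t - q))) by rewrite /w; ring.
  rewrite (le_trans (ler_normB _ _))// (le_trans (lerD B A))//.
  have -> : 2 * e * (w + h) = e * (w + h) + e * (w + h) by ring.
  by apply: lerD; apply: ler_wpM2l => //; apply: S => //; lra.
have cP' : segcont (fun t => P t y1 - P t y2) x1 x2.
  by apply: segcontD; last apply: segcontN; apply: rectcont_x cP _; lra.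
have cQ' : segcont (fun t => Q x2 t - Q x1 t) y1 y2.
  by apply: segcontD; last apply: segcontN; apply: rectcont_y cQ _; lra.
have lx : x1 <= x2 by lra. have ly : y1 <= y2 by lra.
have P1 : `|ri (fun t => P t y1 - P t y2) x1 x2 + be * h * w| <= 2 * e * (w + h) * w.
  have A := @ri_ub R _ x1 x2 (2 * e * (w + h) - be * h) lx cP' _.
  have B := @ri_lb R _ x1 x2 (- (2 * e * (w + h)) - be * h) lx cP' _.
  rewrite ler_norml; apply/andP; split.
    have := B; rewrite -/w => {}B; rewrite -lerBlDr; apply: le_trans (B _) => [|x /SP]; first lra.
    by rewrite ler_norml; lra.
  have := A; rewrite -/w => {}A; rewrite -lerBrDr; apply: le_trans (A _) _ => [x /SP|]; last lra.
  by rewrite ler_norml; lra.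
have Q1 : `|ri (fun t => Q x2 t - Q x1 t) y1 y2 - be * w * h| <= 2 * e * (w + h) * h.
  have A := @ri_ub R _ y1 y2 (2 * e * (w + h) + be * w) ly cQ' _.
  have B := @ri_lb R _ y1 y2 (- (2 * e * (w + h)) + be * w) ly cQ' _.
  rewrite ler_norml; apply/andP; split.
    have := B; rewrite -/h => {}B; rewrite -lerBlDr; apply: le_trans (B _) => [|x /SQ]; first lra.
    by rewrite ler_norml; lra.
  have := A; rewrite -/h => {}A; rewrite -lerBrDr; apply: le_trans (A _) _ => [x /SQ|]; last lra.
  by rewrite ler_norml; lra.
have -> : oint P Q x1 x2 y1 y2 = (ri (fun t => P t y1 - P t y2) x1 x2 + be * h * w) +
  (ri (fun t => Q x2 t - Q x1 t) y1 y2 - be * w * h) by rewrite /oint; ring.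
rewrite (le_trans (ler_normD _ _))// (le_trans (lerD P1 Q1))//.
by rewrite le_eqVlt; apply/orP; left; apply/eqP; ring.
Qed.

(** Interior sides are traversed twice in opposite directions, so the four quarter integrals add up
    to the whole one and cannot all be smaller than a quarter of it. *)
Lemma oint_quarter P Q x y w h K : 0 <= w -> 0 <= h ->
  rectcont P x (x + w) y (y + h) -> rectcont Q x (x + w) y (y + h) ->
  K <= `|oint P Q x (x + w) y (y + h)| ->
  exists s : R * R, [/\ x <= s.1, s.1 + w / 2 <= x + w, y <= s.2, s.2 + h / 2 <= y + h &
    K / 4 <= `|oint P Q s.1 (s.1 + w / 2) s.2 (s.2 + h / 2)|].
Proof.
move=> w0 h0 cP cQ HK.
have [xl xr] : x <= x + w / 2 /\ x + w / 2 <= x + w by clear -w0; lra.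
have [yl yr] : y <= y + h / 2 /\ y + h / 2 <= y + h by clear -h0; lra.
have xx := le_trans xl xr; have yy := le_trans yl yr.
apply: contrapT => N.
have A a b : x <= a -> a + w / 2 <= x + w -> y <= b -> b + h / 2 <= y + h ->
    `|oint P Q a (a + w / 2) b (b + h / 2)| < K / 4.
  move=> h1 h2 h3 h4; rewrite ltNge; apply/negP => h5; apply: N.
  by exists (a, b).
have A1 := A x y; have A2 := A (x + w / 2) y; have A3 := A x (y + h / 2).
have A4 := A (x + w / 2) (y + h / 2).
have ew : x + w / 2 + w / 2 = x + w by field.
have eh : y + h / 2 + h / 2 = y + h by field.
rewrite ew ?eh in A2 A4; rewrite eh in A3 A4.
move: HK; rewrite (@oint_splitx P Q x (x + w / 2))//.
rewrite (@oint_splity P Q x _ y (y + h / 2))//; last 2 first.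
- exact: rectcontS cP.
- exact: rectcontS cQ.
rewrite (@oint_splity P Q (x + w / 2) _ y (y + h / 2))//; last 2 first.
- exact: rectcontS cP.
- exact: rectcontS cQ.
move: (A1 (lexx _) xr (lexx _) yr) (A2 xl (lexx _) (lexx _) yr).
move: (A3 (lexx _) xr yl (lexx _)) (A4 xl (lexx _) yl (lexx _)).
set a1 := oint _ _ _ _ _ _; set a2 := oint _ _ _ _ _ _.
set a3 := oint _ _ _ _ _ _; set a4 := oint _ _ _ _ _ _.
have := ler_normD (a3 + a1) (a4 + a2); have := ler_normD a3 a1; have := ler_normD a4 a2.
clear; lra.
Qed.

Lemma half_powers_small (u d : R) : 0 < d -> exists n, u / 2 ^+ n < d.
Proof.
move=> d0; exists (Num.bound (u / d)).
rewrite ltr_pdivrMr ?exprn_gt0// mulrC -ltr_pdivrMr//.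
exact: upper_nthrootP.
Qed.

(** The supremum of the left ends lies below every right end. The lemma serves both the bisection of
    rectangles and the convergence of contraction iterates. *)
Lemma nested_halves (a : nat -> R) (w : R) : 0 <= w ->
  (forall n, a n <= a n.+1) ->
  (forall n, a n.+1 + w / 2 ^+ n.+1 <= a n + w / 2 ^+ n) ->
  exists p, forall n, a n <= p <= a n + w / 2 ^+ n.
Proof.
move=> w0 ha hb.
have ma m n : (m <= n)%N -> a m <= a n.
  by move=> /subnK <-; elim: (n - m)%N => // k IH; rewrite addSn (le_trans IH).
have mb m n : (m <= n)%N -> a n + w / 2 ^+ n <= a m + w / 2 ^+ m.
  by move=> /subnK <-; elim: (n - m)%N => // k IH; rewrite addSn (le_trans (hb _)).
have ab m n : a m <= a n + w / 2 ^+ n.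
  have [mn|nm] := leqP m n.
    by rewrite (le_trans (ma _ _ mn))// lerDl divr_ge0 ?exprn_ge0.
  by rewrite (le_trans _ (mb _ _ (ltnW nm)))// lerDl divr_ge0 ?exprn_ge0.
exists (sup (range a)) => n; apply/andP; split.
  apply: ub_le_sup; last by exists n.
  by exists (a 0%N + w / 2 ^+ 0) => _ [m _ <-].
apply: ge_sup; first by exists (a 0%N), 0%N.
by move=> _ [m _ <-].
Qed.

(** Bisection keeps the integral at least [eta / 4 ^ n] on a rectangle of half-perimeter
    [(w + h) / 2 ^ n]. Differentiability at the common point bounds it by a small multiple of the
    square of that half-perimeter, which decays at the same rate [4 ^ n]; a small enough multiple is
    contradictory. *)
Theorem goursat P Q x1 x2 y1 y2 : x1 <= x2 -> y1 <= y2 ->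
  closed_form P Q x1 x2 y1 y2 -> oint P Q x1 x2 y1 y2 = 0.
Proof.
move=> lx ly cl; apply/eqP; rewrite -normr_le0 leNgt; apply/negP.
set eta := `|_| => eta0.
have [cP cQ] := closed_form_cont cl.
pose w := x2 - x1; pose h := y2 - y1.
have w0 : 0 <= w by rewrite subr_ge0.
have h0 : 0 <= h by rewrite subr_ge0.
pose W n := w / 2 ^+ n; pose H n := h / 2 ^+ n.
have W0 n : 0 <= W n by rewrite divr_ge0 ?exprn_ge0.
have H0 n : 0 <= H n by rewrite divr_ge0 ?exprn_ge0.
have WS n : W n.+1 = W n / 2.
  by rewrite /W exprS; field; rewrite expf_neq0 ?pnatr_eq0.
have HS n : H n.+1 = H n / 2.
  by rewrite /H exprS; field; rewrite expf_neq0 ?pnatr_eq0.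
pose good n (s : R * R) := [/\ x1 <= s.1, s.1 + W n <= x2, y1 <= s.2, s.2 + H n <= y2 &
  eta / 4 ^+ n <= `|oint P Q s.1 (s.1 + W n) s.2 (s.2 + H n)|].
(* The choice is made for arbitrary pairs, with the default [(0, 0)] where [good] fails, so that
   [choice] yields a total function to iterate. *)
have step (ns : nat * (R * R)) : exists s' : R * R, good ns.1 ns.2 ->
    good ns.1.+1 s' /\ [/\ ns.2.1 <= s'.1, s'.1 + W ns.1.+1 <= ns.2.1 + W ns.1,
      ns.2.2 <= s'.2 & s'.2 + H ns.1.+1 <= ns.2.2 + H ns.1].
  case: ns => n s /=; have [gs|ns] := pselect (good n s); last by exists (0, 0).
  case: gs => g1 g2 g3 g4 g5.
  have [||s' [k1 k2 k3 k4 k5]] := oint_quarter (W0 n) (H0 n) _ _ g5.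
  - exact: rectcontS cP.
  - exact: rectcontS cQ.
  exists s' => _; split; rewrite ?WS ?HS; last by split.
  split; rewrite ?WS ?HS.
  - exact: le_trans k1.
  - exact: le_trans g2.
  - exact: le_trans k3.
  - exact: le_trans g4.
  by rewrite exprSr invfM mulrA.
have [F HF] := choice step.
pose s := fix s n := if n is m.+1 then F (m, s m) else (x1, y1).
have gs n : good n (s n).
  elim: n => [|n IH]; last by have [] := HF (n, s n) IH.
  rewrite /good /W /H /= !expr0 !divr1 /w /h.
  have e1 : x1 + (x2 - x1) = x2 by ring.
  have e2 : y1 + (y2 - y1) = y2 by ring.
  by rewrite e1 e2; split.
have [p Hp] : exists p, forall n, (s n).1 <= p <= (s n).1 + w / 2 ^+ n.
  by apply: nested_halves => // n; have [_ [h1 h2 h3 h4]] := HF (n, s n) (gs n); [exact: h1|exact: h2].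
have [q Hq] : exists q, forall n, (s n).2 <= q <= (s n).2 + h / 2 ^+ n.
  by apply: nested_halves => // n; have [_ [h1 h2 h3 h4]] := HF (n, s n) (gs n); [exact: h3|exact: h4].
have px : x1 <= p <= x2.
  have := Hp 0%N; rewrite /= expr0 divr1 /w; clear; lra.
have qy : y1 <= q <= y2.
  have := Hq 0%N; rewrite /= expr0 divr1 /h; clear; lra.
have [al [be [ga D]]] := cl p q px qy.
pose k := (w + h) ^+ 2.
have k0 : 0 <= k by rewrite exprn_ge0// addr_ge0.
(* With this tolerance the upper bound is the fraction [k / (k + 1) / 2] of the lower bound
   [eta / 4 ^ n]; the [+ 1] admits a degenerate rectangle, where [k = 0]. *)
have e0 : 0 < eta / (4 * (k + 1)) by rewrite divr_gt0// mulr_gt0// ltr_wpDl.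
have [d d0 {}D] := D _ e0.
have [n Hn] := half_powers_small (w + h) d0.
have [g1 g2 g3 g4 g5] := gs n.
have Wd : W n < d.
  by apply: le_lt_trans Hn; rewrite /W ler_wpM2r ?invr_ge0 ?exprn_ge0// lerDl.
have Hd : H n < d.
  by apply: le_lt_trans Hn; rewrite /H ler_wpM2r ?invr_ge0 ?exprn_ge0// lerDr.
have := @oint_small P Q (s n).1 ((s n).1 + W n) (s n).2 ((s n).2 + H n) p q al be ga _
  (Hp n) (Hq n) (ltW e0) (rectcontS g1 g2 g3 g4 cP) (rectcontS g1 g2 g3 g4 cQ).
move: (Hp n) (Hq n); rewrite -/(W n) -/(H n) => Hpn Hqn.
move=> /(_ _)/(le_trans g5).
have e1 : (s n).1 + W n - (s n).1 = W n by ring.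
have e2 : (s n).2 + H n - (s n).2 = H n by ring.
rewrite e1 e2 => B.
have {B} : eta / 4 ^+ n <= 2 * (eta / (4 * (k + 1))) * (W n + H n) ^+ 2.
  apply: B => x y /andP[xa xb] /andP[ya yb]; apply: D.
  - by rewrite (le_trans g1 xa) (le_trans xb g2).
  - by rewrite (le_trans g3 ya) (le_trans yb g4).
  - apply: le_lt_trans Wd; rewrite ler_norml; clear -xa xb Hpn; lra.
  - apply: le_lt_trans Hd; rewrite ler_norml; clear -ya yb Hqn; lra.
have -> : (W n + H n) ^+ 2 = k / 4 ^+ n.
  rewrite /W /H /k -mulrDl expr_div_n -exprM mulnC exprM.
  by congr (_ / _ ^+ _); ring.
have -> : 2 * (eta / (4 * (k + 1))) * (k / 4 ^+ n) = (eta / 4 ^+ n) * (k / (k + 1) / 2).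
  by field; rewrite expf_neq0 ?pnatr_eq0//= gt_eqF// ltr_wpDl.
rewrite leNgt => /negP; apply.
rewrite -[ltRHS]mulr1 ltr_pM2l ?divr_gt0 ?exprn_gt0//.
rewrite ltr_pdivrMr// mul1r ltr_pdivrMr ?ltr_wpDl//; clear -k0; lra.
Qed.
End Goursat.

(** * The Cauchy estimate *)

Section Modulus.
Context {R : realType}.
Implicit Types (z w : Cx R) (x y : R).

Lemma absCE z : absC z = Num.sqrt (reC z ^+ 2 + imC z ^+ 2).
Proof. by case: z. Qed.

Lemma absCM z w : absC (z * w) = absC z * absC w.
Proof. exact: ComplexField.Normc.normcM. Qed.

Lemma absCD z w : absC (z + w) <= absC z + absC w.
Proof. exact: le_normcD. Qed.

Lemma absC0 : absC (0 : Cx R) = 0.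
Proof. exact: ComplexField.Normc.normc0. Qed.

Lemma absC_ge0 z : 0 <= absC z.
Proof. by rewrite absCE sqrtr_ge0. Qed.

Lemma absCN z : absC (- z) = absC z.
Proof. exact: normcN. Qed.

Lemma absCB z w : absC (z - w) <= absC z + absC w.
Proof. by rewrite -[absC w]absCN absCD. Qed.

Lemma absCV z : absC z^-1 = (absC z)^-1.
Proof. exact: ComplexField.Normc.normcV. Qed.

Lemma absC_eq0 z : absC z = 0 -> z = 0.
Proof. exact: ComplexField.Normc.eq0_normc. Qed.

Lemma absC_gt0 z : (0 < absC z) = (z != 0).
Proof.
rewrite lt_def absC_ge0 andbT; congr (~~ _).
by apply/eqP/eqP => [/absC_eq0|->]; rewrite ?absC0.
Qed.

Lemma absC_toC x : absC (toC x) = `|x|.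
Proof. by rewrite absCE /= expr0n/= addr0 sqrtr_sqr. Qed.

Lemma sqr_absC z : absC z ^+ 2 = reC z ^+ 2 + imC z ^+ 2.
Proof. by rewrite absCE sqr_sqrtr// addr_ge0 ?sqr_ge0. Qed.

Lemma re_le_absC z : `|reC z| <= absC z.
Proof. by rewrite absCE -sqrtr_sqr ler_wsqrtr// lerDl sqr_ge0. Qed.

Lemma im_le_absC z : `|imC z| <= absC z.
Proof. by rewrite absCE -sqrtr_sqr ler_wsqrtr// lerDr sqr_ge0. Qed.

Lemma absC_le z : absC z <= `|reC z| + `|imC z|.
Proof.
rewrite -(ler_pXn2r (ltn0Sn 1)) ?nnegrE ?absC_ge0 ?addr_ge0//.
rewrite sqr_absC -[reC z ^+ 2]real_normK ?num_real// -[imC z ^+ 2]real_normK ?num_real//.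
rewrite sqrrD addrAC lerDl mulrn_wge0// mulr_ge0.
Qed.

Lemma reCD z w : reC (z + w) = reC z + reC w.
Proof. by case: z; case: w. Qed.
Lemma imCD z w : imC (z + w) = imC z + imC w.
Proof. by case: z; case: w. Qed.
Lemma reCN z : reC (- z) = - reC z.
Proof. by case: z. Qed.
Lemma imCN z : imC (- z) = - imC z.
Proof. by case: z. Qed.
Lemma reCM z w : reC (z * w) = reC z * reC w - imC z * imC w.
Proof. by case: z; case: w. Qed.
Lemma imCM z w : imC (z * w) = reC z * imC w + imC z * reC w.
Proof. by case: z => a b; case: w => c d /=; rewrite /imC /= addrC [b * c]mulrC mulrC. Qed.

(** Complex differentiability as a little-o relation with real tolerances. It concerns one point
    only, and it can be restricted to real increments without change. *)
Definition cder (phi : Cx R -> Cx R) (z d : Cx R) : Prop :=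
  forall e, 0 < e -> exists2 dl, 0 < dl & forall h : Cx R, absC h < dl ->
    absC (phi (z + h) - phi z - d * h) <= e * absC h.

Lemma cder_id z : cder id z 1.
Proof.
move=> e e0; exists 1 => // h _.
have -> : id (z + h) - id z - 1 * h = 0 by rewrite /=; ring.
by rewrite absC0 mulr_ge0 ?absC_ge0// ltW.
Qed.

Lemma cderD f g z a b : cder f z a -> cder g z b -> cder (fun w => f w + g w) z (a + b).
Proof.
move=> Hf Hg e e0; have e20 : 0 < e / 2 by rewrite divr_gt0.
have [d1 d10 H1] := Hf _ e20; have [d2 d20 H2] := Hg _ e20.
exists (Num.min d1 d2) => [|h]; first by rewrite lt_min d10.
rewrite lt_min => /andP[h1 h2].
have -> : f (z + h) + g (z + h) - (f z + g z) - (a + b) * h =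
  (f (z + h) - f z - a * h) + (g (z + h) - g z - b * h) by ring.
rewrite (le_trans (absCD _ _))//.
have -> : e * absC h = e / 2 * absC h + e / 2 * absC h by field.
by rewrite lerD ?H1 ?H2.
Qed.

Lemma cderZ c f z a : cder f z a -> cder (fun w => c * f w) z (c * a).
Proof.
move=> Hf e e0; have k0 : 0 < absC c + 1 by rewrite ltr_wpDl ?absC_ge0.
have [d1 d10 H1] := Hf _ (divr_gt0 e0 k0); exists d1 => // h /H1 {}H1.
have -> : c * f (z + h) - c * f z - c * a * h = c * (f (z + h) - f z - a * h) by ring.
rewrite absCM (le_trans (ler_wpM2l (absC_ge0 _) H1))//.
rewrite mulrA ler_wpM2r ?absC_ge0// mulrCA ger_pMr// ler_pdivrMr// mul1r lerDl//.
Qed.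

Lemma cderN f z a : cder f z a -> cder (fun w => - f w) z (- a).
Proof.
move=> /(cderZ (-1)); rewrite mulN1r => H.
by rewrite (_ : (fun w => - f w) = (fun w => -1 * f w))//; apply/funext => w; rewrite mulN1r.
Qed.

Lemma cder_bound f z a : cder f z a -> exists2 dl, 0 < dl & forall h, absC h < dl ->
  absC (f (z + h) - f z) <= (absC a + 1) * absC h.
Proof.
move=> /(_ 1 ltr01)[d d0 H]; exists d => // h /H {}H.
have -> : f (z + h) - f z = (f (z + h) - f z - a * h) + a * h by ring.
rewrite (le_trans (absCD _ _))// absCM mulrDl addrC lerD//.
Qed.

Lemma cderM f g z a b : cder f z a -> cder g z b ->
  cder (fun w => f w * g w) z (a * g z + f z * b).
Proof.
move=> Hf Hg e e0.
(* [k] majorizes every factor met in the product rule. Two terms cost a quarter of [e] each, and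
   [d5] bounds the product of the two increments by another quarter. *)
pose k := absC (f z) + absC (g z) + (absC b + 1) + (absC a + 1).
have k0 : 0 < k by rewrite /k; have := absC_ge0 (f z); have := absC_ge0 (g z);
  have := absC_ge0 a; have := absC_ge0 b; lra.
have ek : 0 < e / (4 * k) by rewrite divr_gt0// mulr_gt0.
have [d1 d10 H1] := Hf _ ek; have [d2 d20 H2] := Hg _ ek.
have [d3 d30 H3] := cder_bound Hf; have [d4 d40 H4] := cder_bound Hg.
pose d5 := e / (4 * (k * k)).
have d50 : 0 < d5 by rewrite divr_gt0// !mulr_gt0.
exists (Num.min (Num.min d1 d2) (Num.min (Num.min d3 d4) d5)) => [|h].
  by rewrite !lt_min d10 d20 d30 d40 d50.
rewrite !lt_min => /andP[/andP[/H1 {}H1 /H2 {}H2] /andP[/andP[/H3 {}H3 /H4 {}H4] hd]].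
have -> : f (z + h) * g (z + h) - f z * g z - (a * g z + f z * b) * h =
  (f (z + h) - f z - a * h) * g z + f z * (g (z + h) - g z - b * h) +
  (f (z + h) - f z) * (g (z + h) - g z) by ring.
rewrite (le_trans (absCD _ _))// (le_trans (lerD (absCD _ _) (lexx _)))// !absCM.
have p1 : absC (f (z + h) - f z - a * h) * absC (g z) <= e / (4 * k) * absC h * k.
  apply: ler_pM; rewrite ?absC_ge0//.
  rewrite /k; have := absC_ge0 (f z); have := absC_ge0 a; have := absC_ge0 b; clear; lra.
have p2 : absC (f z) * absC (g (z + h) - g z - b * h) <= k * (e / (4 * k) * absC h).
  apply: ler_pM; rewrite ?absC_ge0//.
  rewrite /k; have := absC_ge0 (g z); have := absC_ge0 a; have := absC_ge0 b; clear; lra.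
have p3 : absC (f (z + h) - f z) * absC (g (z + h) - g z) <= (k * absC h) * (k * d5).
  apply: ler_pM; rewrite ?absC_ge0//.
    apply: (le_trans H3); rewrite ler_wpM2r ?absC_ge0//.
    rewrite /k; have := absC_ge0 (g z); have := absC_ge0 (f z); have := absC_ge0 b; clear; lra.
  apply: (le_trans H4); apply: ler_pM; rewrite ?absC_ge0 ?addr_ge0 ?absC_ge0//; last exact: ltW.
  rewrite /k; have := absC_ge0 (g z); have := absC_ge0 (f z); have := absC_ge0 a; clear; lra.
have -> : e * absC h = e / (4 * k) * absC h * k + k * (e / (4 * k) * absC h) + (k * absC h) * (k * d5)
   + e / 4 * absC h.
  by rewrite /d5; field; exact: lt0r_neq0.
have := mulr_ge0 (ltW (divr_gt0 e0 (ltr0Sn R 3))) (absC_ge0 h).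
clear -p1 p2 p3; lra.
Qed.

Lemma cderV z : z != 0 -> cder (fun w => w^-1) z (- z ^- 2).
Proof.
move=> z0 e e0; have az : 0 < absC z by rewrite absC_gt0.
(* The remainder is exactly [h * h * (z ^- 2 * (z + h)^-1)], and [z + h] keeps at least half the
   modulus of [z]; this radius therefore produces the factor [e]. *)
pose d := e * absC z ^+ 3 / 2.
have d0 : 0 < d by rewrite divr_gt0// mulr_gt0// exprn_gt0.
exists (Num.min (absC z / 2) d) => [|h]; first by rewrite lt_min d0 divr_gt0.
rewrite lt_min => /andP[hz hd].
have zh : absC z / 2 <= absC (z + h).
  have := absCB (z + h) h; rewrite addrK; clear -hz; lra.
have zh0 : z + h != 0 by rewrite -absC_gt0 (lt_le_trans _ zh)// divr_gt0.
have -> : (z + h)^-1 - z^-1 - - z ^- 2 * h = h * h * (z ^- 2 * (z + h)^-1).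
  by field; rewrite z0 zh0.
rewrite !absCM !absCV !expr2 !absCM mulrAC ler_wpM2r ?absC_ge0//.
have -> : e = d * ((absC z * absC z)^-1 * (absC z / 2)^-1).
  by rewrite /d; field; exact: lt0r_neq0.
apply: ler_pM; rewrite ?absC_ge0//; [|exact: ltW|].
  by rewrite mulr_ge0// invr_ge0 ?mulr_ge0 ?absC_ge0.
rewrite ler_pM2l ?invr_gt0 ?mulr_gt0// lef_pV2// posrE ?divr_gt0//.
by rewrite absC_gt0.
Qed.
End Modulus.

Section Cauchy.
Context {R : realType}.
Implicit Types (z w : Cx R) (x y : R).

Definition cpt x y : Cx R := Complex x y.

Lemma reC_cpt x y : reC (cpt x y) = x.
Proof. by []. Qed.

Lemma imC_cpt x y : imC (cpt x y) = y.
Proof. by []. Qed.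

Lemma cptB x y p q : cpt x y - cpt p q = cpt (x - p) (y - q).
Proof. by []. Qed.

Lemma absC_cpt x y : absC (cpt x y) <= `|x| + `|y|.
Proof. exact: absC_le. Qed.

(** The form is the imaginary part of [g dz], and the Cauchy-Riemann equations supply the common
    cross coefficient, the real part of the derivative. The imaginary part is the useful one: the
    contour integral of [1 / w] is purely imaginary, so it detects the real part of a residue. *)
Lemma closed_form_cder (g : Cx R -> Cx R) x1 x2 y1 y2 :
  (forall x y, x1 <= x <= x2 -> y1 <= y <= y2 -> exists d, cder g (cpt x y) d) ->
  closed_form (fun x y => imC (g (cpt x y))) (fun x y => reC (g (cpt x y))) x1 x2 y1 y2.
Proof.
move=> H p q pp qq; have [D HD] := H p q pp qq.
exists (imC D), (reC D), (- imC D) => e e0; have [d d0 K] := HD e e0.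
exists (d / 2) => [|x y _ _ xd yd]; first by rewrite divr_gt0.
have hle := absC_cpt (x - p) (y - q).
have {K} := K (cpt (x - p) (y - q)) _.
rewrite -cptB addrCA subrr addr0 cptB => K.
have {}K : absC (g (cpt x y) - g (cpt p q) - D * cpt (x - p) (y - q)) <= e * (`|x - p| + `|y - q|).
  apply: le_trans (ler_wpM2l (ltW e0) hle); apply: K.
  by apply: (le_lt_trans hle); rewrite [d]splitr ltrD.
split; apply: le_trans K.
  apply: le_trans (im_le_absC _); rewrite !imCD !imCN imCM /= [X in _ - X]addrC.
  by rewrite lexx.
apply: le_trans (re_le_absC _); rewrite !reCD !reCN reCM /= mulNr.
by rewrite lexx.
Qed.

Lemma oint_expand (P Q : R -> R -> R) x1 x2 y1 y2 : x1 <= x2 -> y1 <= y2 ->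
  closed_form P Q x1 x2 y1 y2 ->
  0 = ri (P^~ y1) x1 x2 - ri (P^~ y2) x1 x2 + (ri (Q x2) y1 y2 - ri (Q x1) y1 y2).
Proof.
move=> lx ly cl; rewrite -(goursat lx ly cl) /oint.
have [cP cQ] := closed_form_cont cl.
have s1 := rectcont_x cP (introT andP (conj (lexx y1) ly)).
have s2 := rectcont_x cP (introT andP (conj ly (lexx y2))).
have s3 := rectcont_y cQ (introT andP (conj (lexx x1) lx)).
have s4 := rectcont_y cQ (introT andP (conj lx (lexx x2))).
rewrite riD//; last exact: segcontN.
rewrite riN// riD//; last exact: segcontN.
by rewrite riN.
Qed.

Lemma ri_norm (f : R -> R) a b k : a <= b -> segcont f a b ->
  (forall x, a <= x <= b -> `|f x| <= k) -> `|ri f a b| <= k * (b - a).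
Proof.
move=> ab cf H; rewrite ler_norml -mulNr ri_ub ?ri_lb// => x /H.
  by rewrite ler_norml => /andP[].
by rewrite ler_norml => /andP[].
Qed.

(* The contour integral of phi(w)/w^2 over the boundaries of the squares
   |Re w|, |Im w| <= dl and <= s agree, and as dl -> 0 the former tends to
   phi'(0) times the contour integral of 1/w. *)
Lemma cauchy_odd (phi : Cx R -> Cx R) (s M e : R) (D : Cx R) :
  0 < s -> 0 < e -> phi 0 = 0 -> cder phi 0 D ->
  (forall w, absC w <= 2 * s -> exists d, cder phi w d) ->
  (forall w, absC w <= 2 * s -> absC (phi w) <= M) ->
  reC D <= 2 * M / s + 2 * e.
Proof.
move=> s0 e0 phi0 D0 dphi Mphi.
have [d d0 Hd] := D0 e e0.
(* On the boundary of the inner square [|w| <= 2 * dl < d], so the expansion of [phi] at 0 applies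
   there; [s / 2] keeps that square inside the outer one. *)
pose dl := Num.min (s / 2) (d / 3).
have dl0 : 0 < dl by rewrite lt_min !divr_gt0.
have dls : dl <= s / 2 by rewrite /dl ge_min lexx.
have dld : dl <= d / 3 by rewrite /dl ge_min lexx orbT.
pose g w := phi w * (w^-1 * w^-1).
pose P x y := imC (g (cpt x y)); pose Q x y := reC (g (cpt x y)).
have dg x y : - s <= x <= s -> - s <= y <= s -> cpt x y != 0 -> exists d, cder g (cpt x y) d.
  move=> xs ys n0; have [|d' Hd'] := dphi (cpt x y).
    apply: (le_trans (absC_cpt _ _)); rewrite (_ : 2 * s = s + s); last by ring.
    by apply: lerD; rewrite ler_norml.
  by eexists; exact: (cderM Hd' (cderM (cderV n0) (cderV n0))).
have nx x y : x != 0 -> cpt x y != 0 by apply: contra_neq => -[].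
have ny x y : y != 0 -> cpt x y != 0 by apply: contra_neq => -[].
have bnd x y : - s <= x <= s -> - s <= y <= s -> s <= absC (cpt x y) ->
    `|P x y| <= M / s ^+ 2 /\ `|Q x y| <= M / s ^+ 2.
  move=> xs ys ge; have Mw : absC (phi (cpt x y)) <= M.
    apply: Mphi; apply: (le_trans (absC_cpt _ _)); rewrite (_ : 2 * s = s + s); last by ring.
    by apply: lerD; rewrite ler_norml.
  have : absC (g (cpt x y)) <= M / s ^+ 2.
    rewrite /g !absCM !absCV -invfM -expr2.
    apply: ler_pM; rewrite ?invr_ge0 ?exprn_ge0 ?absC_ge0//.
    by rewrite lef_pV2 ?posrE ?exprn_gt0 ?(lt_le_trans s0 ge)// ler_pXn2r ?nnegrE ?absC_ge0 ?(ltW s0).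
  by split; [exact: le_trans (im_le_absC _) _|exact: le_trans (re_le_absC _) _].
have near x y : absC (cpt x y) < d -> absC (phi (cpt x y) - D * cpt x y) <= e * absC (cpt x y).
  by move=> /Hd; rewrite add0r phi0 subr0.
(* The leading part [D / w] of [g] is removed at two points at once; at each of them the error is at
   most [e / |w|], hence [e / dl]. *)
have gap x y x' y' c : absC (cpt x y) < d -> absC (cpt x' y') < d ->
    dl <= absC (cpt x y) -> dl <= absC (cpt x' y') ->
    D * (cpt x y)^-1 - D * (cpt x' y')^-1 = c ->
    absC (g (cpt x y) - g (cpt x' y') - c) <= 2 * e / dl.
  move=> h1 h2 h3 h4 <-.
  have E a b : absC (cpt a b) < d -> dl <= absC (cpt a b) ->
      absC (g (cpt a b) - D * (cpt a b)^-1) <= e / dl.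
    move=> k1 k2; have k3 : 0 < absC (cpt a b) := lt_le_trans dl0 k2.
    have k4 : cpt a b != 0 by rewrite -absC_gt0.
    have -> : g (cpt a b) - D * (cpt a b)^-1 =
      (phi (cpt a b) - D * cpt a b) * ((cpt a b)^-1 * (cpt a b)^-1) by rewrite /g; field.
    rewrite !absCM absCV (le_trans (ler_wpM2r _ (near _ _ k1)))//.
      by rewrite mulr_ge0 ?invr_ge0 ?absC_ge0.
    rewrite mulrA mulfK ?gt_eqF// ler_wpM2l ?(ltW e0)// lef_pV2//.
  have -> : g (cpt x y) - g (cpt x' y') - (D / cpt x y - D / cpt x' y') =
    (g (cpt x y) - D / cpt x y) - (g (cpt x' y') - D / cpt x' y') by ring.
  rewrite (le_trans (absCB _ _))// (le_trans (lerD (E _ _ h1 h3) (E _ _ h2 h4)))//.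
  by rewrite -mulrDl; lra.
have M0 : 0 <= M by apply: le_trans (Mphi 0 _); rewrite ?absC_ge0 // absC0 mulr_ge0 ?ltW.
(* A negative real part satisfies the bound trivially; otherwise its sign allows the lower bound on
   the kernel below to be multiplied by it. *)
have [Dneg|D_ge0] := ltP (reC D) 0.
  apply: (le_trans (ltW Dneg)); rewrite addr_ge0 ?divr_ge0 ?mulr_ge0 ?(ltW s0) ?(ltW e0)//.
have ltd x y : `|x| <= dl -> `|y| <= dl -> absC (cpt x y) < d.
  by move=> h1 h2; apply: (le_lt_trans (absC_cpt _ _)); clear -h1 h2 dld d0; lra.
(* Between opposite sides [1 / w] jumps by a real or purely imaginary amount of size
   [2 * dl / (dl ^ 2 + t ^ 2)]. The crude bound [1 / dl] replaces the exact integral, so 4 stands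
   where the residue theorem would give [2 * pi]. *)
have K t : - dl <= t <= dl -> exists k, [/\ dl^-1 <= k,
    (cpt dl t)^-1 - (cpt (- dl) t)^-1 = cpt k 0 & (cpt t (- dl))^-1 - (cpt t dl)^-1 = cpt 0 k].
  move=> td; have N0 : 0 < dl ^+ 2 + t ^+ 2 by rewrite ltr_pwDl ?exprn_gt0 ?sqr_ge0.
  exists (2 * dl / (dl ^+ 2 + t ^+ 2)); split.
  - rewrite ler_pdivlMr// mulrC ler_pdivrMr//.
    have : t ^+ 2 <= dl ^+ 2 by rewrite -[t ^+ 2]real_normK ?num_real// ler_pXn2r ?nnegrE ?(ltW dl0)// ler_norml.
    rewrite !expr2; clear; lra.
  - have -> : (cpt dl t)^-1 = cpt (dl / (dl ^+ 2 + t ^+ 2)) (- (t / (dl ^+ 2 + t ^+ 2))) by [].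
    have -> : (cpt (-dl) t)^-1 = cpt (- dl / ((- dl) ^+ 2 + t ^+ 2)) (- (t / ((- dl) ^+ 2 + t ^+ 2))) by [].
    rewrite sqrrN cptB subrr (_ : dl / _ - _ = 2 * dl / (dl ^+ 2 + t ^+ 2))//.
    by field; exact: lt0r_neq0.
  - have -> : (cpt t (-dl))^-1 = cpt (t / (t ^+ 2 + (- dl) ^+ 2)) (- (- dl / (t ^+ 2 + (- dl) ^+ 2))) by [].
    have -> : (cpt t dl)^-1 = cpt (t / (t ^+ 2 + dl ^+ 2)) (- (dl / (t ^+ 2 + dl ^+ 2))) by [].
    rewrite sqrrN cptB subrr (_ : - (- dl / _) - _ = 2 * dl / (dl ^+ 2 + t ^+ 2))//.
    by rewrite addrC in N0; rewrite (addrC (dl ^+ 2)); field; exact: lt0r_neq0.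
have dlabs : `|dl| <= dl by rewrite ger0_norm ?(ltW dl0).
have dlabs' : `|- dl| <= dl by rewrite normrN.
have rd x y : dl <= `|x| -> dl <= absC (cpt x y).
  by move=> h; apply: le_trans h (re_le_absC (cpt x y)).
have id x y : dl <= `|y| -> dl <= absC (cpt x y).
  by move=> h; apply: le_trans h (im_le_absC (cpt x y)).
have dla : dl <= `|dl| by rewrite ler_norm.
have dla' : dl <= `|- dl| by rewrite normrN.
have gapQ t : - dl <= t <= dl -> (reC D - 2 * e) / dl <= Q dl t - Q (- dl) t.
  move=> td; have [k [k1 k2 _]] := K t td; have ta : `|t| <= dl by rewrite ler_norml.
  have := gap dl t (- dl) t _ (ltd _ _ dlabs ta) (ltd _ _ dlabs' ta) (rd _ _ dla) (rd _ _ dla') erefl.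
  move=> /(le_trans (re_le_absC _)).
  rewrite -mulrBr k2 !reCD !reCN [reC (D * _)]reCM reC_cpt imC_cpt mulr0 subr0 ler_norml => /andP[+ _].
  have : reC D * dl^-1 <= reC D * k by rewrite ler_wpM2l.
  by rewrite -/(Q _ _) -/(Q _ _) mulrBl; clear; lra.
have gapP t : - dl <= t <= dl -> (reC D - 2 * e) / dl <= P t (- dl) - P t dl.
  move=> td; have [k [k1 _ k2]] := K t td; have ta : `|t| <= dl by rewrite ler_norml.
  have := gap t (- dl) t dl _ (ltd _ _ ta dlabs') (ltd _ _ ta dlabs) (id _ _ dla') (id _ _ dla) erefl.
  move=> /(le_trans (im_le_absC _)).
  rewrite -mulrBr k2 !imCD !imCN [imC (D * _)]imCM reC_cpt imC_cpt mulr0 addr0 ler_norml => /andP[+ _].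
  have : reC D * dl^-1 <= reC D * k by rewrite ler_wpM2l.
  by rewrite -/(P _ _) -/(P _ _) mulrBl; clear; lra.
have [h1 [h2 h3]] : - s <= - dl /\ - dl <= dl /\ dl <= s by clear -dls dl0 s0; lra.
have h4 : - s <= s := le_trans h1 (le_trans h2 h3).
have dlN : 0 < `|dl| by rewrite normr_gt0 gt_eqF.
(* The square annulus is cut into two side rectangles of full height and two caps above and below
   the hole; none of them contains the origin. *)
have cR : closed_form P Q dl s (- s) s.
  apply: closed_form_cder => x y /andP[x1 x2] /andP[y1 y2]; apply: dg.
  - by rewrite x2 andbT (le_trans h1 (le_trans h2 x1)).
  - by rewrite y1.
  - by apply: nx; rewrite gt_eqF// (lt_le_trans dl0).
have cL : closed_form P Q (- s) (- dl) (- s) s.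
  apply: closed_form_cder => x y /andP[x1 x2] /andP[y1 y2]; apply: dg.
  - by rewrite x1/= (le_trans x2 (le_trans h2 h3)).
  - by rewrite y1.
  - by apply: nx; rewrite lt_eqF// (le_lt_trans x2)// oppr_lt0.
have cT : closed_form P Q (- dl) dl dl s.
  apply: closed_form_cder => x y /andP[x1 x2] /andP[y1 y2]; apply: dg.
  - by rewrite (le_trans h1 x1) (le_trans x2 h3).
  - by rewrite y2 andbT (le_trans h1 (le_trans h2 y1)).
  - by apply: ny; rewrite gt_eqF// (lt_le_trans dl0).
have cB : closed_form P Q (- dl) dl (- s) (- dl).
  apply: closed_form_cder => x y /andP[x1 x2] /andP[y1 y2]; apply: dg.
  - by rewrite (le_trans h1 x1) (le_trans x2 h3).
  - by rewrite y1/= (le_trans y2 (le_trans h2 h3)).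
  - by apply: ny; rewrite lt_eqF// (le_lt_trans y2)// oppr_lt0.
have eR := oint_expand h3 h4 cR. have eL := oint_expand h1 h4 cL.
have eT := oint_expand h2 h3 cT. have eB := oint_expand h2 h1 cB.
have [[PR QR] [PL QL]] := (closed_form_cont cR, closed_form_cont cL).
have [[PT QT] [PB QB]] := (closed_form_cont cT, closed_form_cont cB).
have i1 : - s <= - s <= s by rewrite lexx.
have i2 : - s <= s <= s by rewrite lexx andbT.
have sabs : s <= `|s| by rewrite ler_norm.
have sabs' : s <= `|- s| by rewrite normrN.
have bx x y : s <= `|x| -> s <= absC (cpt x y).
  by move=> h; apply: le_trans h (re_le_absC (cpt x y)).
have by' x y : s <= `|y| -> s <= absC (cpt x y).
  by move=> h; apply: le_trans h (im_le_absC (cpt x y)).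
have split3 f : segcont f (- s) s ->
    ri f (- s) s = ri f (- s) (- dl) + ri f (- dl) dl + ri f dl s.
  move=> cf; rewrite (@ri_split _ f _ (- dl) s) ?(le_trans h2)//.
  rewrite (@ri_split _ f (- dl) dl s)//; first by ring.
  exact: segcontS h1 (lexx _) cf.
have h23 : - dl <= s := le_trans h2 h3.
have h12 : - s <= dl := le_trans h1 h2.
have cQ1 : segcont (Q dl) (- s) s by apply: rectcont_y QR _; rewrite lexx.
have cQ2 : segcont (Q (- dl)) (- s) s by apply: rectcont_y QL _; rewrite lexx andbT.
have cQ1' := segcontS h1 h3 cQ1. have cQ2' := segcontS h1 h3 cQ2.
have cP1 : segcont (P^~ dl) (- dl) dl by apply: rectcont_x PT _; rewrite lexx.
have cP2 : segcont (P^~ (- dl)) (- dl) dl by apply: rectcont_x PB _; rewrite lexx andbT.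
have S1 := split3 _ cQ1. have S2 := split3 _ cQ2.
have inner1 : (reC D - 2 * e) / dl * (dl - - dl) <= ri (Q dl) (- dl) dl - ri (Q (- dl)) (- dl) dl.
  rewrite -riN// -riD//; last exact: segcontN.
  by apply: ri_lb => //; apply: segcontD => //; exact: segcontN.
have inner2 : (reC D - 2 * e) / dl * (dl - - dl) <= ri (P^~ (- dl)) (- dl) dl - ri (P^~ dl) (- dl) dl.
  rewrite -riN// -riD//; last exact: segcontN.
  by apply: ri_lb => //; apply: segcontD => //; exact: segcontN.
have in12 : (reC D - 2 * e) / dl * (dl - - dl) = 2 * (reC D - 2 * e) by field; exact: lt0r_neq0.
rewrite in12 in inner1 inner2.
pose m := M / s ^+ 2.
have b1 x1 x2 y : - s <= x1 -> x1 <= x2 -> x2 <= s -> (y = s \/ y = - s) ->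
    segcont (P^~ y) x1 x2 -> `|ri (P^~ y) x1 x2| <= m * (x2 - x1).
  move=> a1 a2 a3 yy c; apply: ri_norm => // x /andP[xa xb].
  have xs : - s <= x <= s by rewrite (le_trans a1 xa) (le_trans xb a3).
  by case: yy => ->; [have [] := bnd x s xs i2 (by' _ _ sabs)|have [] := bnd x (- s) xs i1 (by' _ _ sabs')].
have b2 x : (x = s \/ x = - s) ->
    segcont (Q x) (- s) s -> `|ri (Q x) (- s) s| <= m * (s - - s).
  move=> xx c; apply: ri_norm => // y ys.
  by case: xx => ->; [have [] := bnd s y i2 ys (bx _ _ sabs)|have [] := bnd (- s) y i1 ys (bx _ _ sabs')].
have k1 := b1 dl s (- s) h12 h3 (lexx _) (or_intror erefl) (rectcont_x PR i1).
have k2 := b1 dl s s h12 h3 (lexx _) (or_introl erefl) (rectcont_x PR i2).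
have k3 := b1 (- s) (- dl) (- s) (lexx _) h1 h23 (or_intror erefl) (rectcont_x PL i1).
have k4 := b1 (- s) (- dl) s (lexx _) h1 h23 (or_introl erefl) (rectcont_x PL i2).
have k5 : `|ri (P^~ s) (- dl) dl| <= m * (dl - - dl).
  by apply: b1 => //; [left|apply: rectcont_x PT _; rewrite lexx h3].
have k6 : `|ri (P^~ (- s)) (- dl) dl| <= m * (dl - - dl).
  by apply: b1 => //; [right|apply: rectcont_x PB _; rewrite lexx h1].
have k7 : `|ri (Q s) (- s) s| <= m * (s - - s).
  by apply: b2 => //; [left|apply: rectcont_y QR _; rewrite lexx h3].
have k8 : `|ri (Q (- s)) (- s) s| <= m * (s - - s).
  by apply: b2 => //; [right|apply: rectcont_y QL _; rewrite lexx h1].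
(* Left: two pairs of inner sides, each contributing at least [2 * (reC D - 2 * e)]. Right: the
   outer contour has length [8 * s] and carries an integrand bounded by [m]. *)
have fin : 4 * (reC D - 2 * e) <= 8 * (m * s).
  move: eR eL eT eB S1 S2 inner1 inner2 k1 k2 k3 k4 k5 k6 k7 k8.
  clearbody P Q m; rewrite !ler_norml.
  move: (ri _ _ _) (ri _ _ _) (ri _ _ _) (ri _ _ _) (ri _ _ _) (ri _ _ _) (ri _ _ _) (ri _ _ _)
    (ri _ _ _) (ri _ _ _) (ri _ _ _) (ri _ _ _) (ri _ _ _) (ri _ _ _) (ri _ _ _) (ri _ _ _)
    (ri _ _ _) (ri _ _ _).
  move=> y1 y2 o0 o1 o2 o3 o4 o5 o6 o7 o8 o9 o10 o11 o12 o13 o14 o15 E1 E2 E3 E4 E5 E6.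
  move=> I1 I2 /andP[_ u14] /andP[u13 _] /andP[_ u10] /andP[u9 _] /andP[u5 _] /andP[_ u2] /andP[_ u12] /andP[u7 _].
  have E : y2 - y1 + (o2 - o7) = (o15 - o14) + (o13 - o8) + (o11 - o10) + (o3 - o6).
    by move: E1 E2 E3 E4 E5 E6; clear; lra.
  have U1 := lerB u14 u13; have U2 := lerB u10 u9; have U3 := lerB u2 u5; have U4 := lerB u12 u7.
  by move: (lerD I1 I2) (lerD (lerD U1 U2) (lerD U3 U4)); rewrite E; clear; lra.
have -> : 2 * M / s = 2 * (m * s) by rewrite /m; field; exact: lt0r_neq0.
clear -fin; lra.
Qed.

Lemma cder_comp_opp (f : Cx R -> Cx R) z a : cder f (- z) a -> cder (fun w => f (- w)) z (- a).
Proof.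
move=> H e e0; have [d d0 K] := H e e0; exists d => // h hd.
rewrite opprD -[absC h]absCN; have := K (- h); rewrite absCN => /(_ hd).
by rewrite mulrN mulNr.
Qed.

(** The odd difference [phi w - phi (- w)] vanishes at 0, is bounded by [2 * M] and has derivative
    [D + D], so [cauchy_odd] gives [reC D <= 2 * M / s]. Multiplying [phi] by the four units bounds
    the real and the imaginary part of [D], whence the constant 4. *)
Theorem cauchy_ineq (phi : Cx R -> Cx R) (s M : R) (D : Cx R) :
  0 < s -> cder phi 0 D ->
  (forall w, absC w <= 2 * s -> exists d, cder phi w d) ->
  (forall w, absC w <= 2 * s -> absC (phi w) <= M) ->
  absC D <= 4 * M / s.
Proof.
move=> s0 D0 dphi Mphi.
have dN (f : Cx R -> Cx R) (E : Cx R) : cder f 0 E ->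
  (forall w, absC w <= 2 * s -> exists d, cder f w d) ->
  (forall w, absC w <= 2 * s -> absC (f w) <= M) -> reC E <= 2 * M / s.
  move=> f0 df Mf; pose f1 w := f w - f (- w).
  have E1 : cder f1 0 (E + E).
    have := cderD f0 (cderN (@cder_comp_opp f 0 E _)).
    by rewrite oppr0 opprK; apply.
  have : forall e, 0 < e -> reC (E + E) <= 2 * (2 * M) / s + 2 * e.
    move=> e e0; apply: cauchy_odd E1 _ _ => //; first by rewrite /f1 oppr0 subrr.
      move=> w ws; have [a Ha] := df w ws.
      have [|b Hb] := df (- w); first by rewrite absCN.
      by eexists; exact: (cderD Ha (cderN (cder_comp_opp Hb))).
    move=> w ws; rewrite (le_trans (absCB _ _))//.
    by rewrite (_ : 2 * M = M + M); [rewrite lerD ?Mf ?absCN|ring].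
  rewrite reCD => H; rewrite leNgt; apply/negP => lt.
  have := H ((reC E - 2 * M / s) / 2) _; rewrite divr_gt0 ?subr_gt0// => /(_ erefl).
  by move: lt; clear; lra.
have abs_le (E x : Cx R) : absC x = 1 -> cder phi 0 E -> reC (x * E) <= 2 * M / s.
  move=> x1 HE; apply: (dN (fun w => x * phi w)); first exact: cderZ.
  - by move=> w /dphi[a Ha]; exists (x * a); exact: cderZ.
  - by move=> w /Mphi; rewrite absCM x1 mul1r.
have one : absC (1 : Cx R) = 1 by exact: ComplexField.Normc.normc1.
have A1 := abs_le D 1 one D0; rewrite mul1r in A1.
have A2 := abs_le D (- 1) _ D0; rewrite absCN one mulN1r reCN in A2.
have oneI : absC (cpt 0 1) = 1 by rewrite absCE /= expr0n/= add0r sqrtr_sqr normr1.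
have A3 := abs_le D (cpt 0 1) oneI D0.
have A4 := abs_le D (- cpt 0 1) _ D0; rewrite absCN oneI in A4.
rewrite mulNr reCN reCM reC_cpt imC_cpt mul0r mul1r sub0r in A4; rewrite reCM reC_cpt imC_cpt mul0r mul1r sub0r in A3.
apply: (le_trans (absC_le D)).
have := A2 erefl; have := A4 erefl; move=> {}A4 {}A2.
have B1 : `|reC D| <= 2 * M / s by rewrite ler_norml; clear -A1 A2; lra.
have B2 : `|imC D| <= 2 * M / s by rewrite ler_norml; clear -A3 A4; lra.
by apply: (le_trans (lerD B1 B2)); clear; lra.
Qed.
End Cauchy.

(** * Means and primitives of periodic functions *)

Section Primitive.
Context {R : realType}.
Implicit Types (f g F G : R -> R) (a b k t s : R).

Lemma continuous_segcont f a b : continuous f -> segcont f a b.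
Proof.
move=> cf x _ e e0; have /cvgrPdist_le /(_ e e0) := cf x.
move=> /nbhs_ballP[d /= d0 H]; exists d => // y _ yd.
by rewrite distrC; apply: H; rewrite /ball/= distrC.
Qed.

Lemma derive_seg_prim f a x : continuous f -> a < x ->
  is_derive x (1 : R) (fun y => ri f a y) (f x).
Proof.
move=> cf ax; have xu : x < x + 1 by rewrite ltrDl.
have fi := segcont_int (continuous_segcont (a := a) (b := x + 1) cf).
have [dF F'] := continuous_FTC1_closed xu fi ax (cf x).
by apply: (DeriveDef dF); rewrite -F' derive1E.
Qed.

(** The left end of the integral moves with [x], so that one formula serves all arguments;
    subtracting the integral up to 0 makes the value independent of that end, which can thus be
    frozen near a given point. *)
Lemma exists_primitive f : continuous f ->
  exists F, forall x, is_derive x (1 : R) F (f x).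
Proof.
move=> cf; exists (fun x => ri f (- (`|x| + 1)) x - ri f (- (`|x| + 1)) 0) => x.
pose N := `|x| + 2.
have N0 : - N < x by have := ler_norm (- x); rewrite normrN /N; clear; lra.
have : is_derive x (1 : R) (fun y => ri f (- N) y - ri f (- N) 0) (f x - 0).
  by apply: is_deriveB; exact: derive_seg_prim.
rewrite subr0; apply: near_eq_is_derive; near=> y.
have yN : `|y| < `|x| + 1.
  have : `|x - y| < 1 by near: y; exists 1 => //=.
  by have := ler_normD x (y - x); rewrite subrKC distrC; clear; lra.
have h1 : - N <= - (`|y| + 1) by rewrite /N lerN2; move: yN; clear; lra.
have h2 : - (`|y| + 1) <= y by have := ler_norm (- y); rewrite normrN; clear; lra.
have h3 : - (`|y| + 1) <= 0 by rewrite oppr_le0 addr_ge0.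
rewrite (ri_split h1 h2 (continuous_segcont cf)) (ri_split h1 h3 (continuous_segcont cf)).
by ring.
Unshelve. all: by end_near. Qed.

Lemma prim_unique f F G : (forall x, is_derive x (1 : R) F (f x)) ->
  (forall x, is_derive x (1 : R) G (f x)) -> forall s t, F t - F s = G t - G s.
Proof.
move=> HF HG s t.
have H x : is_derive x (1 : R) (F - G) 0.
  by rewrite -(subrr (f x)); apply: is_deriveB.
by have := is_derive_0_is_cst t s H; rewrite !fctE; move/eqP; rewrite -subr_eq0 => /eqP E;
  apply/eqP; rewrite -subr_eq0 -E; apply/eqP; ring.
Qed.

Lemma contD f g : continuous f -> continuous g -> continuous (fun t => f t + g t).
Proof. by move=> cf cg x; apply: continuousD; [exact: cf|exact: cg]. Qed.

Lemma contN f : continuous f -> continuous (fun t => - f t).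
Proof. by move=> cf x; apply: continuousN; exact: cf. Qed.

Lemma contB f g : continuous f -> continuous g -> continuous (fun t => f t - g t).
Proof. by move=> cf cg; apply: contD => //; exact: contN. Qed.

Lemma contM f g : continuous f -> continuous g -> continuous (fun t => f t * g t).
Proof. by move=> cf cg x; apply: continuousM; [exact: cf|exact: cg]. Qed.

Lemma cont_cst k : continuous (fun _ : R => k).
Proof. by move=> x; exact: cvg_cst. Qed.

(** One primitive is chosen for every function, so that means and zero-mean primitives become
    operators; a discontinuous function receives a meaningless value. *)
Lemma primitive_operator : {prim : (R -> R) -> R -> R |
  forall f, continuous f -> forall x, is_derive x (1 : R) (prim f) (f x)}.
Proof.
apply: cid; have H f : exists F : R -> R,
    continuous f -> forall x, is_derive x (1 : R) F (f x).
  have [/exists_primitive[F HF]|nc] := pselect (continuous f); first by exists F.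
  by exists f => /nc.
by have [prim Hprim] := choice H; exists prim.
Qed.

Definition prim : (R -> R) -> R -> R := sval primitive_operator.

Lemma primP f : continuous f -> forall x, is_derive x (1 : R) (prim f) (f x).
Proof. exact: svalP primitive_operator f. Qed.

Lemma derive_continuous F f : (forall x, is_derive x (1 : R) F (f x)) -> continuous F.
Proof.
by move=> H x; apply: differentiable_continuous; apply/derivable1_diffP; have [] := H x.
Qed.

Lemma prim_cont f : continuous f -> continuous (prim f).
Proof. by move=> cf; apply: derive_continuous (primP cf). Qed.

Lemma mvt_norm F f k s t : (forall x, is_derive x (1 : R) F (f x)) ->
  (forall x, `|f x| <= k) -> `|F t - F s| <= k * `|t - s|.
Proof.
move=> HF fk; wlog st : s t / s <= t => [H|].
  have [/H//|/ltW/H] := leP s t.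
  by rewrite distrC (distrC s).
have cF : {within `[s, t], continuous F}.
  by apply: continuous_subspaceT; exact: derive_continuous HF.
have [c _ ->] := MVT_segment st (fun x _ => HF x) cF.
by rewrite normrM ler_wpM2r.
Qed.
End Primitive.

Section Mean.
Context {R : realType}.
Variable T : R.
Hypothesis T0 : 0 < T.
Implicit Types (f g F G : R -> R) (a b k t s : R).

(** Defined by a primitive instead of an integral: linearity, invariance under shifts and
    integration by parts then all follow from uniqueness of primitives up to constants. *)
Definition mean f : R := (prim f T - prim f 0) / T.

Definition Tperiodic f : Prop := forall t, f (t + T) = f t.

Lemma mean_prim f F : continuous f -> (forall x, is_derive x (1 : R) F (f x)) ->
  mean f = (F T - F 0) / T.
Proof. by move=> cf HF; rewrite /mean (prim_unique (primP cf) HF). Qed.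

Lemma meanD f g : continuous f -> continuous g ->
  mean (fun t => f t + g t) = mean f + mean g.
Proof.
move=> cf cg.
have c := contD cf cg.
have d x : is_derive x (1 : R) (prim f + prim g) (f x + g x).
  by apply: is_deriveD; exact: primP.
by rewrite (mean_prim c d) /mean !fctE -mulrDl; congr (_ / _); ring.
Qed.

Lemma meanZ f k : continuous f -> mean (fun t => k * f t) = k * mean f.
Proof.
move=> cf.
have c := contM (cont_cst (k:=k)) cf.
have d x : is_derive x (1 : R) (k *: prim f) (k * f x).
  by apply: is_deriveZ; exact: primP.
by rewrite (mean_prim c d) /mean !fctE /= mulrA -mulrBr.
Qed.

Lemma meanN f : continuous f -> mean (fun t => - f t) = - mean f.
Proof.
by move=> cf; rewrite -mulN1r -meanZ//; congr mean; apply/funext => t; rewrite mulN1r.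
Qed.

Lemma meanB f g : continuous f -> continuous g ->
  mean (fun t => f t - g t) = mean f - mean g.
Proof.
move=> cf cg; by rewrite meanD// ?meanN//; exact: contN.
Qed.

Lemma mean_cst k : mean (fun=> k) = k.
Proof.
have c := @cont_cst R k.
have d (x : R) : is_derive x (1 : R) (k *: (id : R -> R)) k.
  by rewrite -[X in is_derive _ _ _ X](mulr1 k); exact: is_deriveZ.
by rewrite (mean_prim c d) !fctE /= /GRing.scale/= mulr0 subr0 mulfK ?gt_eqF.
Qed.

(** By the mean value theorem for the primitive, the mean is itself a value of [f] on the period. *)
Lemma mean_norm f k : continuous f -> (forall t, 0 <= t <= T -> `|f t| <= k) ->
  `|mean f| <= k.
Proof.
move=> cf fk; rewrite /mean.
have cF : {within `[0, T], continuous (prim f)}.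
  by apply: continuous_subspaceT; exact: prim_cont.
have [c cT ->] := MVT_segment (ltW T0) (fun x _ => primP cf x) cF.
by rewrite subr0 mulfK ?gt_eqF// fk//; move: cT; rewrite in_itv.
Qed.

Lemma mean_deriv F f : continuous f -> (forall x, is_derive x (1 : R) F (f x)) ->
  Tperiodic F -> mean f = 0.
Proof.
by move=> cf HF pF; rewrite (mean_prim cf HF) -[X in F X]add0r pF subrr mul0r.
Qed.

Lemma derive_shift F f s : (forall x, is_derive x (1 : R) F (f x)) ->
  forall x, is_derive x (1 : R) (fun t => F (t + s)) (f (x + s)).
Proof.
move=> HF x.
have d : is_derive x (1 : R) (fun t : R => t + s) 1.
  by rewrite -[X in is_derive _ _ _ X]addr0; exact: is_deriveD.
by have := @is_derive1_comp R F (fun t => t + s) x (f (x + s)) 1 (HF _) d; rewrite mulr1.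
Qed.

Lemma continuous_shift f s : continuous f -> continuous (fun t => f (t + s)).
Proof.
move=> cf x; apply: continuous_comp; last exact: cf.
by apply: continuousD; [exact: cvg_id|exact: cvg_cst].
Qed.

Lemma mean_shift f s : continuous f -> Tperiodic f -> mean (fun t => f (t + s)) = mean f.
Proof.
move=> cf pf; have cs := continuous_shift (s:=s) cf.
rewrite (mean_prim cs (derive_shift s (primP cf))) /mean add0r.
have d x : is_derive x (1 : R) (prim f) (f (x + T)) by rewrite pf; exact: primP.
rewrite (addrC T s); congr (_ / _).
have : prim f (s + T) - prim f (0 + T) = prim f s - prim f 0.
  exact: prim_unique (derive_shift T (primP cf)) d 0 s.
rewrite add0r => /eqP; rewrite subr_eq => /eqP ->; ring.
Qed.

(** The inverse of differentiation on periodic functions of mean zero, applied to [f] freed of its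
    mean. *)
Definition osc f : R -> R :=
  let F := prim (fun t => f t - mean f) in fun t => F t - mean F.

Lemma continuousB_cst f k : continuous f -> continuous (fun t => f t - k).
Proof. by move=> cf; apply: contB => //; exact: cont_cst. Qed.

Lemma osc_deriv f : continuous f -> forall x, is_derive x (1 : R) (osc f) (f x - mean f).
Proof.
move=> cf x; rewrite -[X in is_derive _ _ _ X]subr0.
by apply: is_deriveB; exact: primP (continuousB_cst cf) _.
Qed.

Lemma osc_cont f : continuous f -> continuous (osc f).
Proof. by move=> cf; apply: derive_continuous (osc_deriv cf). Qed.

Lemma mean_osc f : continuous f -> mean (osc f) = 0.
Proof.
move=> cf; have cp := prim_cont (continuousB_cst (k := mean f) cf).
by rewrite /osc meanB ?mean_cst ?subrr//; exact: cont_cst.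
Qed.

Lemma osc_unique f F : continuous f -> (forall x, is_derive x (1 : R) F (f x - mean f)) ->
  mean F = 0 -> F =1 osc f.
Proof.
move=> cf HF mF t.
have cF := derive_continuous HF; have cO := osc_cont cf.
have E s : F t - osc f t = F s - osc f s.
  have := prim_unique HF (osc_deriv cf) s t; move=> /eqP; rewrite -subr_eq0 => /eqP H.
  by apply/eqP; rewrite -subr_eq0 -H; apply/eqP; ring.
apply/eqP; rewrite -subr_eq0 -(mean_cst (F t - osc f t)).
have -> : (fun=> F t - osc f t) = (fun s => F s - osc f s) by apply/funext => s; exact: E.
by rewrite meanB// mF mean_osc// subrr.
Qed.

Lemma osc_periodic f : continuous f -> Tperiodic f -> Tperiodic (osc f).
Proof.
move=> cf pf t; have cO := osc_cont cf.
have E s : osc f (t + T) - osc f t = osc f (s + T) - osc f s.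
  have H1 x : is_derive x (1 : R) (fun t => osc f (t + T)) (f x - mean f).
    by rewrite -(pf x); exact: (derive_shift T (osc_deriv cf)).
  have := prim_unique H1 (osc_deriv cf) s t; clear; lra.
have : osc f (0 + T) - osc f 0 = 0.
  have /eqP : mean (fun s => f s - mean f) = 0.
    by rewrite meanB ?mean_cst ?subrr//; exact: cont_cst.
  rewrite (mean_prim (continuousB_cst cf) (osc_deriv cf)) mulf_eq0 invr_eq0 (gt_eqF T0) orbF add0r.
  by move/eqP.
by rewrite -E => /eqP; rewrite subr_eq0 => /eqP.
Qed.

(** Since [osc f] has mean zero, its value at [t] is the mean of its differences with the values
    over the following period, and its derivative [f - mean f] is bounded by [2 * k]. *)
Lemma osc_norm f k : continuous f -> Tperiodic f -> (forall t, `|f t| <= k) ->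
  forall t, `|osc f t| <= 2 * T * k.
Proof.
move=> cf pf fk t.
have mk : `|mean f| <= k by apply: mean_norm => // s _; exact: fk.
have bd s : `|f s - mean f| <= 2 * k.
  by rewrite (le_trans (ler_normB _ _))// mulr_natl mulr2n lerD.
have cO := osc_cont cf; have pO := osc_periodic cf pf.
have -> : osc f t = mean (fun s => osc f t - osc f (s + t)).
  rewrite meanB ?mean_cst ?mean_shift ?mean_osc ?subr0//.
    exact: cont_cst.
  exact: continuous_shift.
apply: mean_norm => [|s /andP[s0 sT]].
  by apply: contB; [exact: cont_cst|exact: continuous_shift].
rewrite (le_trans (mvt_norm _ _ (osc_deriv cf) bd))//.
have -> : t - (s + t) = - s by ring.
have k0 : 0 <= k := le_trans (normr_ge0 _) mk.
rewrite normrN ger0_norm// (_ : 2 * T * k = 2 * k * T); last by ring.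
by rewrite ler_wpM2l// mulr_ge0.
Qed.

Lemma oscB f g : continuous f -> continuous g ->
  forall t, osc f t - osc g t = osc (fun s => f s - g s) t.
Proof.
move=> cf cg t; apply: (@osc_unique _ (osc f - osc g)).
- exact: contB.
- move=> x; rewrite meanB//.
  have -> : f x - g x - (mean f - mean g) = (f x - mean f) - (g x - mean g) by ring.
  by apply: is_deriveB; exact: osc_deriv.
- by rewrite (_ : mean _ = mean (fun t => osc f t - osc g t))// meanB ?mean_osc ?subrr//; exact: osc_cont.
Qed.

Lemma mean_by_parts F G f g : continuous f -> continuous g ->
  (forall x, is_derive x (1 : R) F (f x)) -> (forall x, is_derive x (1 : R) G (g x)) ->
  Tperiodic F -> Tperiodic G -> mean (fun t => F t * g t + G t * f t) = 0.
Proof.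
move=> cf cg HF HG pF pG; apply: (@mean_deriv (F * G)).
- by apply: contD; apply: contM => //; [exact: derive_continuous HF|exact: derive_continuous HG].
- by move=> x; rewrite !fctE pF pG.
Qed.
End Mean.

(** * Contractions for weighted pointwise distances *)

Section Picard.
Context {R : realType} {X : Type}.
Variables (w : X -> R) (Op : (X -> R) -> X -> R) (U : (X -> R) -> Prop).

(** A contraction principle without a normed space: distance at most [d] means [d * w i] at every
    index. Completeness is that of the reals, index by index, together with the closure hypothesis
    on [U] under geometric convergence. *)
Lemma picard_fixpoint (x0 : X -> R) (d0 : R) :
  (forall i, 0 <= w i) -> (forall x, U x -> U (Op x)) ->
  (forall x y d, U x -> U y -> 0 <= d -> (forall i, `|x i - y i| <= d * w i) ->
    forall i, `|Op x i - Op y i| <= d / 2 * w i) ->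
  (forall (xs : nat -> X -> R) x C, (forall n, U (xs n)) ->
    (forall i n, `|xs n i - x i| <= C * w i / 2 ^+ n) -> U x) ->
  U x0 -> 0 <= d0 -> (forall i, `|Op x0 i - x0 i| <= d0 * w i) ->
  exists2 x, U x & forall i, Op x i = x i.
Proof.
move=> w0 UOp contr Ucl Ux0 d00 Hx0.
pose xs n := iter n Op x0.
have Uxs n : U (xs n) by elim: n => //= n IH; exact: UOp.
have dxs n i : `|xs n.+1 i - xs n i| <= d0 / 2 ^+ n * w i.
  elim: n i => [|n IH] i; first by rewrite expr0 divr1; exact: Hx0.
  have := contr _ _ _ (Uxs n.+1) (Uxs n) _ IH i; rewrite exprSr invfM mulrA; apply.
  by rewrite divr_ge0 ?exprn_ge0.
pose c i := 2 * d0 * w i.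
have c0 i : 0 <= c i by rewrite !mulr_ge0.
have cS i n : c i / 2 ^+ n = c i / 2 ^+ n.+1 + c i / 2 ^+ n.+1.
  by rewrite exprS; field; rewrite expf_neq0 ?pnatr_eq0.
have cE i n : c i / 2 ^+ n.+1 = d0 / 2 ^+ n * w i.
  by rewrite /c exprS; field; rewrite expf_neq0 ?pnatr_eq0.
have lim i : exists l, forall n, `|xs n i - l| <= c i / 2 ^+ n.
  (* The segments of radius [c i / 2 ^ n] about the iterates are nested, because consecutive
     iterates differ by at most half that radius. *)
  have [|n|n|l Hl] := @nested_halves R (fun n => xs n i - c i / 2 ^+ n) (2 * c i).
  - by rewrite mulr_ge0.
  - have := dxs n i; have := cS i n; rewrite ler_norml -cE; cbv beta; clear; lra.
  - have := dxs n i; have := cS i n; rewrite ler_norml -cE; cbv beta; rewrite -!mulrA; clear; lra.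
  exists l => n; have := Hl n; rewrite -mulrA ler_norml; clear; lra.
have [x Hx] := choice lim.
have Ux : U x by apply: (Ucl xs x (2 * d0)).
exists x => // i.
have H n : `|Op x i - x i| <= 2 * c i / 2 ^+ n.
  have -> : Op x i - x i = - (Op (xs n) i - Op x i) + (xs n.+1 i - x i) by rewrite /=; ring.
  rewrite (le_trans (ler_normD _ _))// normrN.
  have := contr _ _ (2 * d0 / 2 ^+ n) (Uxs n) Ux _ _ i.
  have -> : 2 * d0 / 2 ^+ n / 2 * w i = c i / 2 ^+ n.+1 by rewrite cE; field; rewrite expf_neq0 ?pnatr_eq0.
  move=> /(_ _ _)/le_trans K.
  have := Hx i n.+1; have := c0 i; have : 0 <= c i / 2 ^+ n.+1 by rewrite divr_ge0 ?exprn_ge0.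
  have {}K : `|Op (xs n) i - Op x i| <= c i / 2 ^+ n.+1.
    apply: K => [|j|//]; first by rewrite divr_ge0 ?mulr_ge0 ?exprn_ge0.
    by rewrite mulrAC; exact: Hx.
  rewrite -mulrA (cS i n); clear -K; lra.
apply/eqP; rewrite -subr_eq0 -normr_le0 leNgt; apply/negP => pos.
have [n Hn] := half_powers_small (2 * c i) pos.
by have := le_lt_trans (H n) Hn; rewrite ltxx.
Qed.
End Picard.

Section LocalLipschitz.
Context {R : realType}.
Lemma le_of_small (a b k : R) : (forall n, a <= b + k / 2 ^+ n) -> a <= b.
Proof.
move=> H; rewrite leNgt; apply/negP => lt.
have ab : 0 < a - b by rewrite subr_gt0.
have [n Hn] := half_powers_small k ab; have := H n; move: Hn; clear; lra.
Qed.

Lemma cont_sum (I : Type) (r : seq I) (f : I -> R -> R) :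
  (forall i, continuous (f i)) -> continuous (fun t => \sum_(i <- r) f i t).
Proof.
move=> cf; elim: r => [|i r IH].
  rewrite (_ : (fun t => _) = fun=> 0); last by apply/funext => t; rewrite big_nil.
  exact: cont_cst.
rewrite (_ : (fun t => _) = fun t => f i t + \sum_(i <- r) f i t).
  exact: contD.
by apply/funext => t; rewrite big_cons.
Qed.

Lemma mean_sum T (I : Type) (r : seq I) (f : I -> R -> R) : 0 < T ->
  (forall i, continuous (f i)) ->
  mean T (fun t => \sum_(i <- r) f i t) = \sum_(i <- r) mean T (f i).
Proof.
move=> T0 cf; elim: r => [|i r IH].
  rewrite (_ : (fun t => _) = fun=> 0); last by apply/funext => t; rewrite big_nil.
  by rewrite mean_cst// big_nil.
rewrite (_ : (fun t => _) = fun t => f i t + \sum_(i <- r) f i t); last first.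
  by apply/funext => t; rewrite big_cons.
by rewrite meanD// ?IH ?big_cons//; exact: cont_sum.
Qed.

(** A linear function above a downward parabola through the origin has slope zero. The test
    displacement [- g / (|K| + 1)] makes the linear gain strictly exceed the quadratic loss unless
    [g = 0]. *)
Lemma zero_of_quadratic (g K : R) : (forall h, - (K * h ^+ 2) <= g * h) -> g = 0.
Proof.
move=> H; apply/eqP; rewrite -sqrf_eq0 eq_le sqr_ge0 andbT.
have k0 : 0 < `|K| + 1 by rewrite ltr_wpDl.
have := H (- g / (`|K| + 1)).
have -> : g * (- g / (`|K| + 1)) = - (g ^+ 2 / (`|K| + 1)) by ring.
rewrite lerN2 => A.
have : g ^+ 2 / (`|K| + 1) <= `|K| * g ^+ 2 / (`|K| + 1) ^+ 2.
  apply: (le_trans A); rewrite expr_div_n sqrrN mulrA ler_wpM2r ?invr_ge0 ?exprn_ge0 ?(ltW k0)//.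
  by rewrite ler_wpM2r ?sqr_ge0 ?ler_norm.
rewrite expr2 invfM mulrA ler_pM2r ?invr_gt0// ler_pdivlMr// mulrDr mulr1 [g ^+ 2 * _]mulrC.
by rewrite gerDl.
Qed.

(** The bound is required only at distance at most 1, since the Taylor estimate applied to [P] along
    a loop contributes a quadratic term. *)
Lemma lip_continuous (f : R -> R) L :
  (forall s t, `|s - t| <= 1 -> `|f s - f t| <= L * `|s - t|) -> continuous f.
Proof.
move=> H x; apply/cvgrPdist_le => e e0.
have k0 : 0 < `|L| + 1 by rewrite ltr_wpDl.
near=> y.
have xy : `|x - y| < Num.min 1 (e / (`|L| + 1)).
  by near: y; exists (Num.min 1 (e / (`|L| + 1))) => //=; rewrite lt_min ltr01 divr_gt0.
move: xy; rewrite lt_min => /andP[/ltW x1 /ltW xe].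
rewrite (le_trans (H _ _ x1))//; move: xe; rewrite ler_pdivlMr// => xe.
apply: le_trans xe; rewrite mulrC ler_wpM2l//.
by apply: le_trans (ler_norm _) _; rewrite lerDl.
Unshelve. all: by end_near. Qed.
End LocalLipschitz.

(** * Periodic orbits of a small perturbation of a quadratic Hamiltonian *)

(* Coordinates are indexed by [bool * D]; [(false, d)] and [(true, d)] are
   conjugate momentum and position. The Hamiltonian is
   [om . p + (1/2) \sum_c beta c * y c ^+ 2 + P y] and [G c] is the partial
   derivative of [P]. Coordinates with [beta c = 0] are the angles. *)
Section Dynamics.
Context {R : realType} {D : finType}.
Local Notation C := (bool * D)%type.
Variables (T : R) (beta om w eta : C -> R) (kw : C -> int).
Variables (G : C -> (C -> R) -> R) (P : (C -> R) -> R) (KP : R).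

Definition cj (c : C) : C := (~~ c.1, c.2).
(** With this sign Hamilton's equations take one form for all coordinates: the velocity of [c] is
    [sg c] times the derivative of the Hamiltonian in [cj c]. *)
Definition sg (c : C) : R := if c.1 then 1 else -1.
Definition adom (y : C -> R) : Prop := forall c, beta c != 0 -> `|y c| <= w c.
Definition angle_shift (n : C -> int) : Prop := forall c, beta c != 0 -> n c = 0.
Definition base (ps : C -> R) : Prop := forall c, beta c != 0 -> ps c = 0.
Definition kap (c : C) : R := `|beta c| * w c + eta c.

Hypothesis T0 : 0 < T.
Hypothesis w0 : forall c, 0 < w c.
Hypothesis eta0 : forall c, 0 <= eta c.
Hypothesis betap : forall d, beta (false, d) != 0.
Hypothesis om0 : forall c, beta c != 0 -> om c = 0.
Hypothesis omT : forall c, om c * T = 2 * pi * (kw c)%:~R.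
Hypothesis G_bd : forall c y, adom y -> `|G c y| <= eta c.
Hypothesis G_lip : forall c y y' d, adom y -> adom y' -> 0 <= d ->
  (forall i, `|y i - y' i| <= d * w i) -> `|G c y - G c y'| <= eta c * d.
Hypothesis G_per : forall c y n, adom y -> angle_shift n ->
  G c (fun i => y i + 2 * pi * (n i)%:~R) = G c y.
Hypothesis P_per : forall y n, adom y -> angle_shift n ->
  P (fun i => y i + 2 * pi * (n i)%:~R) = P y.
Hypothesis P_taylor : forall y y' d, adom y -> adom y' -> 0 <= d ->
  (forall i, `|y' i - y i| <= d * w i) ->
  `|P y' - P y - \sum_c G c y * (y' c - y c)| <= KP * d ^+ 2.
Hypothesis KP0 : 0 <= KP.
(** The two terms bound the mean and the oscillation produced by [Op]. The factor 1/2 on the right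
    serves twice: [Op] maps the weighted box into itself and halves distances. *)
Hypothesis small : forall c,
  eta c / `|beta c| + 2 * T * kap (cj c) <= w c / 2.

Definition Xt (ps : C -> R) (x : C * R -> R) (t : R) (c : C) : R :=
  ps c + om c * t + x (c, t).
Definition Fv ps x (c : C) (t : R) : R := beta c * x (c, t) + G c (Xt ps x t).
(** The Lyapunov-Schmidt operator. Where [beta c != 0] the mean of the component is the one that
    cancels the mean of the force [beta c * x + G c]; the oscillation integrates the conjugate
    force. For an angle the division by 0 gives 0, which normalizes its deviation to mean zero. *)
Definition Op ps x (i : C * R) : R :=
  - mean T (fun t => G i.1 (Xt ps x t)) / beta i.1 + sg i.1 * osc T (Fv ps x (cj i.1)) i.2.
(** A fixed Lipschitz constant, rather than continuity, is required: it is preserved by pointwise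
    limits and by [Op], whose values have velocity at most [2 * kap (cj c)]. *)
Definition loops (x : C * R -> R) : Prop := forall c,
  [/\ forall t, x (c, t + T) = x (c, t), forall t, `|x (c, t)| <= w c
    & forall s t, `|x (c, s) - x (c, t)| <= 2 * kap (cj c) * `|s - t|].

Lemma cjK c : cj (cj c) = c.
Proof. by case: c => b d; rewrite /cj /= negbK. Qed.

Lemma kap_ge0 c : 0 <= kap c.
Proof. by rewrite addr_ge0 ?mulr_ge0// ltW. Qed.

Lemma two_pi_gt0 : 0 < 2 * pi :> R.
Proof. by rewrite mulr_gt0// pi_gt0. Qed.

Lemma kw_shift : angle_shift kw.
Proof.
move=> c bc; have := omT c; rewrite om0// mul0r => /esym/eqP.
by rewrite mulf_eq0 (gt_eqF two_pi_gt0)/= intr_eq0 => /eqP.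
Qed.

Lemma adom_Xt ps x t : base ps -> loops x -> adom (Xt ps x t).
Proof.
move=> bps Ux c bc; rewrite /Xt bps// om0// mul0r !add0r.
by have [_ H _] := Ux c.
Qed.

Definition Kom : R := \sum_c (`|om c| + 2 * kap (cj c)) / w c.

Lemma Kom_ge0 : 0 <= Kom.
Proof.
apply: sumr_ge0 => c _; rewrite divr_ge0 ?(ltW (w0 c))// addr_ge0// mulr_ge0//.
exact: kap_ge0.
Qed.

Lemma Xt_lip ps x s t c : loops x -> `|Xt ps x s c - Xt ps x t c| <= Kom * `|s - t| * w c.
Proof.
move=> Ux; have [_ _ H] := Ux c.
have -> : Xt ps x s c - Xt ps x t c = om c * (s - t) + (x (c, s) - x (c, t)) by rewrite /Xt; ring.
rewrite (le_trans (ler_normD _ _))// normrM (le_trans (lerD (lexx _) (H s t)))//.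
rewrite -mulrDl mulrAC ler_wpM2r//.
rewrite -ler_pdivrMr// /Kom (bigD1 c)//= lerDl sumr_ge0// => i _.
rewrite divr_ge0 ?(ltW (w0 i))// addr_ge0// mulr_ge0//; exact: kap_ge0.
Qed.

Lemma G_cont ps x c : base ps -> loops x -> continuous (fun t => G c (Xt ps x t)).
Proof.
move=> bps Ux; apply: (@lip_continuous _ _ (eta c * Kom)) => s t _.
rewrite -mulrA; apply: G_lip; [exact: adom_Xt|exact: adom_Xt| |].
  by rewrite mulr_ge0 ?Kom_ge0.
by move=> i; exact: Xt_lip.
Qed.

Lemma x_cont x c : loops x -> continuous (fun t => x (c, t)).
Proof.
move=> Ux; have [_ _ H] := Ux c.
by apply: (@lip_continuous _ _ (2 * kap (cj c))) => s t _.
Qed.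

Lemma Fv_cont ps x c : base ps -> loops x -> continuous (Fv ps x c).
Proof.
move=> bps Ux; apply: contD; last exact: G_cont.
by apply: contM; [exact: cont_cst|exact: x_cont].
Qed.

Lemma Fv_bd ps x c t : base ps -> loops x -> `|Fv ps x c t| <= kap c.
Proof.
move=> bps Ux; rewrite (le_trans (ler_normD _ _))// lerD//.
  by rewrite normrM ler_wpM2l//; have [_ H _] := Ux c.
by apply: G_bd; exact: adom_Xt.
Qed.

Lemma Xt_shift ps x t c : loops x -> Xt ps x (t + T) c = Xt ps x t c + 2 * pi * (kw c)%:~R.
Proof.
by move=> Ux; have [H _ _] := Ux c; rewrite /Xt H mulrDr omT; ring.
Qed.

Lemma G_periodic ps x c : base ps -> loops x -> Tperiodic T (fun t => G c (Xt ps x t)).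
Proof.
move=> bps Ux t.
have -> : Xt ps x (t + T) = fun i => Xt ps x t i + 2 * pi * (kw i)%:~R.
  by apply/funext => i; exact: Xt_shift.
by apply: G_per; [exact: adom_Xt|exact: kw_shift].
Qed.

Lemma Fv_periodic ps x c : base ps -> loops x -> Tperiodic T (Fv ps x c).
Proof.
move=> bps Ux t; rewrite /Fv; have [-> _ _] := Ux c.
by have -> := G_periodic c bps Ux t.
Qed.

Lemma sg_norm c : `|sg c| = 1.
Proof. by rewrite /sg; case: c.1; rewrite ?normrN normr1. Qed.

Lemma Op_deriv ps x c t : base ps -> loops x ->
  is_derive t (1 : R) (fun s => Op ps x (c, s))
    (sg c * (Fv ps x (cj c) t - mean T (Fv ps x (cj c)))).
Proof.
move=> bps Ux; rewrite -[X in is_derive _ _ _ X]add0r.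
have dO := osc_deriv T (Fv_cont (c:=cj c) bps Ux).
have dZ : is_derive t (1 : R) (sg c *: osc T (Fv ps x (cj c)))
  (sg c * (Fv ps x (cj c) t - mean T (Fv ps x (cj c)))) by exact: is_deriveZ.
exact: (@is_deriveD _ _ _ (cst (- mean T (fun t => G c (Xt ps x t)) / beta c)) _ t 1 0 _ _ dZ).
Qed.

Lemma loops_Op ps x : base ps -> loops x -> loops (Op ps x).
Proof.
move=> bps Ux c; have cF := Fv_cont (c:=cj c) bps Ux; have pF := Fv_periodic (cj c) bps Ux.
have bF t := Fv_bd (cj c) t bps Ux.
split.
- by move=> t; rewrite /Op /= (osc_periodic T0 cF pF).
- move=> t; rewrite /Op /= (le_trans (ler_normD _ _))//.
  apply: (@le_trans _ _ (w c / 2)); last by rewrite ler_pdivrMr// ler_pMr// ler1n.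
  apply: le_trans (small c); apply: lerD.
    rewrite normrM normrN normfV ler_wpM2r ?invr_ge0//.
    apply: mean_norm => // [|s _]; first exact: G_cont.
    by apply: G_bd; exact: adom_Xt.
  rewrite normrM sg_norm mul1r; exact: (osc_norm T0 cF pF bF).
- move=> s t.
  have dO u : is_derive u (1 : R) (fun s => Op ps x (c, s))
    (sg c * (Fv ps x (cj c) u - mean T (Fv ps x (cj c)))) by exact: Op_deriv.
  apply: (mvt_norm t s dO) => u.
  rewrite normrM sg_norm mul1r (le_trans (ler_normB _ _))// mulr_natl mulr2n lerD//.
  by apply: mean_norm.
Qed.

(** Loop and phase vary together. With equal phases this is the contraction property; with fixed
    points on both sides it controls the dependence of the loop on its phase. *)
Lemma Op_lip ps ps' x y d de : base ps -> base ps' -> loops x -> loops y ->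
  0 <= d -> 0 <= de ->
  (forall i, `|x i - y i| <= d * w i.1) -> (forall c, `|ps c - ps' c| <= de * w c) ->
  forall i, `|Op ps x i - Op ps' y i| <= (d + de) / 2 * w i.1.
Proof.
move=> bps bps' Ux Uy d0 de0 xy pp [c t] /=.
have dde : 0 <= d + de by rewrite addr_ge0.
have XX s i : `|Xt ps x s i - Xt ps' y s i| <= (d + de) * w i.
  have -> : Xt ps x s i - Xt ps' y s i = (x (i, s) - y (i, s)) + (ps i - ps' i) by rewrite /Xt; ring.
  by rewrite (le_trans (ler_normD _ _))// mulrDl lerD// xy.
have GG i s : `|G i (Xt ps x s) - G i (Xt ps' y s)| <= eta i * (d + de).
  by apply: G_lip => //; exact: adom_Xt.
have FF i s : `|Fv ps x i s - Fv ps' y i s| <= kap i * (d + de).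
  have -> : Fv ps x i s - Fv ps' y i s = beta i * (x (i, s) - y (i, s)) +
    (G i (Xt ps x s) - G i (Xt ps' y s)) by rewrite /Fv; ring.
  rewrite (le_trans (ler_normD _ _))// /kap mulrDl lerD// normrM -mulrA ler_wpM2l//.
  by rewrite (le_trans (xy _))//= mulrC ler_wpM2l ?(ltW (w0 _))// lerDl.
have cG1 := G_cont (c:=c) bps Ux; have cG2 := G_cont (c:=c) bps' Uy.
have cF1 := Fv_cont (c:=cj c) bps Ux; have cF2 := Fv_cont (c:=cj c) bps' Uy.
have pF1 := Fv_periodic (cj c) bps Ux; have pF2 := Fv_periodic (cj c) bps' Uy.
have -> : Op ps x (c, t) - Op ps' y (c, t) =
  - mean T (fun s => G c (Xt ps x s) - G c (Xt ps' y s)) / beta c +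
  sg c * osc T (fun s => Fv ps x (cj c) s - Fv ps' y (cj c) s) t.
  by rewrite /Op /= (meanB T cG1 cG2) -(oscB T0 cF1 cF2); ring.
rewrite (le_trans (ler_normD _ _))//.
have -> : (d + de) / 2 * w c = (w c / 2) * (d + de) by field.
apply: le_trans (ler_wpM2r dde (small c)); rewrite mulrDl; apply: lerD.
  rewrite normrM normrN normfV mulrAC ler_wpM2r ?invr_ge0//.
  by apply: mean_norm => //; exact: contB.
rewrite normrM sg_norm mul1r.
have -> : 2 * T * kap (cj c) * (d + de) = 2 * T * (kap (cj c) * (d + de)) by ring.
apply: (osc_norm T0 (contB cF1 cF2)) => // s.
by rewrite pF1 pF2.
Qed.

Lemma loops0 : loops (fun=> 0).
Proof.
move=> c; split=> [//|t|s t]; first by rewrite normr0 ltW.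
by rewrite subrr normr0 mulr_ge0// mulr_ge0// kap_ge0.
Qed.

Lemma loops_closed (xs : nat -> C * R -> R) x K : (forall n, loops (xs n)) ->
  (forall i n, `|xs n i - x i| <= K * w i.1 / 2 ^+ n) -> loops x.
Proof.
move=> Ux Hx c.
have H t n := Hx (c, t) n.
split=> [t|t|s t].
- apply/eqP; rewrite -subr_eq0 -normr_le0; apply: (@le_of_small _ _ _ (2 * (K * w c))) => n.
  have [P1 _ _] := Ux n c; rewrite add0r.
  have -> : x (c, t + T) - x (c, t) = - (xs n (c, t + T) - x (c, t + T)) + (xs n (c, t) - x (c, t)).
    by rewrite P1; ring.
  rewrite (le_trans (ler_normD _ _))// normrN -mulrA mulr_natl mulr2n lerD//; exact: H.
- apply: (@le_of_small _ _ _ (K * w c)) => n; have [_ P2 _] := Ux n c.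
  have -> : x (c, t) = xs n (c, t) - (xs n (c, t) - x (c, t)) by ring.
  by rewrite (le_trans (ler_normB _ _))// lerD//; exact: H.
- apply: (@le_of_small _ _ _ (2 * (K * w c))) => n; have [_ _ P3] := Ux n c.
  have -> : x (c, s) - x (c, t) = (xs n (c, s) - xs n (c, t)) +
     (- (xs n (c, s) - x (c, s)) + (xs n (c, t) - x (c, t))) by ring.
  rewrite (le_trans (ler_normD _ _))// lerD// (le_trans (ler_normD _ _))//.
  rewrite normrN -mulrA mulr_natl mulr2n lerD//; exact: H.
Qed.

Lemma exists_sol ps : base ps -> exists2 x, loops x & forall i, Op ps x i = x i.
Proof.
move=> bps; apply: (@picard_fixpoint R _ (fun i : C * R => w i.1) (Op ps) loops (fun=> 0) 1).
- by move=> i; rewrite ltW.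
- by move=> x; exact: loops_Op.
- move=> x y d Ux Uy d0 xy i; rewrite -[X in X / 2](addr0 d).
  by apply: Op_lip => // c; rewrite subrr normr0 mul0r.
- by move=> xs x K; exact: loops_closed.
- exact: loops0.
- exact: ler01.
- move=> [c t]; rewrite subr0 mul1r.
  by have [_ H _] := loops_Op bps loops0 c; exact: H.
Qed.

Definition ashift (ps : C -> R) (n : C -> int) (c : C) : R := ps c + 2 * pi * (n c)%:~R.

Lemma base_ashift ps n : base ps -> angle_shift n -> base (ashift ps n).
Proof. by move=> bps sn c bc; rewrite /ashift bps// sn// mulr0 addr0. Qed.

Lemma Xt_ashift ps n x t : Xt (ashift ps n) x t = fun c => Xt ps x t c + 2 * pi * (n c)%:~R.
Proof.
apply/funext => c; rewrite /Xt /ashift.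
have lem (a b u v : R) : a + b + u + v = a + u + v + b by ring.
by rewrite lem.
Qed.

Lemma Fv_ashift ps n x c : base ps -> angle_shift n -> loops x ->
  Fv (ashift ps n) x c = Fv ps x c.
Proof.
move=> bps sn Ux; apply/funext => t; rewrite /Fv Xt_ashift G_per//.
exact: adom_Xt.
Qed.

Lemma Op_ashift ps n x : base ps -> angle_shift n -> loops x ->
  Op (ashift ps n) x = Op ps x.
Proof.
move=> bps sn Ux; apply/funext => i; rewrite /Op Fv_ashift//; congr (- mean T _ / _ + _).
by apply/funext => t; rewrite Xt_ashift G_per//; exact: adom_Xt.
Qed.

(** Phases that differ by multiples of [2 * pi] have the same set of fixed loops, and [xget] depends
    on that set alone; so the chosen loop is periodic in the phase by construction. *)
Lemma solution_operator : {sol : (C -> R) -> C * R -> R |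
  (forall ps, base ps -> loops (sol ps) /\ forall i, Op ps (sol ps) i = sol ps i) /\
  forall ps n, base ps -> angle_shift n -> sol (ashift ps n) = sol ps}.
Proof.
apply: cid; pose sol ps := xget (fun=> 0) [set x | loops x /\ forall i, Op ps x i = x i].
exists sol; split=> [ps /exists_sol[x Ux Hx]|ps n bps sn].
  by rewrite /sol; case: xgetP => [y _ [] //|/(_ x)]; case.
rewrite /sol; congr xget; apply/seteqP; split=> x /= [Ux Hx]; split=> // i;
  by have := Hx i; rewrite Op_ashift.
Qed.

Definition sol : (C -> R) -> C * R -> R := sval solution_operator.

Lemma solP ps : base ps -> loops (sol ps) /\ forall i, Op ps (sol ps) i = sol ps i.
Proof. by have [H _] := svalP solution_operator; exact: H. Qed.

Lemma sol_ashift ps n : base ps -> angle_shift n -> sol (ashift ps n) = sol ps.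
Proof. by have [_ H] := svalP solution_operator; exact: H. Qed.

(** Both loops are fixed, so [Op_lip] improves a bound [d] to [(d + de) / 2]. Iteration from the
    crude size bound leaves [de] in the limit, with constant 1. *)
Lemma sol_lip ps ps' de : base ps -> base ps' -> 0 <= de ->
  (forall c, `|ps c - ps' c| <= de * w c) ->
  forall i, `|sol ps i - sol ps' i| <= de * w i.1.
Proof.
move=> bps bps' de0 pp i.
have [Ux Hx] := solP bps; have [Uy Hy] := solP bps'.
have H n : forall i, `|sol ps i - sol ps' i| <= (de + 2 / 2 ^+ n) * w i.1.
  elim: n => [|n IH] [c t].
    rewrite expr0 divr1 (le_trans (ler_normB _ _))//=.
    have [_ A _] := Ux c; have [_ B _] := Uy c.
    apply: (le_trans (lerD (A t) (B t))).
    by rewrite (_ : w c + w c = 2 * w c) ?ler_wpM2r ?(ltW (w0 c)) ?lerDr//; ring.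
  rewrite -Hx -Hy; have := Op_lip bps bps' Ux Uy _ de0 IH pp (c, t).
  have -> : (de + 2 / 2 ^+ n + de) / 2 = de + 2 / 2 ^+ n.+1.
    by rewrite exprS; field; rewrite expf_neq0 ?pnatr_eq0.
  by apply; rewrite addr_ge0// divr_ge0 ?exprn_ge0.
apply: (@le_of_small _ _ _ (2 * w i.1)) => n; apply: le_trans (H n i) _.
by rewrite mulrDl mulrAC.
Qed.

Definition velo ps (c : C) (t : R) : R :=
  sg c * (Fv ps (sol ps) (cj c) t - mean T (Fv ps (sol ps) (cj c))).

Lemma sol_deriv ps c t : base ps ->
  is_derive t (1 : R) (fun s => sol ps (c, s)) (velo ps c t).
Proof.
move=> bps; have [Ux Hx] := solP bps.
have := Op_deriv c t bps Ux; congr (is_derive _ _ _ _).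
by apply/funext => s; exact: Hx.
Qed.

Lemma mean_sol ps c : base ps -> mean T (fun t => sol ps (c, t)) =
  - mean T (fun t => G c (Xt ps (sol ps) t)) / beta c.
Proof.
move=> bps; have [Ux Hx] := solP bps; have cF := Fv_cont (c:=cj c) bps Ux.
rewrite (_ : (fun t => _) = fun t => Op ps (sol ps) (c, t)); last first.
  by apply/funext => t; rewrite Hx.
rewrite /Op /= meanD; [|exact: cont_cst|]; last first.
  by apply: contM; [exact: cont_cst|exact: osc_cont].
by rewrite mean_cst// meanZ ?mean_osc ?mulr0 ?addr0//; exact: osc_cont.
Qed.

(** The means of the loop were chosen to annihilate the mean force in all coordinates with
    [beta c != 0]; what remains is the mean torque on the angles, the only obstruction to a true
    orbit. *)
Lemma mean_Fv ps c : base ps -> mean T (Fv ps (sol ps) c) =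
  if beta c == 0 then mean T (fun t => G c (Xt ps (sol ps) t)) else 0.
Proof.
move=> bps; have [Ux Hx] := solP bps; have cx := x_cont (c:=c) Ux.
rewrite /Fv meanD; [|by apply: contM; [exact: cont_cst|]|exact: G_cont].
rewrite meanZ// mean_sol//; case: eqP => [->|/eqP b0]; first by rewrite mul0r add0r.
by rewrite mulrCA divff// mulr1 addNr.
Qed.

(** Momentum times velocity minus the Hamiltonian. The linear term [om . p] has cancelled against
    the constant part of the velocities, so deviations from the linear flow appear in place of
    positions. *)
Definition lagr ps (t : R) : R :=
  \sum_d sol ps (false, d, t) * velo ps (true, d) t
  - \sum_c beta c / 2 * sol ps (c, t) ^+ 2 - P (Xt ps (sol ps) t).
Definition act ps : R := mean T (lagr ps).

Lemma P_cont ps x : base ps -> loops x -> continuous (fun t => P (Xt ps x t)).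
Proof.
move=> bps Ux; apply: (@lip_continuous _ _ (\sum_c eta c * (Kom * w c) + KP * Kom ^+ 2)) => s t st.
have d0 : 0 <= Kom * `|s - t| by rewrite mulr_ge0 ?Kom_ge0.
have H := P_taylor (adom_Xt t bps Ux) (adom_Xt s bps Ux) d0 (fun i => Xt_lip ps s t i Ux).
set y := Xt ps x s in H *; set y' := Xt ps x t in H *.
have -> : P y - P y' = (P y - P y' - \sum_c G c y' * (y c - y' c)) + \sum_c G c y' * (y c - y' c) by ring.
rewrite (le_trans (ler_normD _ _))// addrC mulrDl lerD//.
  rewrite mulr_suml (le_trans (ler_norm_sum _ _ _))// ler_sum// => c _.
  rewrite normrM -mulrA; apply: ler_pM => //; first by apply: G_bd; exact: adom_Xt.
  by rewrite mulrAC; exact: Xt_lip.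
apply: (le_trans H); rewrite exprMn mulrA ler_wpM2l ?(mulr_ge0 KP0 (sqr_ge0 _))//.
by rewrite expr2 ler_piMr.
Qed.

Lemma velo_cont ps c : base ps -> continuous (velo ps c).
Proof.
move=> bps; have [Ux _] := solP bps.
apply: contM; first exact: cont_cst.
by apply: contB; [exact: Fv_cont|exact: cont_cst].
Qed.

Lemma sol_cont ps c : base ps -> continuous (fun t => sol ps (c, t)).
Proof. by move=> bps; have [Ux _] := solP bps; exact: x_cont. Qed.

Lemma lagr_cont ps : base ps -> continuous (lagr ps).
Proof.
move=> bps; have [Ux _] := solP bps.
apply: contB; last exact: P_cont.
apply: contB; apply: cont_sum => i.
  by apply: contM; [exact: sol_cont|exact: velo_cont].
by apply: contM; [exact: cont_cst|apply: contM; exact: sol_cont].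
Qed.

Lemma sum_conj (f : C -> R) : \sum_c f c = \sum_d (f (false, d) + f (true, d)).
Proof.
rewrite big_split/= addrC.
rewrite (eq_bigr (fun c => f (c.1, c.2))); last by case.
by rewrite -(pair_bigA _ (fun b d => f (b, d)))/= big_bool.
Qed.

Definition Kact : R :=
  \sum_d w (false, d) * (4 * kap (false, d)) + \sum_c `|beta c| / 2 * w c ^+ 2 + KP * 4.

(** The mean torque is, up to sign, the gradient of the action in the phase. The first variation
    through the change of the loop vanishes because the loop solves the projected equations. *)
Lemma act_diff ps ps' de : base ps -> base ps' -> 0 <= de ->
  (forall c, `|ps' c - ps c| <= de * w c) ->
  `|act ps' - act ps + \sum_c mean T (fun t => G c (Xt ps (sol ps) t)) * (ps' c - ps c)|
    <= Kact * de ^+ 2.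
Proof.
move=> bps bps' de0 pp.
have [Ux _] := solP bps; have [Ux' _] := solP bps'.
have dx i := sol_lip bps' bps de0 pp i.
have dX t i : `|Xt ps' (sol ps') t i - Xt ps (sol ps) t i| <= 2 * de * w i.
  have -> : Xt ps' (sol ps') t i - Xt ps (sol ps) t i =
    (sol ps' (i, t) - sol ps (i, t)) + (ps' i - ps i).
    have lem (a b c a' c' : R) : a + b + c - (a' + b + c') = (c - c') + (a - a') by ring.
    exact: lem.
  rewrite (le_trans (ler_normD _ _))// (_ : 2 * de * w i = de * w i + de * w i); last by ring.
  by rewrite lerD// dx.
pose dl c t := sol ps' (c, t) - sol ps (c, t).
pose dv c t := velo ps' c t - velo ps c t.
pose m c := mean T (Fv ps (sol ps) c).
(* Two quantities of mean zero are inserted: the time derivative of momentum times position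
   variation, and [m c * dl c], where either the mean force [m c] or the mean of [dl c] is zero.
   After this [E] is quadratic in the variations at every time, as [EE] makes explicit. *)
pose E t := lagr ps' t - lagr ps t + \sum_c G c (Xt ps (sol ps) t) * (ps' c - ps c)
  - \sum_d (sol ps (false, d, t) * dv (true, d) t + dl (true, d) t * velo ps (false, d) t)
  + \sum_c m c * dl c t.
have cdl c : continuous (dl c) by apply: contB; exact: sol_cont.
have cdv c : continuous (dv c) by apply: contB; exact: velo_cont.
have cG c : continuous (fun t => G c (Xt ps (sol ps) t)) by exact: G_cont.
have c1 : continuous (fun t => lagr ps' t - lagr ps t) by apply: contB; exact: lagr_cont.
have c2 : continuous (fun t => \sum_c G c (Xt ps (sol ps) t) * (ps' c - ps c)).
  by apply: cont_sum => c; apply: contM => //; exact: cont_cst.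
have c3' d : continuous (fun t => sol ps (false, d, t) * dv (true, d) t + dl (true, d) t * velo ps (false, d) t).
  by apply: contD; apply: contM => //; [exact: sol_cont|exact: velo_cont].
have c3 := cont_sum (r := index_enum D) c3'.
have c4 : continuous (fun t => \sum_c m c * dl c t).
  by apply: cont_sum => c; apply: contM => //; exact: cont_cst.
have cE : continuous E by apply: contD => //; apply: contB => //; exact: contD.
have mE : mean T E = act ps' - act ps + \sum_c mean T (fun t => G c (Xt ps (sol ps) t)) * (ps' c - ps c).
  rewrite /E meanD//; last by apply: contB => //; exact: contD.
  rewrite meanB//; last exact: contD.
  rewrite meanD// meanB; [|exact: lagr_cont..].
  rewrite !mean_sum//; last 2 first.
  - by move=> c; apply: contM => //; exact: cont_cst.
  - by move=> c; apply: contM => //; exact: cont_cst.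
  rewrite [X in _ - X]big1 ?subr0; last first.
    move=> d _; apply: (@mean_by_parts _ T (fun t => sol ps (false, d, t)) (dl (true, d))
      (velo ps (false, d)) (dv (true, d)) (velo_cont (c:=(false, d)) bps) (cdv (true, d))).
    - by move=> x; exact: sol_deriv.
    - by move=> x; apply: is_deriveB; exact: sol_deriv.
    - by move=> t; have [-> _ _] := Ux (false, d).
    - by move=> t; rewrite /dl; have [-> _ _] := Ux (true, d); have [-> _ _] := Ux' (true, d).
  rewrite [X in _ + X]big1 ?addr0; last first.
    move=> c _; rewrite meanZ// /m mean_Fv//; case: eqP => [b0|_]; last by rewrite mul0r.
    rewrite meanB; [|exact: sol_cont..].
    rewrite (mean_sol c bps) (mean_sol c bps') b0 invr0.
    by move: (mean _ _) (mean _ _) => u v; rewrite !mulr0 subrr mulr0.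
  congr (_ + _); apply: eq_bigr => c _.
  rewrite (_ : (fun t => _) = fun t => (ps' c - ps c) * G c (Xt ps (sol ps) t)).
    by rewrite meanZ// mulrC.
  by apply/funext => t; rewrite mulrC.
rewrite -mE; apply: mean_norm => // t _.
have vq p d : velo p (true, d) t = Fv p (sol p) (false, d) t - mean T (Fv p (sol p) (false, d)).
  by rewrite /velo /sg /cj /= mul1r.
have vp p d : velo p (false, d) t = - (Fv p (sol p) (true, d) t - mean T (Fv p (sol p) (true, d))).
  by rewrite /velo /sg /cj /= mulN1r.
have EE : E t = \sum_d dl (false, d) t * dv (true, d) t - \sum_c beta c / 2 * dl c t ^+ 2
  - (P (Xt ps' (sol ps') t) - P (Xt ps (sol ps) t)
     - \sum_c G c (Xt ps (sol ps) t) * (Xt ps' (sol ps') t c - Xt ps (sol ps) t c)).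
  rewrite /E /lagr !sum_conj.
  set P1 := P (Xt ps' _ _); set P2 := P (Xt ps _ _).
  pose h c := beta c / 2.
  pose A1 d := sol ps' (false, d, t) * velo ps' (true, d) t.
  pose A2 d := sol ps (false, d, t) * velo ps (true, d) t.
  pose B1 d := h (false, d) * sol ps' (false, d, t) ^+ 2 + h (true, d) * sol ps' (true, d, t) ^+ 2.
  pose B2 d := h (false, d) * sol ps (false, d, t) ^+ 2 + h (true, d) * sol ps (true, d, t) ^+ 2.
  pose g c := G c (Xt ps (sol ps) t).
  pose C1 d := g (false, d) * (ps' (false, d) - ps (false, d)) + g (true, d) * (ps' (true, d) - ps (true, d)).
  pose C2 d := sol ps (false, d, t) * dv (true, d) t + dl (true, d) t * velo ps (false, d) t.
  pose C3 d := m (false, d) * dl (false, d) t + m (true, d) * dl (true, d) t.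
  pose E1 d := dl (false, d) t * dv (true, d) t.
  pose E2 d := h (false, d) * dl (false, d) t ^+ 2 + h (true, d) * dl (true, d) t ^+ 2.
  pose E3 d := g (false, d) * (Xt ps' (sol ps') t (false, d) - Xt ps (sol ps) t (false, d))
    + g (true, d) * (Xt ps' (sol ps') t (true, d) - Xt ps (sol ps) t (true, d)).
  have key : \sum_d (A1 d - B1 d - A2 d + B2 d + C1 d - C2 d + C3 d - E1 d + E2 d - E3 d) = 0.
    rewrite big1// => d _; rewrite /A1 /A2 /B1 /B2 /C1 /C2 /C3 /E1 /E2 /E3 /g /h /dv /dl !vq !vp.
    rewrite -/(m (false, d)) -/(m (true, d)) /Fv /Xt; by field.
  change (\sum_d A1 d - \sum_d B1 d - P1 - (\sum_d A2 d - \sum_d B2 d - P2)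
    + \sum_d C1 d - \sum_d C2 d + \sum_d C3 d =
    \sum_d E1 d - \sum_d E2 d - (P1 - P2 - \sum_d E3 d)).
  clearbody A1 A2 B1 B2 C1 C2 C3 E1 E2 E3 P1 P2.
  rewrite !(big_split, sumrN)/= in key.
  by apply/eqP; rewrite -subr_eq0 -[X in _ == X]key; apply/eqP; ring.
have dF c s : `|Fv ps' (sol ps') c s - Fv ps (sol ps) c s| <= kap c * (2 * de).
  have -> : Fv ps' (sol ps') c s - Fv ps (sol ps) c s = beta c * (sol ps' (c, s) - sol ps (c, s)) +
    (G c (Xt ps' (sol ps') s) - G c (Xt ps (sol ps) s)) by rewrite /Fv; ring.
  rewrite (le_trans (ler_normD _ _))// /kap mulrDl lerD//.
    rewrite normrM -mulrA ler_wpM2l// (le_trans (dx _))//= mulrC ler_wpM2l ?(ltW (w0 _))//.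
    by rewrite mulr_natl mulr2n lerDl.
  apply: G_lip; [exact: adom_Xt|exact: adom_Xt|by rewrite mulr_ge0|move=> i].
  exact: dX.
have dvb d : `|dv (true, d) t| <= 4 * kap (false, d) * de.
  have cF c p : base p -> continuous (Fv p (sol p) c).
    by move=> bp; have [Up _] := solP bp; exact: Fv_cont.
  have -> : dv (true, d) t = (Fv ps' (sol ps') (false, d) t - Fv ps (sol ps) (false, d) t)
    - mean T (fun s => Fv ps' (sol ps') (false, d) s - Fv ps (sol ps) (false, d) s).
    by rewrite meanB; [rewrite /dv !vq; ring|exact: cF|exact: cF].
  rewrite (le_trans (ler_normB _ _))//.
  have -> : 4 * kap (false, d) * de = kap (false, d) * (2 * de) + kap (false, d) * (2 * de) by ring.
  apply: lerD => //; apply: mean_norm => //.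
  by apply: contB; exact: cF.
rewrite EE (le_trans (ler_normB _ _))// /Kact !mulrDl lerD//; last first.
  rewrite -mulrA (_ : 4 * de ^+ 2 = (2 * de) ^+ 2); last by ring.
  apply: P_taylor; [exact: adom_Xt|exact: adom_Xt|by rewrite mulr_ge0|move=> i].
  exact: dX.
rewrite (le_trans (ler_normB _ _))// lerD// (le_trans (ler_norm_sum _ _ _))// mulr_suml.
  apply: ler_sum => d _; rewrite normrM.
  have -> : w (false, d) * (4 * kap (false, d)) * de ^+ 2 =
    (de * w (false, d)) * (4 * kap (false, d) * de) by ring.
  by apply: ler_pM => //; exact: dx.
apply: ler_sum => c _; rewrite !normrM normfV [`|2|]ger0_norm// -[leRHS]mulrA.
rewrite ler_wpM2l ?mulr_ge0 ?invr_ge0//.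
rewrite -[leLHS]expr2 -exprMn ler_pXn2r ?nnegrE ?mulr_ge0 ?(ltW (w0 _))// mulrC.
exact: dx.
Qed.

(** Moving a single phase by [h] of either sign changes the action by [- g * h] up to a multiple of
    [h ^ 2], which at an extremum forces [g = 0]. *)
Lemma act_critical ps : base ps ->
  (forall ps', base ps' -> act ps' <= act ps) \/ (forall ps', base ps' -> act ps <= act ps') ->
  forall c, beta c = 0 -> mean T (fun t => G c (Xt ps (sol ps) t)) = 0.
Proof.
move=> bps ext c bc; set g := mean _ _.
have H h : exists2 ps', base ps' & `|act ps' - act ps + g * h| <= Kact / w c ^+ 2 * h ^+ 2.
  pose ps' c' := ps c' + (if c' == c then h else 0).
  have bps' : base ps'.
    move=> c' bc'; rewrite /ps' bps// add0r; case: eqP => // cc.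
    by rewrite cc bc eqxx in bc'.
  have psd c' : ps' c' - ps c' = if c' == c then h else 0 by rewrite /ps' addrC addKr.
  exists ps' => //.
  have := @act_diff ps ps' (`|h| / w c) bps bps'.
  rewrite divr_ge0 ?(ltW (w0 _))// => /(_ isT).
  rewrite (bigD1 c)//= psd eqxx big1 ?addr0; last first.
    by move=> i ic; rewrite psd (negbTE ic) mulr0.
  have -> : Kact * (`|h| / w c) ^+ 2 = Kact / w c ^+ 2 * h ^+ 2.
    by rewrite expr_div_n real_normK ?num_real// mulrA mulrAC.
  apply => i.
  rewrite psd; case: eqP => [->|_]; first by rewrite divfK// gt_eqF.
  by rewrite normr0 mulr_ge0 ?divr_ge0 ?(ltW (w0 _)).
case: ext => ext.
  apply: (@zero_of_quadratic _ _ (Kact / w c ^+ 2)) => h.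
  have [ps' bps' ] := H h; rewrite ler_norml => /andP[+ _] => Ha.
  by rewrite (le_trans Ha)// gerDr subr_le0 ext.
apply/eqP; rewrite -oppr_eq0; apply/eqP.
apply: (@zero_of_quadratic _ _ (Kact / w c ^+ 2)) => h.
have [ps' bps' ] := H h; rewrite ler_norml => /andP[_ Ha].
by rewrite mulNr lerN2 (le_trans _ Ha)// lerDr subr_ge0 ext.
Qed.

Lemma act_ashift ps n : base ps -> angle_shift n -> act (ashift ps n) = act ps.
Proof.
move=> bps sn; have [Ux _] := solP bps; congr mean; apply/funext => t; rewrite /lagr /velo.
rewrite sol_ashift// Xt_ashift P_per//; last exact: adom_Xt.
congr (_ - _ - _); apply: eq_bigr => d _; by rewrite Fv_ashift.
Qed.

Lemma act_le ps ps' de : base ps -> base ps' -> 0 <= de -> de <= 1 ->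
  (forall c, `|ps' c - ps c| <= de * w c) ->
  `|act ps' - act ps| <= (Kact + \sum_c eta c * w c) * de.
Proof.
move=> bps bps' de0 de1 pp; have [Ux _] := solP bps.
have -> : act ps' - act ps = (act ps' - act ps + \sum_c mean T (fun t => G c (Xt ps (sol ps) t)) * (ps' c - ps c))
   - \sum_c mean T (fun t => G c (Xt ps (sol ps) t)) * (ps' c - ps c) by rewrite addrK.
have K0 : 0 <= Kact.
  rewrite /Kact !addr_ge0 ?mulr_ge0 ?sumr_ge0// => c _; rewrite !mulr_ge0 ?(ltW (w0 _)) ?sqr_ge0 ?invr_ge0//.
  exact: kap_ge0.
rewrite (le_trans (ler_normB _ _))// mulrDl lerD//.
  apply: (le_trans (act_diff bps bps' de0 pp)).
  by rewrite ler_wpM2l// expr2 ler_piMr.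
rewrite (le_trans (ler_norm_sum _ _ _))// mulr_suml ler_sum// => c _.
rewrite normrM -mulrA; apply: ler_pM => //; last by rewrite mulrC.
apply: mean_norm => // [|t _]; first exact: G_cont.
by apply: G_bd; exact: adom_Xt.
Qed.

(** Turns by [2 * pi] reduce all phases to a compact cube. The cube has one side per coordinate, and
    [pv] discards those that are not angles. *)
Lemma act_extrema : exists ps1 ps2, [/\ base ps1, base ps2 &
  forall ps, base ps -> act ps2 <= act ps <= act ps1].
Proof.
pose N := #|{: C}|.
pose pv (th : 'rV[R]_N) (c : C) : R := if beta c == 0 then th 0 (enum_rank c) else 0.
have bpv th : base (pv th) by move=> c bc; rewrite /pv (negbTE bc).
pose box : set 'rV[R]_N := [set th | forall i, [set` `[0, 2 * pi]] (th ord0 i)].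
have cbox : compact box.
  by apply: (@rV_compact _ _ (fun=> [set` `[0, 2 * pi]])) => i; exact: segment_compact.
have box0 : box !=set0.
  by exists 0 => i /=; rewrite mxE in_itv/= lexx (ltW two_pi_gt0).
pose L := \sum_c (w c)^-1.
have L0 : 0 <= L by apply: sumr_ge0 => c _; rewrite invr_ge0 ltW.
have cact : continuous (fun th => act (pv th)).
  move=> th; have FF : Filter (nbhs th) by exact: nbhs_filter.
  suff : (fun x => act (pv x)) @ nbhs th --> act (pv th) by [].
  apply/(@cvgrPdist_le _ _ _ _ FF) => e e0.
  pose K := `|Kact + \sum_c eta c * w c| * L + 1.
  have K0 : 0 < K by rewrite ltr_wpDl// mulr_ge0.
  near=> th'.
  have d1 : `|th - th'| < Num.min (1 / (L + 1)) (e / K).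
    near: th'; apply/nbhs_ballP; exists (Num.min (1 / (L + 1)) (e / K)).
      by rewrite /= lt_min !divr_gt0// ltr_wpDl.
    by move=> y; rewrite -ball_normE.
  move: d1; rewrite lt_min => /andP[d1 d2].
  have dL1 : `|th - th'| * L <= 1.
    move: d1; rewrite ltr_pdivlMr ?ltr_wpDl// mulrDr mulr1 => /ltW; apply: le_trans.
    by rewrite lerDl.
  have H := @act_le (pv th') (pv th) (`|th - th'| * L) (bpv _) (bpv _) (mulr_ge0 (normr_ge0 _) L0) dL1.
  apply: le_trans (H _) _ => [c|].
    apply: (@le_trans _ _ `|th - th'|).
      rewrite /pv; case: ifP => _; last by rewrite subrr normr0.
      have -> : th 0 (enum_rank c) - th' 0 (enum_rank c) = (th - th') 0 (enum_rank c) by rewrite !mxE.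
      rewrite [leRHS]/Num.norm/= mx_normrE; apply/bigmax_geP; right => /=.
      by exists (0, enum_rank c).
    rewrite -mulrA ler_peMr// mulrC -ler_pdivrMl// mulr1 /L (bigD1 c)//= lerDl sumr_ge0// => i _.
    by rewrite invr_ge0 ltW.
  move/ltW: d2; rewrite ler_pdivlMr// => d2; apply: le_trans d2.
  rewrite mulrCA ler_wpM2l// /K; apply: (@le_trans _ _ (`|Kact + \sum_c eta c * w c| * L)).
    by rewrite ler_wpM2r// ler_norm.
  by rewrite lerDl.
have cw : {within box, continuous (fun th => act (pv th))} by exact: continuous_subspaceT.
have [th1 _ H1] := compact_EVT_max box0 cbox cw.
have [th2 _ H2] := compact_EVT_min box0 cbox cw.
exists (pv th1), (pv th2); split=> // ps bps.
pose n c : int := if beta c == 0 then - Num.floor (ps c / (2 * pi)) else 0.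
have sn : angle_shift n by move=> c bc; rewrite /n (negbTE bc).
pose th : 'rV[R]_N := \row_i ashift ps n (enum_val i).
have pth : pv th = ashift ps n.
  apply/funext => c; rewrite /pv mxE enum_rankK; case: ifPn => // bc.
  by rewrite (base_ashift bps sn).
have thbox : th \in box.
  rewrite inE => i /=; rewrite mxE /ashift /n; set c := enum_val i.
  have p0 := two_pi_gt0.
  case: ifPn => bc; last by rewrite bps// mulr0 addr0 in_itv/= lexx ltW.
  have := floor_itv (ps c / (2 * pi)); set f := Num.floor _ => /andP[].
  rewrite ler_pdivlMr// ltr_pdivrMr// intrD mulrDl mul1r => f1 /ltW f2.
  rewrite (_ : pi + pi = 2 * pi :> R); last by ring.
  have -> : 2 * pi * (- f)%:~R = - (f%:~R * (2 * pi)) :> R by rewrite mulrNz; ring.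
  by rewrite in_itv; apply/andP; split; [change (0 <= ps c - f%:~R * (2 * pi)); lra|change (ps c - f%:~R * (2 * pi) <= 2 * pi); lra].
by rewrite -(act_ashift bps sn) -pth H1// H2.
Unshelve. all: by end_near. Qed.

Definition true_sol ps : Prop := forall c t,
  is_derive t (1 : R) (fun s => sol ps (c, s)) (sg c * Fv ps (sol ps) (cj c) t).

Lemma critical_true ps : base ps ->
  (forall c, beta c = 0 -> mean T (fun t => G c (Xt ps (sol ps) t)) = 0) -> true_sol ps.
Proof.
move=> bps crit c t; have := sol_deriv c t bps; rewrite /velo mean_Fv//.
by case: eqP => [/crit ->|_]; rewrite subr0.
Qed.

(** The Lagrangian as a function of the phase point alone: the velocity of a position is the
    unprojected force there, as the mean force in momentum directions vanishes. Hence the action is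
    an invariant of the orbit, insensitive to time translation. *)
Definition slagr (y : C -> R) : R :=
  \sum_d y (false, d) * (beta (false, d) * y (false, d) + G (false, d) y)
  - \sum_c beta c / 2 * y c ^+ 2 - P y.

Lemma lagr_state ps t : base ps -> lagr ps t = slagr (Xt ps (sol ps) t).
Proof.
move=> bps; have X c : beta c != 0 -> Xt ps (sol ps) t c = sol ps (c, t).
  by move=> bc; rewrite /Xt bps// om0// mul0r !add0r.
rewrite /lagr /slagr; congr (_ - _ - _); [apply: eq_bigr => d _|apply: eq_bigr => c _].
  rewrite X// /velo /sg /cj /= mul1r mean_Fv// (negbTE (betap d)) subr0.
  by rewrite /Fv.
have [->|bc] := eqVneq (beta c) 0; first by rewrite !mul0r.
by rewrite X.
Qed.

Lemma slagr_shift y n : adom y -> angle_shift n ->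
  slagr (fun c => y c + 2 * pi * (n c)%:~R) = slagr y.
Proof.
move=> ay sn; rewrite /slagr P_per//; congr (_ - _ - _); [apply: eq_bigr => d _|apply: eq_bigr => c _].
  by rewrite G_per// sn// mulr0 addr0.
have [->|bc] := eqVneq (beta c) 0; first by rewrite !mul0r.
by rewrite sn// mulr0 addr0.
Qed.

Lemma act_translate ps ps' tau : base ps -> base ps' ->
  (forall t, exists2 n, angle_shift n & forall c,
    Xt ps' (sol ps') t c = Xt ps (sol ps) (t + tau) c + 2 * pi * (n c)%:~R) ->
  act ps' = act ps.
Proof.
move=> bps bps' H; have [Ux _] := solP bps.
rewrite /act -(mean_shift tau (lagr_cont bps)); last first.
  move=> t; rewrite !lagr_state// -(slagr_shift (adom_Xt t bps Ux) kw_shift).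
  by congr slagr; apply/funext => c; exact: Xt_shift.
congr mean; apply/funext => t; rewrite !lagr_state//.
have [n sn Hn] := H t; rewrite -(slagr_shift (adom_Xt (t + tau) bps Ux) sn).
by congr slagr; apply/funext => c.
Qed.

Theorem two_solutions : exists ps1 ps2, [/\ base ps1, base ps2, true_sol ps1, true_sol ps2 &
  (forall ps, base ps -> true_sol ps) \/
  ~ exists tau, forall t, exists2 n, angle_shift n & forall c,
    Xt ps2 (sol ps2) t c = Xt ps1 (sol ps1) (t + tau) c + 2 * pi * (n c)%:~R].
Proof.
have [ps1 [ps2 [b1 b2 H]]] := act_extrema; exists ps1, ps2; split=> //.
- apply: critical_true => //; apply: act_critical => //; left => ps /H.
  by case/andP.
- apply: critical_true => //; apply: act_critical => //; right => ps /H.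
  by case/andP.
have [E|nE] := eqVneq (act ps2) (act ps1).
  left=> ps bps; apply: critical_true => //; apply: act_critical => //; left => ps' bps'.
  have /andP[h1 _] := H _ bps; have /andP[_ h2] := H _ bps'.
  by rewrite (le_trans h2)// -E.
right=> -[tau Htau]; move/eqP: nE; apply.
exact: act_translate Htau.
Qed.

Definition moves (x : (C -> R) -> C * R -> R) ps : Prop := forall c t,
  is_derive t (1 : R) (fun s => x ps (c, s)) (sg c * Fv ps (x ps) (cj c) t).

(** The interface to the normal form: loops with their size and their equations, and the alternative
    between two distinct orbits and a whole torus of periodic ones. *)
Theorem two_periodic_solutions : exists x : (C -> R) -> C * R -> R,
  (forall ps, base ps -> loops (x ps)) /\
  exists ps1 ps2, [/\ base ps1, base ps2, moves x ps1, moves x ps2 &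
  (forall ps, base ps -> moves x ps) \/
  ~ exists tau, forall t, exists2 n, angle_shift n & forall c,
    Xt ps2 (x ps2) t c = Xt ps1 (x ps1) (t + tau) c + 2 * pi * (n c)%:~R].
Proof. by exists sol; split; [move=> ps /solP[]|exact: two_solutions]. Qed.
End Dynamics.

(** * Cauchy estimates on polydiscs *)

Section ComplexReal.
Context {R : realType}.
Implicit Types (z w : Cx R) (x y : R).

Lemma normCxE z : `|z| = toC (absC z).
Proof. by case: z. Qed.

Lemma toC_le x y : (toC x <= toC y) = (x <= y).
Proof. by rewrite /toC lecR. Qed.

Lemma toC_lt x y : (toC x < toC y) = (x < y).
Proof. by rewrite /toC ltcR. Qed.

(** Radii and tolerances of the topology over [Cx R] are positive complex numbers; this turns them
    into the real ones used by [cder]. *)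
Lemma Cx_pos z : 0 < z -> z = toC (reC z) /\ 0 < reC z.
Proof.
case: z => a b; rewrite ltcE /= => /andP[/eqP b0 a0]; split=> //.
by rewrite /toC /reC /= b0.
Qed.

Lemma toCD x y : toC (x + y) = toC x + toC y.
Proof. by rewrite /toC; apply/eqP; rewrite eq_complex /= addr0 !eqxx. Qed.
Lemma toCN x : toC (- x) = - toC x.
Proof. by rewrite /toC; apply/eqP; rewrite eq_complex /= oppr0 !eqxx. Qed.
Lemma toCB x y : toC (x - y) = toC x - toC y.
Proof. by rewrite toCD toCN. Qed.
Lemma toCM x y : toC (x * y) = toC x * toC y.
Proof. by rewrite /toC; apply/eqP; rewrite eq_complex /= !mulr0 !mul0r subr0 addr0 !eqxx. Qed.
Lemma toC0 : toC 0 = 0 :> Cx R.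
Proof. by []. Qed.
Lemma toC1 : toC 1 = 1 :> Cx R.
Proof. by []. Qed.
Lemma reC_toC x : reC (toC x) = x. Proof. by []. Qed.
Lemma imC_toC x : imC (toC x) = 0. Proof. by []. Qed.
Lemma toC_re z : imC z = 0 -> z = toC (reC z).
Proof. by case: z => a b /= ->. Qed.

Lemma cder_unique f z a b : cder f z a -> cder f z b -> a = b :> Cx R.
Proof.
move=> Ha Hb; apply/eqP; rewrite -subr_eq0; apply/eqP; apply: absC_eq0.
apply/eqP; rewrite eq_le absC_ge0 andbT leNgt; apply/negP => p.
have p4 : 0 < absC (a - b) / 4 by rewrite divr_gt0.
have [d1 d10 H1] := Ha _ p4; have [d2 d20 H2] := Hb _ p4.
pose h := Num.min d1 d2 / 2.
have m0 : 0 < Num.min d1 d2 by rewrite lt_min d10.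
have h0 : 0 < h by rewrite divr_gt0.
have hm : h < Num.min d1 d2 by rewrite ltr_pdivrMr// ltr_pMr// ltr1n.
have hh : absC (toC h) = h by rewrite absC_toC gtr0_norm.
move: hm; rewrite lt_min => /andP[hd1 hd2].
have := H1 (toC h); rewrite hh => /(_ hd1) A.
have := H2 (toC h); rewrite hh => /(_ hd2) B.
have : absC ((a - b) * toC h) <= absC (a - b) / 2 * h.
  have -> : (a - b) * toC h = (f (z + toC h) - f z - b * toC h) - (f (z + toC h) - f z - a * toC h) by ring.
  by rewrite (le_trans (absCB _ _))// (le_trans (lerD B A))// -mulrDl ler_wpM2r ?(ltW h0)//; clear; lra.
rewrite absCM hh ler_pM2r// leNgt => /negP; apply.
by rewrite ltr_pdivrMr// ltr_pMr// ltr1n.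
Qed.

Lemma is_derive_eps (f : R -> R) t d :
  (forall e, 0 < e -> exists2 dl, 0 < dl & forall h, `|h| < dl -> `|f (t + h) - f t - d * h| <= e * `|h|) ->
  is_derive t (1 : R) f d.
Proof.
move=> H.
have L : (fun h : R => h^-1 *: ((f \o shift t) (h *: (1 : R)) - f t)) @ (0 : R)^' --> d.
  apply/cvgrPdist_le => e e0; have [dl dl0 K] := H e e0.
  near=> h.
  have h0 : h != 0 by near: h; exact: nbhs_dnbhs_neq.
  have hd : `|h| < dl by near: h; apply: dnbhs0_lt.
  have := K h hd; rewrite /= /GRing.scale/= mulr1 (addrC h t) => {}K.
  have -> : d - h^-1 * (f (t + h) - f t) = - (h^-1 * (f (t + h) - f t - d * h)).
    by field.
  by rewrite normrN normrM normfV ler_pdivrMl ?normr_gt0// [leRHS]mulrC; apply: K.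
have dd : derivable f t 1 by exact: (cvgP d L).
by apply: (DeriveDef dd); apply/cvg_lim; [exact: Rhausdorff|exact: L].
Unshelve. all: by end_near. Qed.

Lemma is_derive_epsP (f : R -> R) t d : is_derive t (1 : R) f d ->
  forall e, 0 < e -> exists2 dl, 0 < dl & forall h, `|h| < dl -> `|f (t + h) - f t - d * h| <= e * `|h|.
Proof.
move=> [df <-] e e0.
have /cvgrPdist_le /(_ e e0) := df.
move=> /nbhs_ballP[dl /= dl0 H]; exists dl => // h hd.
have [->|h0] := eqVneq h 0; first by rewrite addr0 mulr0 subrr subr0 normr0 mulr0.
have := H h; rewrite /ball/= sub0r normrN => /(_ hd h0).
rewrite /GRing.scale/= mulr1 (addrC h t) => K.
have -> : f (t + h) - f t - 'D_1 f t * h = - (h * ('D_1 f t - h^-1 * (f (t + h) - f t))).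
  by field.
by rewrite normrN normrM mulrC ler_wpM2r.
Qed.

Lemma derivable_cder (V : normedModType (Cx R)) (F : V -> Cx R) (x v : V) :
  derivable F x v -> cder (fun w => F (w *: v + x)) 0 ('D_v F x).
Proof.
move=> df e e0.
have e0' : 0 < toC e by rewrite -toC0 toC_lt.
have /cvgrPdist_le /(_ _ e0') := df.
move=> /nbhs_ballP[dl /= dl0 H].
have [dlE dl0'] := Cx_pos dl0.
exists (reC dl) => // h hd; rewrite add0r scale0r add0r.
have [->|h0] := eqVneq h 0.
  by rewrite scale0r add0r mulr0 subrr subr0 absC0 mulr0.
have := H h; rewrite /ball/= sub0r normrN normCxE dlE toC_lt => /(_ hd h0).
rewrite /GRing.scale/= normCxE toC_le => K.
have -> : F (h *: v + x) - F x - 'D_v F x * h =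
   - (h * ('D_v F x - h^-1 * (F (h *: v + x) - F x))) by field.
by rewrite absCN absCM mulrC ler_wpM2r ?absC_ge0.
Qed.

Lemma cder_re (phi : Cx R -> Cx R) z h d (t : R) : cder phi (z + toC t * h) d ->
  is_derive t (1 : R) (fun s => reC (phi (z + toC s * h))) (reC (d * h)).
Proof.
move=> H; apply: is_derive_eps => e e0.
have k0 : 0 < absC h + 1 by rewrite ltr_wpDl ?absC_ge0.
have [dl dl0 K] := H _ (divr_gt0 e0 k0).
exists (dl / (absC h + 1)) => [|s sd]; first by rewrite divr_gt0.
have sh : absC (toC s * h) <= `|s| * (absC h + 1).
  by rewrite absCM absC_toC ler_wpM2l// lerDl.
have sdl : absC (toC s * h) < dl.
  by apply: (le_lt_trans sh); rewrite -ltr_pdivlMr.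
have {}K := K _ sdl.
set z' := z + toC t * h in K *.
have e1 : z + toC (t + s) * h = z' + toC s * h by rewrite toCD /z'; ring.
have e2 : reC (d * h) * s = reC (d * (toC s * h)).
  by rewrite (_ : d * (toC s * h) = (d * h) * toC s); [rewrite [RHS]reCM reC_toC imC_toC mulr0 subr0|ring].
rewrite e1 e2 -!reCN -!reCD; apply: (le_trans (re_le_absC _)).
apply: (le_trans K); apply: (le_trans (ler_wpM2l (ltW (divr_gt0 e0 k0)) sh)).
by rewrite mulrCA mulrC divfK// gt_eqF.
Qed.

Lemma mvt01 (f df : R -> R) (L : R) : (forall t : R, 0 <= t <= 1 -> is_derive t (1 : R) f (df t)) ->
  (forall t : R, 0 <= t <= 1 -> `|df t| <= L) -> `|f 1 - f 0| <= L.
Proof.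
move=> H HL.
have cf : {within `[0, 1], continuous f}.
  apply: derivable_within_continuous => t; rewrite in_itv/= => /H[]; by [].
have [|c] := @MVT_segment R f df 0 1 ler01 _ cf.
  by move=> x; rewrite in_itv/= => /andP[x0 x1]; apply: H; rewrite !ltW.
by rewrite in_itv/= subr0 mulr1 => c01 ->; exact: HL.
Qed.

(** The real mean value theorem is applied along the segment to the real parts of [phi] and of [i]
    times [phi]; adding the two bounds gives the factor 2. *)
Lemma cder_lip (phi D : Cx R -> Cx R) z h (L : R) :
  (forall t : R, 0 <= t <= 1 -> cder phi (z + toC t * h) (D (z + toC t * h))) ->
  (forall t : R, 0 <= t <= 1 -> absC (D (z + toC t * h)) <= L) ->
  absC (phi (z + h) - phi z) <= 2 * L * absC h.
Proof.
move=> H HL.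
have re_part (u : Cx R) : absC u = 1 -> `|reC (u * (phi (z + h) - phi z))| <= L * absC h.
  move=> u1; have -> : reC (u * (phi (z + h) - phi z)) =
      reC (u * phi (z + toC 1 * h)) - reC (u * phi (z + toC 0 * h)).
    by rewrite toC1 toC0 mul1r mul0r addr0 mulrBr reCD reCN.
  apply: (@mvt01 (fun s => reC (u * phi (z + toC s * h)))
    (fun t => reC (u * D (z + toC t * h) * h))) => t t01.
    by apply: (@cder_re (fun w => u * phi w)); apply: cderZ; exact: H.
  apply: (le_trans (re_le_absC _)); rewrite !absCM u1 mul1r ler_wpM2r ?absC_ge0//.
  exact: HL.
have one : absC (1 : Cx R) = 1 by exact: ComplexField.Normc.normc1.
have oneI : absC (cpt 0 1 : Cx R) = 1 by rewrite absCE /= expr0n/= add0r sqrtr_sqr normr1.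
apply: (le_trans (absC_le _)).
have := re_part 1 one; rewrite mul1r => A.
have := re_part _ oneI; rewrite reCM reC_cpt imC_cpt mul0r mul1r sub0r normrN => B.
by apply: (le_trans (lerD A B)); rewrite -mulrA mulr_natl mulr2n.
Qed.
End ComplexReal.

Section Slices.
Context {R : realType} {I : finType}.
Variables (ang : pred I) (F : (I -> Cx R) -> Cx R) (F' : I -> (I -> Cx R) -> Cx R).
Implicit Types (rho L : I -> R) (y : I -> Cx R).

Definition cbump y (c : I) (w : Cx R) (i : I) : Cx R := if i == c then y i + w else y i.
(** Angles are limited only in their imaginary part, so that a polydisc contains a strip around the
    full real line in each angle. *)
Definition csize (c : I) (z : Cx R) : R := if ang c then `|imC z| else absC z.
Definition pdom rho y : Prop := forall c, csize c (y c) <= rho c.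
Definition sholo rho : Prop := forall y c, pdom rho y ->
  cder (fun w => F (cbump y c w)) 0 (F' c y).

Lemma csizeD c z w : csize c (z + w) <= csize c z + csize c w.
Proof. by rewrite /csize; case: (ang c); [rewrite imCD ler_normD|exact: absCD]. Qed.

Lemma csize_le c z : csize c z <= absC z.
Proof. by rewrite /csize; case: (ang c) => //; exact: im_le_absC. Qed.

Lemma csizeZ c (t : R) z : csize c (toC t * z) = `|t| * csize c z.
Proof.
rewrite /csize; case: (ang c); last by rewrite absCM absC_toC.
by rewrite imCM reC_toC imC_toC mul0r addr0 normrM.
Qed.

Lemma cbump0 y c : cbump y c 0 = y.
Proof. by apply/funext => i; rewrite /cbump addr0 if_same. Qed.

Lemma cbump_bump y c u v : cbump (cbump y c u) c v = cbump y c (u + v).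
Proof. by apply/funext => i; rewrite /cbump; case: eqP => // _; rewrite addrA. Qed.

Lemma pdomS rho rho' y : (forall c, rho c <= rho' c) -> pdom rho y -> pdom rho' y.
Proof. by move=> H Hy c; exact: le_trans (Hy c) (H c). Qed.

Lemma pdom_cbump rho rho' y c w : pdom rho y -> (forall i, rho i <= rho' i) ->
  rho c + absC w <= rho' c -> pdom rho' (cbump y c w).
Proof.
move=> Hy rr H i; rewrite /cbump; case: eqP => [->|_]; last exact: le_trans (Hy i) (rr i).
by apply: le_trans (csizeD _ _ _) (le_trans _ H); apply: lerD => //; exact: csize_le.
Qed.

Lemma slice_cder rho y c w : sholo rho -> pdom rho (cbump y c w) ->
  cder (fun u => F (cbump y c u)) w (F' c (cbump y c w)).
Proof.
move=> H /(H _ c) K e e0; have [d d0 {}K] := K e e0; exists d => // h /K.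
by rewrite add0r !cbump_bump addr0.
Qed.

(** Between the doubled and the tripled polydisc there is room for a disc of radius [rho c] in one
    coordinate, which is [cauchy_ineq] with [s = rho c / 2]. *)
Lemma slice_bound rho M y c : 0 < rho c -> (forall i, 0 <= rho i) ->
  sholo (fun i => 3 * rho i) -> (forall y, pdom (fun i => 3 * rho i) y -> absC (F y) <= M) ->
  pdom (fun i => 2 * rho i) y -> absC (F' c y) <= 8 * M / rho c.
Proof.
move=> r0 r0' Hh HM Hy.
have dm w : absC w <= 2 * (rho c / 2) -> pdom (fun i => 3 * rho i) (cbump y c w).
  move=> ww; apply: (pdom_cbump Hy) => [i|]; first by rewrite ler_wpM2r// ler_nat.
  move: ww; rewrite mulrC divfK ?pnatr_eq0//; clear; lra.
have -> : 8 * M / rho c = 4 * M / (rho c / 2) by field; exact: lt0r_neq0.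
apply: (@cauchy_ineq R (fun w => F (cbump y c w))).
- by rewrite divr_gt0.
- have := @slice_cder _ y c 0 Hh; rewrite cbump0; apply.
  by apply: pdomS Hy => i; rewrite ler_wpM2r// ler_nat.
- by move=> w /dm dw; eexists; exact: slice_cder dw.
- by move=> w /dm; exact: HM.
Qed.

(** The passage from [y] to [y'] replaces one coordinate at a time; each intermediate point stays in
    the polydisc, which is a product of convex sets. *)
Lemma slice_lip rho L y y' : sholo rho ->
  (forall i y, pdom rho y -> absC (F' i y) <= L i) ->
  pdom rho y -> pdom rho y' ->
  absC (F y' - F y) <= \sum_i 2 * L i * absC (y' i - y i).
Proof.
move=> Hh HL Hy Hy'.
pose mix (s : seq I) i := if i \in s then y' i else y i.
have H s : uniq s -> absC (F (mix s) - F y) <= \sum_(i <- s) 2 * L i * absC (y' i - y i).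
  elim: s => [_|i s IH /= /andP[si us]].
    by rewrite big_nil (_ : mix [::] = y)// subrr absC0.
  have -> : mix (i :: s) = cbump (mix s) i (y' i - y i).
    apply/funext => j; rewrite /cbump /mix inE; case: eqP => //= ->.
    by rewrite (negbTE si) addrC subrK.
  rewrite big_cons.
  have -> : F (cbump (mix s) i (y' i - y i)) - F y =
    (F (cbump (mix s) i (y' i - y i)) - F (mix s)) + (F (mix s) - F y) by ring.
  rewrite (le_trans (absCD _ _))// lerD ?IH//.
  have dm t : 0 <= t <= 1 -> pdom rho (cbump (mix s) i (0 + toC t * (y' i - y i))).
    move=> /andP[t0 t1] j; rewrite add0r /cbump /mix; case: eqP => [->|_]; last by case: ifP.
    rewrite (negbTE si).
    have -> : y i + toC t * (y' i - y i) = toC (1 - t) * y i + toC t * y' i.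
      by rewrite toCB toC1; ring.
    apply: (le_trans (csizeD _ _ _)); rewrite !csizeZ !ger0_norm ?subr_ge0//.
    apply: (@le_trans _ _ ((1 - t) * rho i + t * rho i)).
      by apply: lerD; apply: ler_wpM2l; rewrite ?subr_ge0.
    by rewrite -mulrDl subrK mul1r.
  have := @cder_lip R (fun w => F (cbump (mix s) i w)) (fun w => F' i (cbump (mix s) i w)) 0
    (y' i - y i) (L i); rewrite add0r cbump0; apply => t t01.
    exact: slice_cder (dm t t01).
  by apply: HL; exact: dm.
have := H (index_enum I) (index_enum_uniq I).
by rewrite (_ : mix _ = y')//; apply/funext => i; rewrite /mix mem_index_enum.
Qed.
End Slices.

Section SliceDerivative.
Context {R : realType} {I : finType}.
Variables (ang : pred I) (F : (I -> Cx R) -> Cx R) (F' : I -> (I -> Cx R) -> Cx R).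
Implicit Types (rho L : I -> R) (y : I -> Cx R).

(** Cauchy's estimate is applied to the difference of the slices through [y'] and [y]. The Lipschitz
    bound of [F] thus passes to its partial derivatives, and no second derivative is needed. *)
Lemma slice_deriv_lip rho L y y' c : 0 < rho c -> (forall i, 0 <= rho i) ->
  sholo ang F F' (fun i => 2 * rho i) ->
  (forall i y, pdom ang (fun i => 2 * rho i) y -> absC (F' i y) <= L i) ->
  pdom ang rho y -> pdom ang rho y' ->
  absC (F' c y' - F' c y) <= 8 / rho c * \sum_i 2 * L i * absC (y' i - y i).
Proof.
move=> r0 r0' Hh HL Hy Hy'.
set M := \sum_i _.
have dm w x : pdom ang rho x -> absC w <= 2 * (rho c / 2) -> pdom ang (fun i => 2 * rho i) (cbump x c w).
  move=> Hx ww; apply: (pdom_cbump Hx) => [i|]; first by rewrite ler_peMl// ler1n.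
  move: ww; rewrite mulrC divfK ?pnatr_eq0//; clear; lra.
have -> : 8 / rho c * M = 4 * M / (rho c / 2) by field; exact: lt0r_neq0.
have d2 x : pdom ang rho x -> pdom ang (fun i => 2 * rho i) x.
  by move=> Hx; apply: pdomS Hx => i; rewrite ler_peMl// ler1n.
apply: (@cauchy_ineq R (fun w => F (cbump y' c w) - F (cbump y c w))).
- by rewrite divr_gt0.
- apply: cderD; last apply: cderN.
    by have := @slice_cder _ _ _ _ _ _ y' c 0 Hh; rewrite cbump0; apply; exact: d2.
  by have := @slice_cder _ _ _ _ _ _ y c 0 Hh; rewrite cbump0; apply; exact: d2.
- move=> w ww; eexists; apply: cderD; last apply: cderN.
    by apply: (slice_cder Hh); exact: dm.
  by apply: (slice_cder Hh); exact: dm.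
- move=> w ww; apply: (le_trans (slice_lip Hh HL (dm _ _ Hy ww) (dm _ _ Hy' ww))).
  rewrite /M; apply: ler_sum => i _; rewrite /cbump; case: eqP => // _.
  by rewrite opprD addrACA subrr addr0.
Qed.

(** One Cauchy estimate from triple to double radii bounds the partial derivatives, another from
    double to single radii their variation. Since [w i <= rho i] the radii in the sum cancel,
    leaving [8 * 16] per coordinate. *)
Lemma slice_deriv_weighted rho w M y y' c d : (forall i, 0 < rho i) -> 0 <= d -> 0 <= M ->
  sholo ang F F' (fun i => 3 * rho i) ->
  (forall y, pdom ang (fun i => 3 * rho i) y -> absC (F y) <= M) ->
  (forall i, w i <= rho i) ->
  pdom ang rho y -> pdom ang rho y' -> (forall i, absC (y' i - y i) <= d * w i) ->
  absC (F' c y' - F' c y) <= 128 * #|I|%:R * M / rho c * d.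
Proof.
move=> r0 d0 M0 Hh HM wr Hy Hy' yy.
have r0' i : 0 <= rho i by exact: ltW.
have HL i x : pdom ang (fun i => 2 * rho i) x -> absC (F' i x) <= 8 * M / rho i.
  by move=> Hx; apply: (slice_bound (ang := ang) (F := F) (rho := rho)).
have Hh2 : sholo ang F F' (fun i => 2 * rho i).
  move=> x i Hx; apply: Hh; apply: pdomS Hx => j.
  by rewrite ler_wpM2r// ler_nat.
apply: (le_trans (slice_deriv_lip _ _ Hh2 HL Hy Hy')) => //.
have -> : 128 * #|I|%:R * M / rho c * d = 8 / rho c * (16 * M * d * #|I|%:R) by field; exact: lt0r_neq0.
apply: ler_wpM2l; first by rewrite divr_ge0.
rewrite mulr_natr -sumr_const; apply: ler_sum => i _.
apply: (@le_trans _ _ (2 * (8 * M / rho i) * (d * rho i))).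
  apply: ler_wpM2l; first by rewrite !mulr_ge0// invr_ge0.
  by apply: le_trans (yy i) _; rewrite ler_wpM2l.
by rewrite le_eqVlt; apply/orP; left; apply/eqP; field; exact: lt0r_neq0.
Qed.
End SliceDerivative.

(** * Coordinates near an invariant torus *)

Section DirectionalDerivatives.
Context {R : realType}.

Lemma cder_ext (f g : Cx R -> Cx R) z d : (forall w, f w = g w) -> cder f z d -> cder g z d.
Proof. by move=> fg; rewrite (_ : f = g)//; apply/funext. Qed.

Lemma cder_cst (k z : Cx R) : cder (fun=> k) z 0.
Proof.
move=> e e0; exists 1 => // h _; rewrite subrr mul0r subrr absC0.
by rewrite mulr_ge0 ?absC_ge0 ?(ltW e0).
Qed.

Lemma cderB (f g : Cx R -> Cx R) z a b : cder f z a -> cder g z b ->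
  cder (fun w => f w - g w) z (a - b).
Proof. by move=> Hf Hg; apply: cderD => //; exact: cderN. Qed.

Lemma cder_sum (J : Type) (r : seq J) (f : J -> Cx R -> Cx R) z d :
  (forall j, cder (f j) z (d j)) -> cder (fun w => \sum_(j <- r) f j w) z (\sum_(j <- r) d j).
Proof.
move=> H; elim: r => [|j r IH].
  by rewrite big_nil; apply: cder_ext (cder_cst 0 z) => w; rewrite big_nil.
rewrite big_cons; apply: cder_ext (cderD (H j) IH) => w.
by rewrite big_cons.
Qed.

Lemma derive_cder (V : normedModType (Cx R)) (F : V -> Cx R) (x v : V) (d : Cx R) :
  cder (fun w => F (w *: v + x)) 0 d -> 'D_v F x = d.
Proof.
move=> H.
have L : (fun h : Cx R => h^-1 *: ((F \o shift x) (h *: v) - F x)) @ (0 : Cx R)^' --> d.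
  apply/cvgrPdist_le => e e0; have [eE e0'] := Cx_pos e0; have [dl dl0 K] := H _ e0'.
  near=> h.
  have h0 : h != 0 by near: h; exact: nbhs_dnbhs_neq.
  have hd : `|h| < toC dl by near: h; apply: dnbhs0_lt; rewrite -toC0 toC_lt.
  move: hd; rewrite normCxE toC_lt => /K; rewrite add0r scale0r add0r => {}K.
  rewrite normCxE eE toC_le.
  rewrite (_ : d - h^-1 *: ((F \o shift x) (h *: v) - F x) =
     - (h^-1 * (F (h *: v + x) - F x - d * h))); last first.
    by rewrite /= /GRing.scale/=; field.
  by rewrite absCN absCM absCV ler_pdivrMl ?absC_gt0// [leRHS]mulrC.
by rewrite /derive; apply/cvg_lim; [exact: norm_hausdorff|exact: L].
Unshelve. all: by end_near. Qed.

Lemma derive_lin (V : normedModType (Cx R)) (F : V -> Cx R) (x u v : V) (a b : Cx R) :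
  differentiable F x -> 'D_(a *: u + b *: v) F x = a * 'D_u F x + b * 'D_v F x.
Proof. by move=> dF; rewrite !deriveE// linearD !linearZ. Qed.

Lemma derive_cder_diff (V : normedModType (Cx R)) (F : V -> Cx R) (x v : V) :
  differentiable F x -> cder (fun w => F (w *: v + x)) 0 ('D_v F x).
Proof. by move=> dF; apply: derivable_cder; exact: diff_derivable. Qed.
End DirectionalDerivatives.

Section Coordinates.
Context {R : realType}.

(** The outer Boolean separates momenta from positions, the inner one marks the elliptic pair. For
    [z = (v + i u) / sqrt 2] the form [i dz /\ dw] equals [dv /\ du], so [v] is the momentum and [u]
    the position. *)
Definition ca (j : 'I_2) : crd := (false, (false, j)).
Definition cps (j : 'I_2) : crd := (true, (false, j)).
Definition cv (j : 'I_2) : crd := (false, (true, j)).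
Definition cu (j : 'I_2) : crd := (true, (true, j)).
Definition ang (c : crd) : bool := c.1 && ~~ c.2.1.

Lemma crd_cases (P : crd -> Prop) : (forall j, P (ca j)) -> (forall j, P (cps j)) ->
  (forall j, P (cv j)) -> (forall j, P (cu j)) -> forall c, P c.
Proof.
by move=> H1 H2 H3 H4 [[] [[] j]]; [exact: H4|exact: H2|exact: H3|exact: H1].
Qed.

Definition isq2 : Cx R := toC (Num.sqrt 2)^-1.

Lemma isq2_sq : isq2 * isq2 = 2^-1.
Proof.
rewrite /isq2 -toCM -invfM -expr2 sqr_sqrtr//.
apply: (mulfI (_ : (2 : Cx R) != 0)); rewrite ?pnatr_eq0// divff ?pnatr_eq0//.
by rewrite (_ : (2 : Cx R) = toC 2) -?toCM ?divff ?pnatr_eq0// -[2]/(1 + 1) toCD.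
Qed.

Lemma isq2_abs : absC isq2 <= 1.
Proof.
rewrite /isq2 absC_toC ger0_norm ?invr_ge0 ?sqrtr_ge0// invf_le1 ?sqrtr_gt0//.
by rewrite -[leLHS]sqrtr1 ler_sqrt// ler1n.
Qed.

(** Actions are measured from [J0], around which the domains are given, and not from the torus
    [Jeps]; for complex [v] and [u] the last two slots are independent. *)
Definition emb (J0 : 'rV[R]_2) (y : crd -> Cx R) : phase (Cx R) :=
  mkphase (rvecC J0 + \row_j y (ca j)) (\row_j y (cps j))
    (\row_j (isq2 * (y (cv j) + 'i * y (cu j))))
    (\row_j (isq2 * (y (cv j) - 'i * y (cu j)))).

Definition dirc (c : crd) : phase (Cx R) :=
  match c with
  | (false, (false, j)) => dir1 _ j
  | (true, (false, j)) => dir2 _ j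
  | (false, (true, j)) => isq2 *: dir3 _ j + isq2 *: dir4 _ j
  | (true, (true, j)) => (isq2 * 'i) *: dir3 _ j + (- (isq2 * 'i)) *: dir4 _ j
  end.

Lemma phase_eq (x y : phase (Cx R)) : slot1 x = slot1 y -> slot2 x = slot2 y ->
  slot3 x = slot3 y -> slot4 x = slot4 y -> x = y.
Proof. by case: x => [[[a b] c] d]; case: y => [[[a' b'] c'] d'];
  rewrite /slot1 /slot2 /slot3 /slot4 /= => -> -> -> ->. Qed.

Lemma emb_cbump J0 y c w : emb J0 (cbump y c w) = w *: dirc c + emb J0 y.
Proof.
move: c; apply: crd_cases => i; apply: phase_eq; apply/rowP => j;
  rewrite /slot1 /slot2 /slot3 /slot4 /emb /mkphase /dirc /dir1 /dir2 /dir3 /dir4 /mkphase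
    /unit_vec /cbump /ca /cps /cv /cu /= !mxE ?xpair_eqE ?eqxx /=;
  try (case: eqP => _ /=); ring.
Qed.
End Coordinates.

(** * Size of the perturbation *)

Ltac nonneg := lazymatch goal with
  | |- is_true (0 <= _ * _) => apply: mulr_ge0; nonneg
  | |- is_true (0 <= _ + _) => apply: addr_ge0; nonneg
  | |- is_true (0 <= _ ^-1) => rewrite invr_ge0; nonneg
  | |- is_true (0 <= _ ^+ _) => apply: exprn_ge0; nonneg
  | |- is_true (0 <= _ %:R) => exact: ler0n
  | |- is_true (0 <= 1) => exact: ler01
  | |- _ => first [assumption | apply: ltW; assumption]
  end.

Definition crad (R : realType) (ra rp rz : R) (c : crd) : R :=
  if c.2.1 then rz else if c.1 then rp else ra.

Lemma cradM (R : realType) (ra rp rz t : R) c : t * crad ra rp rz c = crad (t * ra) (t * rp) (t * rz) c.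
Proof. by rewrite /crad; case: c.2.1; case: c.1. Qed.

Lemma crad_le (R : realType) (ra rp rz ra' rp' rz' : R) c : ra <= ra' -> rp <= rp' -> rz <= rz' ->
  crad ra rp rz c <= crad ra' rp' rz' c.
Proof. by rewrite /crad; case: c.2.1; case: c.1. Qed.

Lemma crad_gt0 (R : realType) (ra rp rz : R) c : 0 < ra -> 0 < rp -> 0 < rz -> 0 < crad ra rp rz c.
Proof. by rewrite /crad; case: c.2.1; case: c.1. Qed.

Lemma card_crd : #|{: crd}| = 8%N.
Proof. by rewrite !card_prod !card_bool card_ord. Qed.

Lemma sum_crd_le (R : realType) (F : crd -> R) K : (forall c, F c <= K) -> \sum_c F c <= 8 * K.
Proof.
move=> H; apply: (@le_trans _ _ (\sum_(c : crd) K)); first exact: ler_sum.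
by rewrite sumr_const card_crd mulr_natl.
Qed.

Lemma enormC_le (R : realType) (v : 'rV[Cx R]_2) K : (forall j, absC (v 0 j) <= K) ->
  enormC v <= 2 * K.
Proof.
move=> H; have K0 : 0 <= K := le_trans (absC_ge0 _) (H 0).
rewrite /enormC -[leRHS]ger0_norm ?mulr_ge0// -sqrtr_sqr ler_wsqrtr//.
have Hj j : absC (v 0 j) ^+ 2 <= K ^+ 2 by rewrite ler_pXn2r ?nnegrE ?absC_ge0.
rewrite big_ord_recl big_ord1.
apply: (le_trans (lerD (Hj _) (Hj _))); rewrite exprMn.
have -> : K ^+ 2 + K ^+ 2 = 2 * K ^+ 2 by ring.
by rewrite ler_wpM2r ?sqr_ge0// -natrX ler_nat.
Qed.

Section PieceArithmetic.
Context {R : realType}.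
Variables (eps se th B q cA cG cO : R).
Hypothesis e0 : 0 < eps.
Hypothesis e1 : eps <= 1.
Hypothesis s0 : 0 < se.
Hypothesis s1 : se <= 1.
Hypothesis ss : se * se = eps.
Hypothesis t0 : 0 < th.
Hypothesis t1 : th <= 1.
Hypothesis B0 : 0 <= B.
Hypothesis q1 : 1 <= q.
Hypothesis A0 : 0 <= cA.
Hypothesis G0 : 0 <= cG.
Hypothesis O0 : 0 <= cO.

Definition piece_const : R := cA * (1 + cG + cO) * B * (1 + q) * (th^-1 * th^-1).

Lemma piece_const_ge a b c : 0 <= a <= cA * (1 + cG + cO) -> 0 <= b <= 1 + q ->
  0 <= c <= th^-1 * th^-1 -> a * B * b * c <= piece_const.
Proof.
move=> /andP[a0 aa] /andP[b0 bb] /andP[c0 cc].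
by rewrite /piece_const; apply: ler_pM; rewrite ?mulr_ge0//; apply: ler_pM; rewrite ?mulr_ge0//;
  apply: ler_pM.
Qed.

Lemma scale_piece (M' m X m' K : R) : M' = K * m -> 0 <= K -> K <= X -> 0 <= m -> m <= m' ->
  M' <= X * m'.
Proof. by move=> -> K0 KX m0 mm; apply: ler_pM. Qed.

(** Each left side is a supremum divided by a Cauchy radius: for [f], of order [eps ^ 4]; for [g],
    cubic in [z] of size [eps ^ 2]; for the variation [O(se)] of the elliptic frequencies times
    [z ^ 2]. The target in the actions and angles is dictated by [f], in the elliptic directions by
    the frequencies. *)
Lemma pieces_le (c : crd) :
  (eps ^+ 4 * (cA * B / crad (th * se) th th c)
     <= piece_const * crad (eps ^+ 3 * se) (eps ^+ 4) (eps ^+ 3 * se) c /\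
   eps * (cA * (cG * B * eps ^+ 6) / crad (th * se) th (eps ^+ 2) c)
     <= piece_const * crad (eps ^+ 3 * se) (eps ^+ 4) (eps ^+ 3 * se) c) /\
  eps * (cA * (cO * B * q * th^-1 * se * eps ^+ 4) / crad (q * eps) th (eps ^+ 2) c)
     <= piece_const * crad (eps ^+ 3 * se) (eps ^+ 4) (eps ^+ 3 * se) c.
Proof.
have pw (i j : nat) : (j <= i)%N -> eps ^+ i <= eps ^+ j.
  by move=> ji; rewrite ler_wiXn2l ?(ltW e0).
have ese : eps <= se by rewrite -ss ler_piMr ?(ltW s0).
have e4 : eps ^+ 4 <= eps ^+ 3 * se by rewrite exprSr ler_wpM2l ?exprn_ge0 ?(ltW e0).
have e5 : eps ^+ 5 <= eps ^+ 3 * se by apply: le_trans e4; exact: pw.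
have q0 : 0 < q := lt_le_trans ltr01 q1.
have [E0 S0 T0 Q0] : [/\ 0 <= eps, 0 <= se, 0 <= th & 0 <= q] by rewrite !ltW.
have ti1 : 1 <= th^-1 by rewrite invf_ge1.
have ti0 : 0 <= th^-1 by rewrite invr_ge0.
have tt0 : 0 <= (1 : R) <= th^-1 * th^-1.
  by apply/andP; split=> //; rewrite -[leLHS]mulr1 ler_pM.
have tt1 : 0 <= th^-1 <= th^-1 * th^-1 by rewrite ti0 ler_peMr.
have tt2 : 0 <= th^-1 * th^-1 <= th^-1 * th^-1 by rewrite lexx mulr_ge0.
have one : 0 <= (1 : R) <= 1 + q by rewrite ler01/= lerDl.
have qq : 0 <= q <= 1 + q by rewrite Q0/= lerDr ler01.
have aF : 0 <= cA <= cA * (1 + cG + cO).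
  by rewrite A0/= ler_peMr// -addrA lerDl addr_ge0.
have aG : 0 <= cA * cG <= cA * (1 + cG + cO).
  by rewrite mulr_ge0//= ler_wpM2l// addrAC lerDr addr_ge0.
have aO : 0 <= cA * cO <= cA * (1 + cG + cO).
  by rewrite mulr_ge0//= ler_wpM2l// lerDr addr_ge0.
have [se0 th0 e00 qn0] : [/\ se != 0, th != 0, eps != 0 & q != 0] by rewrite !gt_eqF.
have pse n : (3 <= n)%N -> eps ^+ n * se <= eps ^+ 3 * se.
  by move=> n3; rewrite ler_pM2r// pw.
move: (piece_const_ge aF one tt1) (piece_const_ge aG one tt1) (piece_const_ge aG one tt0)
  (piece_const_ge aO one tt1) (piece_const_ge aO qq tt2) (piece_const_ge aO qq tt1).
rewrite !mulr1; move: piece_const => X KF KG KG' Ka Kp Kz.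
have [m1 m2 m3 m4] : [/\ 0 <= eps ^+ 3 * se, 0 <= eps ^+ 4, 0 <= eps ^+ 5 & 0 <= eps ^+ 6 * se].
  by split; nonneg.
move: c; apply: crd_cases => j; rewrite /crad /=.
- split; first split.
  + apply: (scale_piece _ _ KF m1) => //; last by nonneg.
    by rewrite -ss; field; rewrite th0.
  + apply: (scale_piece _ _ KG m4); [by rewrite -ss; field; rewrite th0|by nonneg|exact: pse].
  + apply: (scale_piece (m := eps ^+ 4 * se) _ _ Ka); [|by nonneg|by nonneg|exact: pse].
    by field; rewrite th0 qn0 e00.
- split; first split.
  + by apply: (scale_piece _ _ KF m2) => //; [field|nonneg].
  + apply: (scale_piece (m := eps ^+ 7) _ _ KG); [by field|by nonneg|by nonneg|exact: pw].
  + apply: (scale_piece (m := eps ^+ 5 * se) _ _ Kp); [by field; rewrite th0|by nonneg|by nonneg|].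
    by apply: (@le_trans _ _ (eps ^+ 5)); [rewrite ler_piMr|exact: pw].
- split; first split.
  + by apply: (scale_piece _ _ KF m2) => //; [field|nonneg].
  + by apply: (scale_piece _ _ KG' m3) => //; [field|nonneg].
  + by apply: (scale_piece _ _ Kz m1) => //; [field; rewrite th0 e00|nonneg].
- split; first split.
  + by apply: (scale_piece _ _ KF m2) => //; [field|nonneg].
  + by apply: (scale_piece _ _ KG' m3) => //; [field|nonneg].
  + by apply: (scale_piece _ _ Kz m1) => //; [field; rewrite th0 e00|nonneg].
Qed.
End PieceArithmetic.

(* The part of the normal form near J0 which matters: [h], [Om], [g], [f] are the
   terms of the Hamiltonian and [k] is the unperturbed h_0. The polydiscs have
   size sqrt(eps) in the actions and fixed size in the other variables. *)
Record local_nf (R : realType) (eps th B chi : R) (J0 : 'rV[R]_2)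
    (h k : 'rV[Cx R]_2 -> Cx R) (Om : 'I_2 -> 'rV[Cx R]_2 -> Cx R)
    (g : phase_nopsi (Cx R) -> Cx R) (f : phase (Cx R) -> Cx R) : Prop := LocalNF {
  ln_eps : 0 < eps <= 1;
  ln_th : 0 < th <= 1;
  ln_B : 1 <= B;
  ln_chi : 0 < chi;
  ln_act : forall y, pdom ang (crad (3 * (th * Num.sqrt eps)) (3 * th) (3 * th)) y ->
    [/\ differentiable h (slot1 (emb J0 y)), differentiable k (slot1 (emb J0 y)),
        forall j, differentiable (Om j) (slot1 (emb J0 y)),
        forall j, absC ('D_(unit_vec (Cx R) j) h (slot1 (emb J0 y))
                        - 'D_(unit_vec (Cx R) j) k (slot1 (emb J0 y))) <= B * eps
      & forall j, absC (Om j (slot1 (emb J0 y))) <= B];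
  ln_g : forall y, pdom ang (crad (3 * (th * Num.sqrt eps)) (3 * th) (3 * th)) y ->
    differentiable g (forget_angle (emb J0 y)) /\
    absC (g (forget_angle (emb J0 y)))
      <= B * (enormC (slot3 (emb J0 y)) + enormC (slot4 (emb J0 y))) ^+ 3;
  ln_f : forall y, pdom ang (crad (3 * (th * Num.sqrt eps)) (3 * th) (3 * th)) y ->
    differentiable f (emb J0 y) /\ absC (f (emb J0 y)) <= B;
  ln_real : forall y : crd -> R,
    pdom ang (crad (3 * (th * Num.sqrt eps)) (3 * th) (3 * th)) (fun c => toC (y c)) ->
    [/\ imC (h (slot1 (emb J0 (fun c => toC (y c))))) = 0,
        forall j, imC (Om j (slot1 (emb J0 (fun c => toC (y c))))) = 0,
        imC (g (forget_angle (emb J0 (fun c => toC (y c))))) = 0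
      & imC (f (emb J0 (fun c => toC (y c)))) = 0];
  ln_per : forall y, pdom ang (crad (3 * (th * Num.sqrt eps)) (3 * th) (3 * th)) y ->
    forall n : 'rV[int]_2,
    f (shift_angle (emb J0 y) (rvecC ((2 * pi) *: ivec R n))) = f (emb J0 y);
  ln_low : forall j, chi <= reC (Om j (rvecC J0)) }.

Section Pieces.
Context {R : realType}.
Variables (eps th B chi : R) (J0 : 'rV[R]_2) (h k : 'rV[Cx R]_2 -> Cx R).
Variables (Om : 'I_2 -> 'rV[Cx R]_2 -> Cx R) (g : phase_nopsi (Cx R) -> Cx R).
Variable f : phase (Cx R) -> Cx R.
Hypothesis L : local_nf eps th B chi J0 h k Om g f.
Implicit Types (y : crd -> Cx R).

Let se := Num.sqrt eps.
Let big : crd -> R := crad (3 * (th * se)) (3 * th) (3 * th).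

Definition Fh y : Cx R := h (slot1 (emb J0 y)) - k (slot1 (emb J0 y)).
Definition Fh' c y : Cx R :=
  'D_(slot1 (dirc c)) h (slot1 (emb J0 y)) - 'D_(slot1 (dirc c)) k (slot1 (emb J0 y)).
Definition Fom j y : Cx R := Om j (slot1 (emb J0 y)).
Definition Fom' j c y : Cx R := 'D_(slot1 (dirc c)) (Om j) (slot1 (emb J0 y)).
Definition quad j y : Cx R := 2^-1 * (y (cv j) * y (cv j) + y (cu j) * y (cu j)).
Definition quad' (j : 'I_2) (c : crd) y : Cx R :=
  if c == cv j then y (cv j) else if c == cu j then y (cu j) else 0.
(** The elliptic frequencies are frozen at [J0], which makes the unperturbed part quadratic with
    constant coefficients; their variation with the actions is counted as perturbation. *)
Definition Fo y : Cx R := \sum_j (Fom j y - Om j (rvecC J0)) * quad j y.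
Definition Fo' c y : Cx R :=
  \sum_j (Fom' j c y * quad j y + (Fom j y - Om j (rvecC J0)) * quad' j c y).
Definition Fg y : Cx R := g (forget_angle (emb J0 y)).
Definition Fg' c y : Cx R := 'D_(forget_angle (dirc c)) g (forget_angle (emb J0 y)).
Definition Ff y : Cx R := f (emb J0 y).
Definition Ff' c y : Cx R := 'D_(dirc c) f (emb J0 y).

Lemma eps_gt0 : 0 < eps. Proof. by case/andP: (ln_eps L). Qed.
Lemma eps_le1 : eps <= 1. Proof. by case/andP: (ln_eps L). Qed.
Lemma th_gt0 : 0 < th. Proof. by case/andP: (ln_th L). Qed.
Lemma th_le1 : th <= 1. Proof. by case/andP: (ln_th L). Qed.
Lemma se_gt0 : 0 < se. Proof. by rewrite sqrtr_gt0 eps_gt0. Qed.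
Lemma se_le1 : se <= 1. Proof. by rewrite -sqrtr1 ler_sqrt ?eps_le1. Qed.
Lemma se2 : se * se = eps. Proof. by rewrite -expr2 sqr_sqrtr// ltW// eps_gt0. Qed.
Lemma B_gt0 : 0 < B. Proof. exact: lt_le_trans ltr01 (ln_B L). Qed.

Lemma Fh_holo : sholo ang Fh Fh' big.
Proof.
move=> y c /(ln_act L)[dh dk _ _ _].
apply: cder_ext (cderB (derive_cder_diff (slot1 (dirc c)) dh) (derive_cder_diff (slot1 (dirc c)) dk)) => w.
by rewrite /Fh emb_cbump.
Qed.

Lemma Fom_holo j : sholo ang (Fom j) (Fom' j) big.
Proof.
move=> y c /(ln_act L)[_ _ dO _ _].
apply: cder_ext (derive_cder_diff (slot1 (dirc c)) (dO j)) => w.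
by rewrite /Fom emb_cbump.
Qed.

Lemma Fg_holo : sholo ang Fg Fg' big.
Proof.
move=> y c /(ln_g L)[dg _].
apply: cder_ext (derive_cder_diff (forget_angle (dirc c)) dg) => w.
by rewrite /Fg emb_cbump.
Qed.

Lemma Ff_holo : sholo ang Ff Ff' big.
Proof.
move=> y c /(ln_f L)[df _].
apply: cder_ext (derive_cder_diff (dirc c) df) => w.
by rewrite /Ff emb_cbump.
Qed.

Lemma quad_cder j y c : cder (fun w => quad j (cbump y c w)) 0 (quad' j c y).
Proof.
have D (a : crd) : cder (fun w => cbump y c w a) 0 (if a == c then 1 else 0).
  rewrite /cbump; case: eqP => _; last exact: cder_cst.
  have := cderD (cder_cst (y a) 0) (@cder_id R 0); rewrite add0r.
  exact: cder_ext.
have := cderZ (2^-1) (cderD (cderM (D (cv j)) (D (cv j))) (cderM (D (cu j)) (D (cu j)))).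
rewrite cbump0 /quad' ![c == _]eq_sym.
have two (a : Cx R) : 2^-1 * (a + a) = a by field.
case: eqP => [e|_]; case: eqP => [e'|_].
- by move: e'; rewrite -e.
- by rewrite !mul1r !mul0r !mulr1 !mulr0 !addr0 two.
- by rewrite !mul1r !mul0r !mulr1 !mulr0 !addr0 add0r two.
- by rewrite !mul0r !mulr0 !addr0 mulr0.
Qed.

Lemma Fo_holo : sholo ang Fo Fo' big.
Proof.
move=> y c Hy; rewrite /Fo /Fo'.
apply: (@cder_sum _ _ _ (fun j w => (Fom j (cbump y c w) - Om j (rvecC J0)) * quad j (cbump y c w))) => j.
have H1 := Fom_holo j c Hy.
have H2 := cderB H1 (cder_cst (Om j (rvecC J0)) 0); rewrite subr0 in H2.
have := cderM H2 (quad_cder j y c).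
by rewrite !cbump0.
Qed.

Definition isa (c : crd) : bool := ~~ c.1 && ~~ c.2.1.

Lemma slot1_dirc c : slot1 (dirc c : phase (Cx R)) = if isa c then unit_vec (Cx R) c.2.2 else 0.
Proof.
move: c; apply: crd_cases => j; rewrite /isa /= //; apply/rowP => i; rewrite /slot1 /= !mxE;
  by rewrite !mulr0 ?addr0.
Qed.

Lemma derive_dir0 (F : 'rV[Cx R]_2 -> Cx R) x : 'D_0 F x = 0.
Proof.
apply: derive_cder; apply: cder_ext (cder_cst (F x) 0) => w.
by rewrite scaler0 add0r.
Qed.

Lemma Fh'_bound c y : pdom ang big y -> absC (Fh' c y) <= if isa c then B * eps else 0.
Proof.
move=> /(ln_act L)[_ _ _ H _]; rewrite /Fh' slot1_dirc; case: ifP => _; first exact: H.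
by rewrite !derive_dir0 subrr absC0.
Qed.

Lemma Fom'_bound j c y : pdom ang (fun c => 2 * crad (th * se) th th c) y ->
  absC (Fom' j c y) <= if isa c then 8 * B / (th * se) else 0.
Proof.
move=> Hy; case: ifP => ca; last by rewrite /Fom' slot1_dirc ca derive_dir0 absC0.
have r0 i : 0 < crad (th * se) th th i by apply: crad_gt0; rewrite ?mulr_gt0 ?th_gt0 ?se_gt0.
have -> : th * se = crad (th * se) th th c.
  by move: ca; rewrite /isa /crad => /andP[/negbTE -> /negbTE ->].
apply: (slice_bound (ang := ang) (F := Fom j)) => //.
- by move=> i; exact: ltW.
- by move=> x i Hx; apply: Fom_holo; apply: pdomS Hx => l; rewrite cradM.
- move=> x Hx; have [|_ _ _ _ HO] := ln_act L (y := x); last exact: HO.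
  by apply: pdomS Hx => l; rewrite cradM.
Qed.

(** [Om j] is bounded on action discs of radius of order [se], so its derivative is [O(1 / se)], and
    a displacement of order [q * eps = q * se * se] changes it by [O(se)]. Coordinates other than
    the actions are set to 0, as they do not affect the value. *)
Lemma Fom_close j y q : 1 <= q -> 3 * q * se <= th ->
  pdom ang (crad (3 * (q * eps)) (3 * th) (3 * th)) y ->
  absC (Fom j y - Om j (rvecC J0)) <= 384 * B * q * se / th.
Proof.
move=> q1 qs Hy.
have [t0 s0 b0] : [/\ 0 < th, 0 < se & 0 < B] by rewrite th_gt0 se_gt0 B_gt0.
pose y' c := if isa c then y c else 0.
have -> : Fom j y = Fom j y'.
  by rewrite /Fom; congr Om; apply/rowP => i; rewrite /slot1 /= !mxE.
have -> : Om j (rvecC J0) = Fom j (fun=> 0).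
  by rewrite /Fom; congr Om; apply/rowP => i; rewrite /slot1 /= !mxE addr0.
have cs0 c : csize ang c (0 : Cx R) = 0.
  by rewrite /csize; case: (ang c); rewrite ?normr0 ?absC0.
have e1 : 3 * (q * eps) <= th * se.
  by rewrite -se2 !mulrA ler_pM2r.
have D1 : pdom ang (fun c => 2 * crad (th * se) th th c) y'.
  move=> c; rewrite /y' cradM; case: ifP => ic; last first.
    by rewrite cs0 ltW// crad_gt0// ?mulr_gt0.
  move: (Hy c) ic; rewrite /crad /isa; case: c.2.1; case: c.1 => //= H _.
  by apply: (le_trans H); apply: (le_trans e1); rewrite ler_peMl ?mulr_ge0 ?(ltW t0) ?(ltW s0)// ler1n.
have D0 : pdom ang (fun c => 2 * crad (th * se) th th c) (fun=> 0 : Cx R).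
  by move=> c; rewrite cradM cs0 ltW// crad_gt0// ?mulr_gt0.
have Hh : sholo ang (Fom j) (Fom' j) (fun c => 2 * crad (th * se) th th c).
  move=> x i Hx; apply: Fom_holo; apply: pdomS Hx => l; rewrite cradM.
  by apply: crad_le; rewrite ler_wpM2r ?ler_nat// ?mulr_ge0 ?(ltW t0) ?(ltW s0).
apply: (le_trans (slice_lip Hh (fun c x => @Fom'_bound j c x) D0 D1)).
have -> : 384 * B * q * se / th = 8 * (2 * (8 * B / (th * se)) * (3 * (q * eps))).
  by rewrite -se2; field; rewrite !gt_eqF.
apply: sum_crd_le => c; rewrite subr0 /y'.
have [q0 ee0] : 0 <= q /\ 0 <= eps by rewrite (le_trans ler01 q1) ltW ?eps_gt0.
case: ifP => ic; last by rewrite absC0 !mulr0; nonneg.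
apply: ler_wpM2l; first by nonneg.
move: (Hy c) ic; rewrite /crad /isa /csize /ang; by case: c.2.1; case: c.1.
Qed.

Lemma emb_z_bound y (r : R) j : pdom ang (crad (3 * (th * se)) (3 * th) r) y ->
  absC (slot3 (emb J0 y) 0 j) <= 2 * r /\ absC (slot4 (emb J0 y) 0 j) <= 2 * r.
Proof.
move=> Hy; rewrite /slot3 /slot4 /= !mxE.
have v : absC (y (cv j)) <= r := Hy (cv j).
have u : absC ('i * y (cu j)) <= r.
  rewrite absCM (_ : absC ('i : Cx R) = 1) ?mul1r; first exact: (Hy (cu j)).
  by rewrite absCE /= expr0n/= add0r expr1n sqrtr1.
have i1 (z : Cx R) : absC (isq2 * z) <= absC z.
  by rewrite absCM ler_piMl ?absC_ge0// isq2_abs.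
have r2 : r + r = 2 * r by ring.
split; apply: (le_trans (i1 _)).
  by apply: (le_trans (absCD _ _)); rewrite -r2 lerD.
by apply: (le_trans (absCB _ _)); rewrite -r2 lerD.
Qed.

Variable q : R.
Hypothesis q1 : 1 <= q.
Hypothesis qs : 3 * q * se <= th.
Hypothesis et : eps <= th.

(** The three numbers come from [slice_deriv_weighted], from the bound [24 * eps ^ 2] for the norms
    of [z] and [w] on the tripled polydisc, and from two terms of [Fom_close] multiplied by
    [(3 * eps ^ 2) ^ 2]. *)
Definition pconst : R := piece_const th B q (128 * #|{: crd}|%:R) (24 ^+ 3) (2 * 384 * 3 ^+ 2).
Definition wt : crd -> R := crad (eps ^+ 3) (eps ^+ 2) (eps ^+ 2).
Definition ebd : crd -> R := crad (eps ^+ 3 * se) (eps ^+ 4) (eps ^+ 3 * se).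
(** The action radius is of order [eps], although orbits deviate by [eps ^ 3] only, because the
    torus [Jeps] lies at distance of order [eps] from the centre [J0]. *)
Definition sdom : (crd -> Cx R) -> Prop := pdom ang (crad (q * eps) th (eps ^+ 2)).

Lemma q_gt0 : 0 < q. Proof. exact: lt_le_trans ltr01 q1. Qed.

Lemma eps_pow_le (i j : nat) : (j <= i)%N -> eps ^+ i <= eps ^+ j.
Proof. by move=> ji; rewrite ler_wiXn2l ?(ltW eps_gt0) ?eps_le1. Qed.

Lemma eps_le_se : eps <= se.
Proof. by rewrite -se2 ler_piMr ?(ltW se_gt0) ?se_le1. Qed.

(** Each part of the perturbation has its own polydisc: the full one for [f], one with small [z] for
    [g] and one with small [z] and actions near [J0] for the frequencies. A wider polydisc improves
    the derivative bound, a narrower one the supremum. *)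
Let rf : crd -> R := crad (th * se) th th.
Let rg : crd -> R := crad (th * se) th (eps ^+ 2).
Let ro : crd -> R := crad (q * eps) th (eps ^+ 2).

Lemma piece_arith c (cA cG cO : R) : 0 <= cA -> 0 <= cG -> 0 <= cO ->
  [/\ eps ^+ 4 * (cA * B / rf c) <= piece_const th B q cA cG cO * ebd c,
      eps * (cA * (cG * B * eps ^+ 6) / rg c) <= piece_const th B q cA cG cO * ebd c
    & eps * (cA * (cO * B * q * th^-1 * se * eps ^+ 4) / ro c)
        <= piece_const th B q cA cG cO * ebd c].
Proof.
move=> A0 G0 O0.
have H := @pieces_le R eps se th B q cA cG cO eps_gt0 eps_le1 se_gt0 se_le1 se2 th_gt0 th_le1
  (ltW B_gt0) q1 A0 G0 O0.
by have [[h1 h2] h3] := H c; split; [exact: h1|exact: h2|exact: h3].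
Qed.

Lemma eps2_le_th : eps ^+ 2 <= th.
Proof. by apply: le_trans et; rewrite expr2 ler_piMr ?(ltW eps_gt0) ?eps_le1. Qed.

Lemma qeps_le : q * eps <= th * se.
Proof.
have s0 := se_gt0; rewrite -se2 mulrA ler_pM2r//; apply: le_trans qs.
by rewrite -mulrA ler_peMl ?ler1n// mulr_ge0 ?(ltW q_gt0) ?(ltW s0).
Qed.

Lemma big_rf y : pdom ang (fun c => 3 * rf c) y -> pdom ang big y.
Proof. by move=> Hy c; have := Hy c; rewrite /rf cradM. Qed.
Lemma big_rg y : pdom ang (fun c => 3 * rg c) y -> pdom ang (crad (3 * (th * se)) (3 * th) (3 * eps ^+ 2)) y.
Proof. by move=> Hy c; have := Hy c; rewrite /rg cradM. Qed.
Lemma big_z y r : r <= 3 * th -> pdom ang (crad (3 * (th * se)) (3 * th) r) y -> pdom ang big y.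
Proof. by move=> rt; apply: pdomS => c; exact: crad_le. Qed.
Lemma three_eps2_le : 3 * eps ^+ 2 <= 3 * th.
Proof. by rewrite ler_wpM2l ?eps2_le_th. Qed.
Lemma big_ro y : pdom ang (fun c => 3 * ro c) y ->
  pdom ang (crad (3 * (q * eps)) (3 * th) (3 * eps ^+ 2)) y.
Proof. by move=> Hy c; have := Hy c; rewrite /ro cradM. Qed.
Lemma ro_rg y : pdom ang (crad (3 * (q * eps)) (3 * th) (3 * eps ^+ 2)) y ->
  pdom ang (crad (3 * (th * se)) (3 * th) (3 * eps ^+ 2)) y.
Proof. by apply: pdomS => c; apply: crad_le => //; rewrite ler_wpM2l ?qeps_le. Qed.

Lemma Fg_bound y : pdom ang (fun c => 3 * rg c) y -> absC (Fg y) <= 24 ^+ 3 * B * eps ^+ 6.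
Proof.
move=> /big_rg Hy; have [_ H] := ln_g L (big_z three_eps2_le Hy).
apply: (le_trans H).
have -> : 24 ^+ 3 * B * eps ^+ 6 = B * (24 * eps ^+ 2) ^+ 3 by ring.
rewrite ler_wpM2l ?(ltW B_gt0)// ler_pXn2r ?nnegrE ?addr_ge0 ?sqrtr_ge0 ?mulr_ge0 ?exprn_ge0 ?(ltW eps_gt0)//.
have -> : 24 * eps ^+ 2 = 2 * (2 * (3 * eps ^+ 2)) + 2 * (2 * (3 * eps ^+ 2)) by ring.
by apply: lerD; apply: enormC_le => j; have [] := emb_z_bound j Hy.
Qed.

Lemma quad_bound y j r : 0 <= r -> absC (y (cv j)) <= r -> absC (y (cu j)) <= r -> absC (quad j y) <= r ^+ 2.
Proof.
move=> r0 hv hu; rewrite /quad absCM absCV.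
have -> : absC (2 : Cx R) = 2.
  have -> : (2 : Cx R) = toC 2 by rewrite -[2]/(1 + 1) toCD.
  by rewrite absC_toC ger0_norm.
rewrite ler_pdivrMl// mulr_natl mulr2n; apply: (le_trans (absCD _ _)).
by rewrite !absCM; apply: lerD; rewrite expr2; apply: ler_pM; rewrite ?absC_ge0.
Qed.

Lemma Fo_bound y : pdom ang (fun c => 3 * ro c) y ->
  absC (Fo y) <= 2 * 384 * 3 ^+ 2 * B * q * th^-1 * se * eps ^+ 4.
Proof.
move=> /big_ro Hy.
have Hc j : absC (Fom j y - Om j (rvecC J0)) <= 384 * B * q * se / th.
  by apply: Fom_close => //; apply: pdomS Hy => c; apply: crad_le => //; exact: three_eps2_le.
have Hq j : absC (quad j y) <= (3 * eps ^+ 2) ^+ 2.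
  apply: quad_bound; [by rewrite mulr_ge0 ?sqr_ge0|exact: (Hy (cv j))|exact: (Hy (cu j))].
rewrite /Fo big_ord_recl big_ord1; apply: (le_trans (absCD _ _)).
have -> : 2 * 384 * 3 ^+ 2 * B * q * th^-1 * se * eps ^+ 4 =
  384 * B * q * se / th * (3 * eps ^+ 2) ^+ 2 + 384 * B * q * se / th * (3 * eps ^+ 2) ^+ 2 by ring.
by apply: lerD; rewrite absCM; apply: ler_pM; rewrite ?absC_ge0.
Qed.

Definition pert' c y : Cx R := toC eps * Fo' c y + toC eps * Fg' c y + toC eps ^+ 4 * Ff' c y.

Lemma absC_eps n (z : Cx R) : absC (toC eps ^+ n * z) = eps ^+ n * absC z.
Proof.
rewrite absCM; congr (_ * _); elim: n => [|n IH].
  by rewrite !expr0; exact: ComplexField.Normc.normc1.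
by rewrite !exprS absCM IH absC_toC ger0_norm ?(ltW eps_gt0).
Qed.

Lemma rf_gt0 c : 0 < rf c.
Proof. by apply: crad_gt0; rewrite ?mulr_gt0 ?th_gt0 ?se_gt0. Qed.
Lemma rg_gt0 c : 0 < rg c.
Proof. by apply: crad_gt0; rewrite ?mulr_gt0 ?th_gt0 ?se_gt0 ?exprn_gt0 ?eps_gt0. Qed.
Lemma ro_gt0 c : 0 < ro c.
Proof. by apply: crad_gt0; rewrite ?mulr_gt0 ?th_gt0 ?q_gt0 ?exprn_gt0 ?eps_gt0. Qed.

Lemma e3_le : eps ^+ 3 <= q * eps.
Proof.
apply: (@le_trans _ _ eps); first exact: (eps_pow_le (i := 3) (j := 1)).
by rewrite ler_peMl ?(ltW eps_gt0).
Qed.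
Lemma wt_ro c : wt c <= ro c.
Proof. by apply: crad_le => //; [exact: e3_le|exact: eps2_le_th]. Qed.
Lemma wt_rg c : wt c <= rg c.
Proof. by apply: crad_le => //; [exact: le_trans e3_le qeps_le|exact: eps2_le_th]. Qed.
Lemma wt_rf c : wt c <= rf c.
Proof. by apply: crad_le => //; [exact: le_trans e3_le qeps_le|exact: eps2_le_th|exact: eps2_le_th]. Qed.
Lemma sdom_rg y : sdom y -> pdom ang rg y.
Proof. by apply: pdomS => c; apply: crad_le => //; exact: qeps_le. Qed.
Lemma sdom_rf y : sdom y -> pdom ang rf y.
Proof. by apply: pdomS => c; apply: crad_le => //; [exact: qeps_le|exact: eps2_le_th]. Qed.

Lemma Ff_holo3 : sholo ang Ff Ff' (fun c => 3 * rf c).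
Proof. by move=> y c Hy; apply: Ff_holo; exact: big_rf. Qed.
Lemma Fg_holo3 : sholo ang Fg Fg' (fun c => 3 * rg c).
Proof. by move=> y c Hy; apply: Fg_holo; exact: big_z three_eps2_le (big_rg Hy). Qed.
Lemma Fo_holo3 : sholo ang Fo Fo' (fun c => 3 * ro c).
Proof. by move=> y c Hy; apply: Fo_holo; exact: big_z three_eps2_le (ro_rg (big_ro Hy)). Qed.
Lemma Ff_bound3 y : pdom ang (fun c => 3 * rf c) y -> absC (Ff y) <= B.
Proof. by move=> Hy; have [] := ln_f L (big_rf Hy). Qed.

Lemma piece_sum c (a b e d : R) : 0 <= d ->
  a <= 128 * #|{: crd}|%:R * (2 * 384 * 3 ^+ 2 * B * q * th^-1 * se * eps ^+ 4) / ro c * d ->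
  b <= 128 * #|{: crd}|%:R * (24 ^+ 3 * B * eps ^+ 6) / rg c * d ->
  e <= 128 * #|{: crd}|%:R * B / rf c * d ->
  eps * a + eps * b + eps ^+ 4 * e <= 3 * pconst * ebd c * d.
Proof.
rewrite /pconst.
have cA0 : 0 <= 128 * #|{: crd}|%:R :> R by nonneg.
have cG0 : 0 <= 24 ^+ 3 :> R by nonneg.
have cO0 : 0 <= 2 * 384 * 3 ^+ 2 :> R by nonneg.
move: (128 * #|{: crd}|%:R) (24 ^+ 3) (2 * 384 * 3 ^+ 2) cA0 cG0 cO0 => cA cG cO A0 G0 O0 d0 ha hb he.
have [pf pg po] := piece_arith c A0 G0 O0.
have e0 := ltW eps_gt0.
have A := ler_wpM2l e0 ha; have A' := ler_wpM2l e0 hb.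
have A'' := ler_wpM2l (exprn_ge0 4 e0) he.
move: (piece_const _ _ _ _ _ _) pf pg po => X pf pg po.
have -> : 3 * X * ebd c * d = X * ebd c * d + X * ebd c * d + X * ebd c * d by ring.
have W (u v x : R) : u * v <= x -> u * (v * d) <= x * d by move=> uv; rewrite mulrA ler_wpM2r.
apply: lerD; first apply: lerD.
- by apply: (le_trans A); exact: W po.
- by apply: (le_trans A'); exact: W pg.
- by apply: (le_trans A''); exact: W pf.
Qed.

Lemma lin_combB (e e' a b d a' b' d' : Cx R) : (e * a' + e * b' + e' * d') - (e * a + e * b + e' * d) =
  e * (a' - a) + e * (b' - b) + e' * (d' - d).
Proof. by ring. Qed.

Lemma absC_lin_comb (a b d : Cx R) : absC (toC eps * a + toC eps * b + toC eps ^+ 4 * d) <=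
  eps * absC a + eps * absC b + eps ^+ 4 * absC d.
Proof.
have E (z : Cx R) : absC (toC eps * z) = eps * absC z by have := absC_eps 1 z; rewrite !expr1.
rewrite -!E -absC_eps; apply: (le_trans (absCD _ _)); rewrite lerD2r; exact: absCD.
Qed.

Lemma pert_lip c y y' d : 0 <= d -> sdom y -> sdom y' ->
  (forall i, absC (y' i - y i) <= d * wt i) ->
  absC (pert' c y' - pert' c y) <= 3 * pconst * ebd c * d.
Proof.
move=> d0 Hy Hy' yy.
have -> : pert' c y' - pert' c y = toC eps * (Fo' c y' - Fo' c y) +
  toC eps * (Fg' c y' - Fg' c y) + toC eps ^+ 4 * (Ff' c y' - Ff' c y).
  exact: lin_combB.
apply: (le_trans (absC_lin_comb _ _ _)).
have B0 := ltW B_gt0; have e0 := ltW eps_gt0; have q0 := q_gt0; have t0 := th_gt0; have s0 := se_gt0.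
apply: piece_sum => //.
- apply: (@slice_deriv_weighted R _ ang Fo Fo' ro wt _ y y' c d ro_gt0 d0 _ Fo_holo3 Fo_bound wt_ro Hy Hy' yy).
  by nonneg.
- apply: (@slice_deriv_weighted R _ ang Fg Fg' rg wt _ y y' c d rg_gt0 d0 _ Fg_holo3 Fg_bound wt_rg (sdom_rg Hy) (sdom_rg Hy') yy).
  by nonneg.
- exact: (@slice_deriv_weighted R _ ang Ff Ff' rf wt _ y y' c d rf_gt0 d0 B0 Ff_holo3 Ff_bound3 wt_rf (sdom_rf Hy) (sdom_rf Hy') yy).
Qed.

Lemma two_pdom rho y : (forall c : crd, 0 < rho c) -> pdom ang rho y -> pdom ang (fun c => 2 * rho c) y.
Proof. by move=> r0; apply: pdomS => c; rewrite ler_peMl ?ler1n// ltW. Qed.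

Lemma pert_bound c y : sdom y -> absC (pert' c y) <= 3 * pconst * ebd c.
Proof.
move=> Hy.
apply: (le_trans (absC_lin_comb _ _ _)).
have B0 := ltW B_gt0; have e0 := ltW eps_gt0; have q0 := q_gt0; have t0 := th_gt0; have s0 := se_gt0.
have le8 (M r : R) : 0 <= M -> 0 < r -> 8 * M / r <= 128 * #|{: crd}|%:R * M / r * 1.
  by move=> M0 r0; rewrite mulr1 ler_wpM2r ?invr_ge0 ?(ltW r0)// ler_wpM2r// card_crd -natrM ler_nat.
rewrite -[leRHS]mulr1; apply: piece_sum => //.
- apply: le_trans (le8 _ _ _ (ro_gt0 c)).
    apply: (slice_bound (ro_gt0 c) _ Fo_holo3 Fo_bound) => [i|]; first exact: ltW (ro_gt0 i).
    by apply: two_pdom Hy; exact: ro_gt0.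
  by nonneg.
- apply: le_trans (le8 _ _ _ (rg_gt0 c)).
    apply: (slice_bound (rg_gt0 c) _ Fg_holo3 Fg_bound) => [i|]; first exact: ltW (rg_gt0 i).
    by apply: two_pdom (sdom_rg Hy); exact: rg_gt0.
  by nonneg.
- apply: le_trans (le8 _ _ B0 (rf_gt0 c)).
  apply: (slice_bound (rf_gt0 c) _ Ff_holo3 Ff_bound3) => [i|]; first exact: ltW (rf_gt0 i).
  by apply: two_pdom (sdom_rf Hy); exact: rf_gt0.
Qed.

(* Lipschitz bound for the gradient of h_eps - h_0, which is only O(eps) on a
   polydisc of radius O(sqrt eps). *)
Lemma Fh'_lip c y y' (m : R) : 0 <= m ->
  pdom ang (crad (th * se) th th) y -> pdom ang (crad (th * se) th th) y' ->
  (forall i, isa i -> absC (y' i - y i) <= m) ->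
  isa c -> absC (Fh' c y' - Fh' c y) <= 128 * B / th * se * m.
Proof.
move=> m0 Hy Hy' mm ic.
have H2 : sholo ang Fh Fh' (fun i => 2 * rf i).
  move=> x i Hx; apply: Fh_holo; apply: pdomS Hx => l; rewrite /rf cradM.
  by apply: crad_le; rewrite ler_wpM2r ?ler_nat// ?mulr_ge0 ?(ltW th_gt0) ?(ltW se_gt0).
have HL i x : pdom ang (fun i => 2 * rf i) x -> absC (Fh' i x) <= if isa i then B * eps else 0.
  move=> Hx; apply: Fh'_bound; apply: pdomS Hx => l; rewrite /rf cradM.
  by apply: crad_le; rewrite ler_wpM2r ?ler_nat// ?mulr_ge0 ?(ltW th_gt0) ?(ltW se_gt0).
apply: (le_trans (slice_deriv_lip (rf_gt0 c) (fun i => ltW (rf_gt0 i)) H2 HL Hy Hy')).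
have -> : rf c = th * se by move: ic; rewrite /isa /rf /crad => /andP[/negbTE -> /negbTE ->].
have -> : 128 * B / th * se * m = 8 / (th * se) * (8 * (2 * (B * eps) * m)).
  by rewrite -se2; field; rewrite !gt_eqF ?th_gt0 ?se_gt0.
apply: ler_wpM2l; first by rewrite divr_ge0 ?mulr_ge0 ?(ltW th_gt0) ?(ltW se_gt0).
have [b0' e0'] := (B_gt0, eps_gt0).
have b0 : 0 <= 2 * (B * eps) by nonneg.
apply: sum_crd_le => i; case: ifP => ii; last by rewrite mulr0 mul0r mulr_ge0.
by apply: ler_wpM2l => //; exact: mm.
Qed.
End Pieces.

(** * The frequency map *)

Section InverseCube.
Context {R : realType}.
Implicit Types x y a : R.

Lemma inv_dist x y l r : 0 < l -> l <= x -> l <= y -> `|x - y| <= r ->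
  `|x^-1 - y^-1| <= r * (l^-1 * l^-1).
Proof.
move=> l0 lx ly xy; have [x0 y0] := (lt_le_trans l0 lx, lt_le_trans l0 ly).
have -> : x^-1 - y^-1 = - ((x - y) * (x^-1 * y^-1)) by field; rewrite !gt_eqF.
rewrite normrN normrM; apply: ler_pM => //.
rewrite ger0_norm ?mulr_ge0 ?invr_ge0 ?(ltW x0) ?(ltW y0)//.
by apply: ler_pM; rewrite ?invr_ge0 ?(ltW x0) ?(ltW y0)// lef_pV2 ?posrE.
Qed.

Lemma prod4_close (u v s t b m e : R) : `|u| <= m -> `|v| <= m -> `|s| <= m -> `|b| <= m ->
  `|u - b| <= e -> `|v - b| <= e -> `|s - b| <= e -> `|t - b| <= e ->
  `|u * v * s * t - b ^+ 4| <= 4 * m ^+ 3 * e.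
Proof.
move=> um vm sm bm ub vb sb tb.
have m0 : 0 <= m := le_trans (normr_ge0 _) um.
have e0 : 0 <= e := le_trans (normr_ge0 _) ub.
have P3 (x1 x2 x3 y : R) : `|x1| <= m -> `|x2| <= m -> `|x3| <= m -> `|y| <= e ->
    `|x1 * x2 * x3 * y| <= m ^+ 3 * e.
  move=> h1 h2 h3 h4; rewrite !normrM; have -> : m ^+ 3 = m * m * m by ring.
  by do 3! [apply: ler_pM; rewrite ?mulr_ge0//].
have -> : u * v * s * t - b ^+ 4 = u * v * s * (t - b) + u * v * b * (s - b) + u * b * b * (v - b)
   + b * b * b * (u - b) by ring.
have -> : 4 * m ^+ 3 * e = m ^+ 3 * e + m ^+ 3 * e + m ^+ 3 * e + m ^+ 3 * e by ring.
by do 3! [apply: (le_trans (ler_normD _ _)); apply: lerD; last exact: P3]; exact: P3.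
Qed.

Lemma inv_cube_lip x y a l r : 0 < l -> l <= x -> l <= y -> l <= a ->
  `|x - a| <= r -> `|y - a| <= r ->
  `|x^-1 ^+ 3 - y^-1 ^+ 3 - - 3 * a^-1 ^+ 4 * (x - y)| <= 12 * l^-1 ^+ 5 * r * `|x - y|.
Proof.
move=> l0 lx ly la xr yr.
have [x0 y0 a0] : [/\ 0 < x, 0 < y & 0 < a] by split; exact: lt_le_trans l0 _.
have il z : l <= z -> `|z^-1| <= l^-1.
  move=> lz; rewrite ger0_norm ?invr_ge0 ?(le_trans (ltW l0))// lef_pV2 ?posrE//.
  exact: lt_le_trans lz.
have ux := inv_dist l0 lx la xr; have uy := inv_dist l0 ly la yr.
set u := x^-1 in ux *; set v := y^-1 in uy *; set b := a^-1 in ux uy *; set m := l^-1 in ux uy il *.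
have um := il _ lx; have vm := il _ ly; have bm := il _ la.
rewrite -/u in um; rewrite -/v in vm; rewrite -/b in bm.
have -> : u ^+ 3 - v ^+ 3 - - 3 * b ^+ 4 * (x - y) =
  - ((u * v * v * v - b ^+ 4) + (u * u * v * v - b ^+ 4) + (u * u * u * v - b ^+ 4)) * (x - y).
  by rewrite /u /v; field; rewrite !gt_eqF.
rewrite mulNr normrN normrM ler_wpM2r//.
have -> : 12 * m ^+ 5 * r = 4 * m ^+ 3 * (r * (m * m)) + 4 * m ^+ 3 * (r * (m * m)) + 4 * m ^+ 3 * (r * (m * m)) by ring.
apply: (le_trans (ler_normD _ _)); apply: lerD; last exact: prod4_close.
by apply: (le_trans (ler_normD _ _)); apply: lerD; exact: prod4_close.
Qed.

Lemma inv_cube_inj x a M : 0 < x -> 0 < a -> x <= M -> a <= M ->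
  3 * M^-1 ^+ 4 * `|x - a| <= `|x^-1 ^+ 3 - a^-1 ^+ 3|.
Proof.
move=> x0 a0 xM aM; have M0 := lt_le_trans x0 xM.
have iM z : 0 < z -> z <= M -> M^-1 <= z^-1 by move=> z0 zM; rewrite lef_pV2 ?posrE.
have [ux ua] := (iM _ x0 xM, iM _ a0 aM); have m0 : 0 <= M^-1 by rewrite invr_ge0 ltW.
set u := x^-1 in ux *; set b := a^-1 in ua *; set m := M^-1 in ux ua m0 *.
have [u0 b0] := (le_trans m0 ux, le_trans m0 ua).
have -> : u ^+ 3 - b ^+ 3 = - ((u * b) * (u * u + u * b + b * b) * (x - a)).
  by rewrite /u /b; field; rewrite !gt_eqF.
rewrite normrN normrM ler_wpM2r//.
rewrite ger0_norm ?mulr_ge0 ?addr_ge0 ?mulr_ge0//.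
have -> : 3 * m ^+ 4 = (m * m) * (m * m + m * m + m * m) by ring.
by apply: ler_pM; rewrite ?addr_ge0 ?mulr_ge0// ?lerD// ler_pM.
Qed.
End InverseCube.

Section KeplerDerivative.
Context {R : realType}.

Lemma toCX (x : R) n : toC (x ^+ n) = toC x ^+ n.
Proof. by elim: n => [|n IH]; rewrite ?expr0// !exprS toCM IH. Qed.

Lemma cder_shift (f : Cx R -> Cx R) a d : cder f a d -> cder (fun w => f (w + a)) 0 d.
Proof.
move=> H e e0; have [dl dl0 K] := H e e0; exists dl => // x /K.
by rewrite !add0r (addrC x).
Qed.

Lemma h0_derive (m0 : R) (m : 'I_2 -> R) eps (J : 'rV[R]_2) j : (forall i, 0 < J 0 i) ->
  'D_(unit_vec (Cx R) j) (h0 m0 m eps) (rvecC J) = toC (kappa m0 m eps j * (J 0 j)^-1 ^+ 3).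
Proof.
move=> J0; apply: derive_cder; rewrite /h0.
have nz i : toC (J 0 i) != 0 :> Cx R by rewrite -absC_gt0 absC_toC gtr0_norm.
pose d i : Cx R := if i == j then - (2 * toC (J 0 j)^-1 ^+ 3) else 0.
have D i : cder (fun w => (w *: unit_vec (Cx R) j + rvecC J) 0 i ^- 2) 0 (d i).
  rewrite /d; case: eqP => [->|/eqP ij].
    have H := cder_shift (cderV (nz j)).
    apply: (cder_ext (f := fun w => (w + toC (J 0 j))^-1 * (w + toC (J 0 j))^-1)) => [w|].
      by rewrite !mxE /= eqxx mulr1 -invfM -expr2.
    have := cderM H H; rewrite add0r.
    have -> : - toC (J 0 j) ^- 2 * (toC (J 0 j))^-1 + (toC (J 0 j))^-1 * - toC (J 0 j) ^- 2 =
      - (2 * toC (J 0 j)^-1 ^+ 3) => //.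
    have -> : toC (J 0 j)^-1 = (toC (J 0 j))^-1.
      by apply: (mulfI (nz j)); rewrite -toCM !divff// gt_eqF.
    by field; rewrite nz.
  apply: (cder_ext (f := fun=> toC (J 0 i) ^- 2)) => [w|]; last exact: cder_cst.
  by rewrite !mxE /= (negbTE ij) mulr0 add0r.
have := cderZ (- (1 / 2)) (cder_sum (index_enum 'I_2) (fun i => cderZ (toC (kappa m0 m eps i)) (D i))).
rewrite (bigD1 j)//= big1 ?addr0; last by move=> i ij; rewrite /d (negbTE ij) mulr0.
rewrite /d eqxx.
rewrite (_ : - (1 / 2) * (toC (kappa m0 m eps j) * - (2 * toC (J 0 j)^-1 ^+ 3)) =
  toC (kappa m0 m eps j * (J 0 j)^-1 ^+ 3))//.
have E (K x : Cx R) : - (1 / 2) * (K * - (2 * x)) = K * x by field.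
by rewrite E toCM toCX.
Qed.
End KeplerDerivative.

Section Frequency.
Context {R : realType}.
Variables (eps th B chi : R) (J0 : 'rV[R]_2) (h k : 'rV[Cx R]_2 -> Cx R).
Variables (Om : 'I_2 -> 'rV[Cx R]_2 -> Cx R) (g : phase_nopsi (Cx R) -> Cx R).
Variable f : phase (Cx R) -> Cx R.
Hypothesis L : local_nf eps th B chi J0 h k Om g f.
Variables (ka : 'I_2 -> R) (kmin lmin lmax q : R).
Hypothesis kmin0 : 0 < kmin.
Hypothesis ka_bd : forall j, kmin <= ka j <= 1.
Hypothesis lmin0 : 0 < lmin.
Hypothesis J0_bd : forall j, lmin <= J0 0 j <= lmax.
Hypothesis kD : forall J : 'rV[R]_2, (forall i, 0 < J 0 i) -> forall j,
  'D_(unit_vec (Cx R) j) k (rvecC J) = toC (ka j * (J 0 j)^-1 ^+ 3).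

Let se := Num.sqrt eps.

Definition freq0 j : R := ka j * (J0 0 j)^-1 ^+ 3.
(** The diagonal entries of the Hessian of the Kepler part at [J0]; its other entries vanish. *)
Definition twist j : R := - 3 * ka j * (J0 0 j)^-1 ^+ 4.
Definition twist_min : R := 3 * kmin * lmax^-1 ^+ 4.
Definition twist_max : R := 3 * lmin^-1 ^+ 4.

Lemma J0_gt0 j : 0 < J0 0 j.
Proof. by case/andP: (J0_bd j) => + _; exact: lt_le_trans. Qed.

Lemma lmax_gt0 : 0 < lmax.
Proof. by case/andP: (J0_bd 0) => a b; exact: lt_le_trans lmin0 (le_trans a b). Qed.

Lemma twist_min_gt0 : 0 < twist_min.
Proof.
by apply: mulr_gt0; [rewrite mulr_gt0|rewrite exprn_gt0// invr_gt0 lmax_gt0].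
Qed.

Lemma twist_abs j : `|twist j| = 3 * ka j * (J0 0 j)^-1 ^+ 4.
Proof.
rewrite /twist !mulNr normrN ger0_norm// !mulr_ge0 ?exprn_ge0 ?invr_ge0 ?(ltW (J0_gt0 j))//.
by case/andP: (ka_bd j) => + _; apply: le_trans; exact: ltW.
Qed.

Lemma twist_ge j : twist_min <= `|twist j|.
Proof.
have l0 := lmax_gt0; have [/andP[h1 _] /andP[_ h2]] := (ka_bd j, J0_bd j).
rewrite twist_abs /twist_min -!mulrA ler_wpM2l//.
apply: ler_pM; rewrite ?(ltW kmin0) ?exprn_ge0 ?invr_ge0 ?(ltW l0)//.
by rewrite ler_pXn2r ?nnegrE ?invr_ge0 ?(ltW l0) ?(ltW (J0_gt0 j))// lef_pV2 ?posrE ?J0_gt0.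
Qed.

Lemma twist_le j : `|twist j| <= twist_max.
Proof.
have [/andP[h0 h1] /andP[h2 _]] := (ka_bd j, J0_bd j).
rewrite twist_abs /twist_max -!mulrA ler_wpM2l// -[leRHS]mul1r.
apply: ler_pM; rewrite ?exprn_ge0 ?invr_ge0 ?(ltW (J0_gt0 j)) ?(le_trans (ltW kmin0) h0)//.
by rewrite ler_pXn2r ?nnegrE ?invr_ge0 ?(ltW lmin0) ?(ltW (J0_gt0 j))// lef_pV2 ?posrE ?J0_gt0.
Qed.

Lemma twist_neq0 j : twist j != 0.
Proof. by rewrite -normr_gt0 (lt_le_trans twist_min_gt0)// twist_ge. Qed.

Definition yof (J : 'rV[R]_2) (c : crd) : Cx R :=
  if isa c then toC (J 0 c.2.2 - J0 0 c.2.2) else 0.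

Lemma slot1_yof J : slot1 (emb J0 (yof J)) = rvecC J.
Proof.
by apply/rowP => i; rewrite /slot1 /= !mxE /yof /= toCB addrC subrK.
Qed.

Definition nearJ0 (r : R) (J : 'rV[R]_2) : Prop := forall j, `|J 0 j - J0 0 j| <= r.
Definition gh (j : 'I_2) (J : 'rV[R]_2) : R := reC ('D_(unit_vec (Cx R) j) h (rvecC J)).

Lemma yof_dom r ra J : 0 <= ra -> nearJ0 r J -> r <= ra -> pdom ang (crad ra th th) (yof J).
Proof.
move=> ra0 HJ rr; have t0 := ltW (th_gt0 L).
apply: crd_cases => j; rewrite /csize /ang /crad /yof /isa; cbn [fst snd negb andb].
- by rewrite absC_toC (le_trans (HJ j)).
- by rewrite normr0.
- by rewrite absC0.
- by rewrite absC0.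
Qed.

Lemma Dh_split (j : 'I_2) (J : 'rV[R]_2) : (forall i, 0 < J 0 i) ->
  'D_(unit_vec (Cx R) j) h (rvecC J) = Fh' J0 h k (ca j) (yof J) + toC (ka j * (J 0 j)^-1 ^+ 3).
Proof.
by move=> Jp; rewrite /Fh' slot1_dirc /= slot1_yof -kD// subrK.
Qed.

Lemma near_pos r J : nearJ0 r J -> r <= lmin / 2 -> forall j, lmin / 2 <= J 0 j.
Proof.
move=> HJ rl j; have := le_trans (HJ j) rl; have /andP[h1 _] := J0_bd j.
move: h1; rewrite ler_norml => h1 /andP[h2 _]; lra.
Qed.

(** Multiplied by [se], a Lipschitz constant for the frequency map minus its linear part. The term
    in [B] comes from [h - k] by Cauchy's estimate, the other from the Kepler part within distance
    [q * eps], where [eps <= se]. *)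
Definition lip_freq : R := 128 * B / th + 12 * (lmin / 2)^-1 ^+ 5 * q.
Hypothesis q1 : 1 <= q.
Hypothesis qth : q * eps <= th * se.
Hypothesis ql : q * eps <= lmin / 2.
Hypothesis q_twist : 2 * B / twist_min <= q - 1.
Hypothesis lip_small : lip_freq * se <= twist_min / 2.

Lemma eps_ge0 : 0 <= eps. Proof. exact: ltW (eps_gt0 L). Qed.

Lemma gh_lip j J J' m : nearJ0 (q * eps) J -> nearJ0 (q * eps) J' ->
  (forall i, `|J 0 i - J' 0 i| <= m) ->
  `|gh j J - gh j J' - twist j * (J 0 j - J' 0 j)| <= lip_freq * se * m.
Proof.
move=> HJ HJ' Hm.
have m0 : 0 <= m := le_trans (normr_ge0 _) (Hm 0).
have l0 : 0 < lmin / 2 by rewrite divr_gt0.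
have [pJ pJ'] := (near_pos HJ ql, near_pos HJ' ql).
have [p0 p0'] : (forall i, 0 < J 0 i) /\ (forall i, 0 < J' 0 i).
  by split=> i; exact: lt_le_trans l0 _.
have [[s0 t0] q0] := (ltW (se_gt0 L), ltW (th_gt0 L), lt_le_trans ltr01 q1).
have ra0 : 0 <= th * se by rewrite mulr_ge0.
have F1 := @Fh'_lip _ _ _ _ _ _ _ _ _ _ _ L (ca j) (yof J') (yof J) m m0
  (yof_dom ra0 HJ' qth) (yof_dom ra0 HJ qth).
have {}F1 : absC (Fh' J0 h k (ca j) (yof J) - Fh' J0 h k (ca j) (yof J')) <= 128 * B / th * se * m.
  apply: F1 => // i ii; rewrite /yof ii -toCB absC_toC.
  have -> : J 0 i.2.2 - J0 0 i.2.2 - (J' 0 i.2.2 - J0 0 i.2.2) = J 0 i.2.2 - J' 0 i.2.2 by ring.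
  exact: Hm.
have lJ0 : lmin / 2 <= J0 0 j by case/andP: (J0_bd j) => + _; apply: le_trans; lra.
have F2 := inv_cube_lip l0 (pJ j) (pJ' j) lJ0 (HJ j) (HJ' j).
rewrite /gh !Dh_split//.
have ab (z : Cx R) : `|reC z| <= absC z by exact: re_le_absC.
move: (Fh' _ _ _ _ (yof J)) (Fh' _ _ _ _ (yof J')) F1 => A A' F1.
rewrite !reCD !reC_toC.
have -> : reC A + ka j * (J 0 j)^-1 ^+ 3 - (reC A' + ka j * (J' 0 j)^-1 ^+ 3) -
    twist j * (J 0 j - J' 0 j) =
  reC (A - A') + ka j * ((J 0 j)^-1 ^+ 3 - (J' 0 j)^-1 ^+ 3 - - 3 * (J0 0 j)^-1 ^+ 4 * (J 0 j - J' 0 j)).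
  by rewrite reCD reCN /twist; ring.
apply: (le_trans (ler_normD _ _)).
rewrite /lip_freq [(_ + _ * q) * se]mulrDl mulrDl.
apply: lerD; first exact: le_trans (ab _) F1.
have [/andP[k0 k1]] := ka_bd j.
rewrite normrM ger0_norm ?(le_trans (ltW kmin0))// -[leRHS]mul1r.
apply: ler_pM => //; first exact: le_trans (ltW kmin0) k0.
apply: (le_trans F2); apply: ler_pM => //.
  by rewrite mulr_ge0 ?mulr_ge0 ?exprn_ge0 ?invr_ge0 ?(ltW l0)// ?(ltW q0) ?eps_ge0.
rewrite -[12 * _ * _]mulrA -[12 * _ * q * se]mulrA -[12 * _ * (q * se)]mulrA.
apply: ler_wpM2l => //; apply: ler_wpM2l; first by rewrite exprn_ge0 ?invr_ge0 ?(ltW l0).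
by apply: ler_wpM2l; [exact: ltW|exact: (eps_le_se L)].
Qed.

Lemma gh_J0 j : `|gh j J0 - freq0 j| <= B * eps.
Proof.
have n0 : nearJ0 0 J0 by move=> i; rewrite subrr normr0.
have ra0 : 0 <= th * se by rewrite mulr_ge0 ?(ltW (se_gt0 L)) ?(ltW (th_gt0 L)).
have D0 := yof_dom ra0 n0 ra0.
have D1 : pdom ang (crad (3 * (th * se)) (3 * th) (3 * th)) (yof J0).
  have t0 := ltW (th_gt0 L).
  by apply: pdomS D0 => c; apply: crad_le; rewrite ler_peMl// ler1n.
have H := @Fh'_bound _ _ _ _ _ _ _ _ _ _ _ L (ca j) _ D1.
rewrite /gh Dh_split; last exact: J0_gt0.
rewrite /= in H.
move: (Fh' _ _ _ _ _) H => A H.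
rewrite reCD reC_toC /freq0 addrK.
exact: le_trans (re_le_absC _) H.
Qed.

Definition rowadd (x : 'I_2 -> R) : 'rV[R]_2 := J0 + \row_j x j.

Lemma rowaddE x j : rowadd x 0 j = J0 0 j + x j.
Proof. by rewrite !mxE. Qed.

Lemma rowadd_near r x : nearJ0 r (rowadd x) <-> forall j, `|x j| <= r.
Proof. by split=> H j; have := H j; rewrite rowaddE addrAC subrr add0r. Qed.

Lemma exists_Jeps : exists2 J, nearJ0 ((q - 1) * eps) J & forall j, gh j J = freq0 j.
Proof.
have e0 := eps_ge0; have tm := twist_min_gt0.
have nq x : (forall j, `|x j| <= (q - 1) * eps) -> nearJ0 (q * eps) (rowadd x).
  move=> H; apply/rowadd_near => j; apply: (le_trans (H j)).
  by rewrite ler_wpM2r// gerBl.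
(* Newton's method with the derivative frozen at [J0]. The initial correction is at most
   [B * eps / twist_min], half the radius [(q - 1) * eps], and [lip_small] makes the map a
   contraction by 1/2. *)
pose Op (x : 'I_2 -> R) j := x j - (gh j (rowadd x) - freq0 j) / twist j.
pose U (x : 'I_2 -> R) := forall j, `|x j| <= (q - 1) * eps.
have lipO x y d : U x -> U y -> (forall i, `|x i - y i| <= d) ->
    forall i, `|Op x i - Op y i| <= d / 2.
  move=> Ux Uy H i; have tn := twist_neq0 i.
  have d0 : 0 <= d := le_trans (normr_ge0 _) (H 0).
  have -> : Op x i - Op y i = - ((gh i (rowadd x) - gh i (rowadd y) -
      twist i * (rowadd x 0 i - rowadd y 0 i)) / twist i).
    rewrite !rowaddE /Op; move: (gh i (rowadd x)) (gh i (rowadd y)) (freq0 i) (twist i) tn.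
    by move=> ? ? ? ? ?; field.
  rewrite normrN normrM normfV ler_pdivrMr ?normr_gt0//.
  have K : `|gh i (rowadd x) - gh i (rowadd y) - twist i * (rowadd x 0 i - rowadd y 0 i)| <= lip_freq * se * d.
    apply: gh_lip; [exact: nq|exact: nq|move=> l].
    by rewrite !rowaddE opprD addrACA subrr add0r.
  apply: (le_trans K); rewrite (_ : d / 2 * `|twist i| = `|twist i| / 2 * d); last by rewrite mulrAC -!mulrA mulrC -!mulrA.
  apply: ler_wpM2r => //.
  apply: (le_trans lip_small); rewrite ler_pM2r ?invr_gt0//; exact: twist_ge.
have Op0 j : `|Op (fun=> 0) j| <= (q - 1) * eps / 2.
  have tn := twist_neq0 j; have tg := twist_ge j.
  rewrite /Op sub0r normrN normrM normfV ler_pdivrMr ?normr_gt0//.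
  have -> : rowadd (fun=> 0) = J0 by apply/rowP => i; rewrite rowaddE addr0.
  apply: (le_trans (gh_J0 j)).
  have : 2 * B <= (q - 1) * twist_min by rewrite -ler_pdivrMr.
  move=> H; have H2 : (q - 1) * twist_min <= (q - 1) * `|twist j|.
    by apply: ler_wpM2l => //; rewrite subr_ge0.
  have H3 := ler_wpM2r e0 (le_trans H H2).
  have -> : (q - 1) * eps / 2 * `|twist j| = (q - 1) * `|twist j| * eps / 2 by ring.
  rewrite ler_pdivlMr//; have -> : B * eps * 2 = 2 * B * eps by ring.
  exact: H3.
have q10 : 0 <= (q - 1) * eps by rewrite mulr_ge0// subr_ge0.
have U0 : U (fun=> 0) by move=> j; rewrite normr0.
have OpU x : U x -> U (Op x).
  move=> Ux j.
  have K := lipO x (fun=> 0) ((q - 1) * eps) Ux U0.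
  have -> : Op x j = Op x j - Op (fun=> 0) j + Op (fun=> 0) j by rewrite subrK.
  apply: (le_trans (ler_normD _ _)).
  have -> : (q - 1) * eps = (q - 1) * eps / 2 + (q - 1) * eps / 2 by field.
  apply: lerD; last exact: Op0.
  by apply: K => i; rewrite subr0; exact: Ux.
have [x Ux fx] : exists2 x, U x & forall i, Op x i = x i.
  apply: (@picard_fixpoint R 'I_2 (fun=> 1) Op U (fun=> 0) ((q - 1) * eps)) => //.
  - by move=> x y d Ux Uy d0 H i; rewrite mulr1; apply: lipO => // l; have := H l; rewrite mulr1.
  - move=> xs x C Uxs H j; apply: (@le_of_small _ _ _ C) => n.
    have := H j n; rewrite mulr1 => K.
    have -> : x j = xs n j - (xs n j - x j) by ring.
    by apply: (le_trans (ler_normB _ _)); apply: lerD => //; exact: Uxs.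
  - move=> i; rewrite mulr1 subr0; apply: (le_trans (Op0 i)).
    by rewrite ler_pdivrMr// ler_peMr// ler1n.
exists (rowadd x); first by apply/rowadd_near.
move=> j; have tn := twist_neq0 j; move: (fx j); rewrite /Op => /eqP.
rewrite -subr_eq0 addrAC subrr add0r oppr_eq0 mulf_eq0 invr_eq0 (negbTE tn) orbF subr_eq0.
by move/eqP.
Qed.

Lemma Jeps_unique J J' : nearJ0 (q * eps) J -> nearJ0 (q * eps) J' ->
  (forall j, gh j J = gh j J') -> J = J'.
Proof.
move=> HJ HJ' E.
pose m := Num.max `|J 0 0 - J' 0 0| `|J 0 1 - J' 0 1|.
have Hm i : `|J 0 i - J' 0 i| <= m.
  by case: (unliftP 0 i) => [l ->|->]; rewrite /m le_max ?lexx// (ord1 l)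
     (_ : lift 0 0 = 1) ?lexx ?orbT//; exact: val_inj.
have tm := twist_min_gt0.
have K i : `|J 0 i - J' 0 i| <= m / 2.
  have := gh_lip i HJ HJ' Hm; rewrite E subrr sub0r normrN normrM => H.
  have m0 : 0 <= m := le_trans (normr_ge0 _) (Hm 0).
  have H2 := ler_wpM2r m0 lip_small.
  have H3 := ler_wpM2r (normr_ge0 (J 0 i - J' 0 i)) (twist_ge i).
  have H4 := le_trans H3 (le_trans H H2).
  have -> : m / 2 = twist_min^-1 * (twist_min / 2 * m) by field; rewrite gt_eqF.
  by rewrite ler_pdivlMl.
have mm : m <= m / 2 by rewrite {1}/m ge_max !K.
have m0 : m <= 0 by lra.
apply/rowP => i; apply/eqP; rewrite -subr_eq0 -normr_le0; exact: le_trans (Hm i) m0.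
Qed.
End Frequency.

(** * The real Hamiltonian vector field *)

Section Taylor.
Context {R : realType} {I : finType}.
Variables (w eta : I -> R) (dom : (I -> R) -> Prop).
Variables (P : (I -> R) -> R) (G : I -> (I -> R) -> R).
Implicit Types y : I -> R.

Definition rbump y (c : I) (t : R) (i : I) : R := if i == c then y i + t else y i.

Hypothesis eta0 : forall c, 0 <= eta c.
Hypothesis dom_box : forall y y' z, dom y -> dom y' ->
  (forall i, exists2 s, 0 <= s <= 1 & z i = y i + s * (y' i - y i)) -> dom z.
Hypothesis P_deriv : forall y c, dom y -> is_derive 0 (1 : R) (fun t => P (rbump y c t)) (G c y).
Hypothesis G_lip : forall c y y' d, dom y -> dom y' -> 0 <= d ->
  (forall i, `|y i - y' i| <= d * w i) -> `|G c y - G c y'| <= eta c * d.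

Lemma rbump_bump y c s t : rbump (rbump y c s) c t = rbump y c (s + t).
Proof. by apply/funext => i; rewrite /rbump; case: eqP => //= _; rewrite addrA. Qed.

Lemma slice_deriv y c a t : dom (rbump y c (t * a)) ->
  is_derive t (1 : R) (fun s => P (rbump y c (s * a))) (G c (rbump y c (t * a)) * a).
Proof.
move=> /(P_deriv c)/is_derive_epsP H; apply: is_derive_eps => e e0.
have k0 : 0 < `|a| + 1 by rewrite ltr_wpDl.
have [dl dl0 K] := H _ (divr_gt0 e0 k0).
exists (dl / (`|a| + 1)) => [|h hd]; first by rewrite divr_gt0.
have ha : `|h * a| <= `|h| * (`|a| + 1) by rewrite normrM ler_wpM2l// lerDl.
have hdl : `|h * a| < dl by apply: (le_lt_trans ha); rewrite -ltr_pdivlMr.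
have := K _ hdl; rewrite add0r !rbump_bump addr0 => {}K.
rewrite mulrDl -mulrA [a * h]mulrC; apply: (le_trans K).
apply: (le_trans (ler_wpM2l (ltW (divr_gt0 e0 k0)) ha)).
by rewrite mulrCA mulrC divfK// gt_eqF.
Qed.

Lemma coordinate_taylor y y' d : dom y -> dom y' -> 0 <= d ->
  (forall i, `|y' i - y i| <= d * w i) ->
  `|P y' - P y - \sum_c G c y * (y' c - y c)| <= (\sum_c eta c * w c) * d ^+ 2.
Proof.
move=> Hy Hy' d0 yy.
pose mix (s : seq I) i := if i \in s then y' i else y i.
have H s : uniq s -> `|P (mix s) - P y - \sum_(c <- s) G c y * (y' c - y c)| <=
    (\sum_(c <- s) eta c * w c) * d ^+ 2.
  elim: s => [_|c s IH /= /andP[cs us]].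
    by rewrite !big_nil mul0r (_ : mix [::] = y)// subrr subr0 normr0.
  rewrite !big_cons; set D := y' c - y c.
  have -> : mix (c :: s) = rbump (mix s) c (1 * D).
    apply/funext => j; rewrite /rbump /mix inE mul1r; case: eqP => //= ->.
    by rewrite (negbTE cs) /D addrC subrK.
  pose f t := P (rbump (mix s) c (t * D)) - t * (G c y * D).
  have m0 : rbump (mix s) c (0 * D) = mix s.
    by apply/funext => i; rewrite /rbump mul0r addr0; case: eqP.
  have dm t i : 0 <= t <= 1 ->
      exists2 s', 0 <= s' <= 1 & rbump (mix s) c (t * D) i = y i + s' * (y' i - y i).
    move=> t01; rewrite /rbump /mix; case: eqP => [->|_].
      by exists t => //; rewrite (negbTE cs).
    case: ifP => _; first by exists 1; rewrite ?lexx ?ler01// mul1r addrC subrK.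
    by exists 0; rewrite ?lexx ?ler01// mul0r addr0.
  have dom_t t : 0 <= t <= 1 -> dom (rbump (mix s) c (t * D)).
    by move=> t01; apply: (dom_box Hy Hy') => i; exact: dm.
  have df (t : R) : 0 <= t <= 1 ->
      is_derive t (1 : R) f ((G c (rbump (mix s) c (t * D)) - G c y) * D).
    move=> t01; rewrite /f mulrBl; apply: is_deriveB; first exact: (slice_deriv (dom_t t t01)).
    apply: is_derive_eps => e e0; exists 1 => // h _.
    rewrite (_ : _ - _ = 0) ?normr0 ?mulr_ge0 ?(ltW e0)//; ring.
  have K t : 0 <= t <= 1 -> `|(G c (rbump (mix s) c (t * D)) - G c y) * D| <= eta c * w c * d ^+ 2.
    move=> t01; rewrite normrM.
    have -> : eta c * w c * d ^+ 2 = eta c * d * (d * w c) by rewrite expr2; ring.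
    apply: ler_pM => //; last exact: yy.
    apply: (G_lip _ (dom_t t t01) Hy d0).
    move=> i; have [s' /andP[s0 s1] ->] := dm t i t01.
    rewrite addrAC subrr add0r normrM ger0_norm//; apply: le_trans (yy i).
    by rewrite ler_piMl.
  have := mvt01 df K; rewrite /f m0 mul0r subr0 [1 * (_ * _)]mul1r => M.
  have -> : P (rbump (mix s) c (1 * D)) - P y - (G c y * D + \sum_(j <- s) G j y * (y' j - y j)) =
   P (rbump (mix s) c (1 * D)) - G c y * D - P (mix s) +
   (P (mix s) - P y - \sum_(j <- s) G j y * (y' j - y j)).
    move: (\sum_(j <- s) _) (P (rbump _ _ _)) (P (mix s)) (P y) (G c y * D).
    by move=> ? ? ? ? ?; ring.
  by rewrite mulrDl; apply: (le_trans (ler_normD _ _)); apply: lerD => //; exact: IH.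
have := H (index_enum I) (index_enum_uniq I).
by rewrite (_ : mix _ = y')//; apply/funext => i; rewrite /mix mem_index_enum.
Qed.
End Taylor.

Section RealSlices.
Context {R : realType}.

Lemma cder_local (f g : Cx R -> Cx R) z d r : 0 < r ->
  (forall h, absC h < r -> f (z + h) = g (z + h)) -> cder f z d -> cder g z d.
Proof.
move=> r0 E H e e0; have [dl dl0 K] := H e e0.
exists (Num.min dl r); first by rewrite lt_min dl0.
move=> h; rewrite lt_min => /andP[h1 h2].
have fz : f z = g z by have := E 0; rewrite absC0 addr0; exact.
by rewrite -E// -fz; exact: K.
Qed.

(** Difference quotients along the real axis have no imaginary part, hence neither has the complex
    derivative, which then restricts to the real one. *)
Lemma cder_real (f : Cx R -> Cx R) d r : 0 < r ->
  (forall t : R, `|t| < r -> imC (f (toC t)) = 0) -> cder f 0 d ->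
  imC d = 0 /\ is_derive (0 : R) (1 : R) (fun t => reC (f (toC t))) (reC d).
Proof.
move=> r0 Hr H; split; last first.
  have := @cder_re R f 0 1 d 0; rewrite mulr1 toC0 addr0 => /(_ H); rewrite mulr1.
  rewrite (_ : (fun s => reC (f (0 + toC s * 1))) = fun t => reC (f (toC t)))//.
  by apply/funext => s; rewrite add0r mulr1.
apply/eqP; rewrite -normr_le0; apply/ler_addgt0Pr => e e0; rewrite add0r.
have [dl dl0 K] := H e e0.
pose t := Num.min dl r / 2.
have m0 : 0 < Num.min dl r by rewrite lt_min dl0.
have t0 : 0 < t by rewrite divr_gt0.
have tm : t < Num.min dl r by rewrite ltr_pdivrMr// ltr_pMr// ltr1n.
move: tm; rewrite lt_min => /andP[td tr].
have := K (toC t); rewrite absC_toC gtr0_norm// => /(_ td); rewrite add0r => {}K.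
have I1 : imC (f (toC t) - f 0 - d * toC t) = - (imC d * t).
  have f0 : imC (f 0) = 0 by rewrite -toC0 Hr// normr0.
  by rewrite !imCD !imCN imCM imC_toC reC_toC Hr ?gtr0_norm// f0; ring.
have : `|imC (f (toC t) - f 0 - d * toC t)| <= e * t.
  by apply: le_trans K; exact: im_le_absC.
by rewrite I1 normrN normrM (gtr0_norm t0) ler_pM2r.
Qed.
End RealSlices.

Section Slots.
Context {K : numFieldType}.
Implicit Types x : phase K.

Lemma differentiable_fst (U V : normedModType K) (x : U * V) : differentiable (@fst U V) x.
Proof. by apply: linear_differentiable => y; exact: cvg_fst. Qed.

Lemma differentiable_snd (U V : normedModType K) (x : U * V) : differentiable (@snd U V) x.
Proof. by apply: linear_differentiable => y; exact: cvg_snd. Qed.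

Lemma slot1_diff x : differentiable (@slot1 K : phase K -> 'rV[K]_2) x.
Proof.
apply: (differentiable_comp (f := fun x : phase K => x.1.1) (g := fst)); last exact: differentiable_fst.
apply: (differentiable_comp (f := fst) (g := fst)); exact: differentiable_fst.
Qed.

Lemma slot3_diff x : differentiable (@slot3 K : phase K -> 'rV[K]_2) x.
Proof.
apply: (differentiable_comp (f := fst) (g := snd)); [exact: differentiable_fst|exact: differentiable_snd].
Qed.

Lemma slot4_diff x : differentiable (@slot4 K : phase K -> 'rV[K]_2) x.
Proof. exact: differentiable_snd. Qed.

Lemma forget_angle_diff x :
  differentiable (@forget_angle K : phase K -> phase_nopsi K) x.
Proof.
apply: (differentiable_pair (f := fun x : phase K => (slot1 x, slot3 x)) (g := @slot4 K)).
  by apply: differentiable_pair; [exact: slot1_diff|exact: slot3_diff].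
exact: slot4_diff.
Qed.
End Slots.

Section HamiltonianField.
Context {R : realType}.
Variables (eps th B chi : R) (J0 : 'rV[R]_2) (h k : 'rV[Cx R]_2 -> Cx R).
Variables (Om : 'I_2 -> 'rV[Cx R]_2 -> Cx R) (g : phase_nopsi (Cx R) -> Cx R).
Variable f : phase (Cx R) -> Cx R.
Hypothesis L : local_nf eps th B chi J0 h k Om g f.
Implicit Types (y : crd -> Cx R).

Let se := Num.sqrt eps.
Let big : crd -> R := crad (3 * (th * se)) (3 * th) (3 * th).

Definition Ham (x : phase (Cx R)) : Cx R :=
  h (slot1 x) + toC eps * \sum_j Om j (slot1 x) * slot3 x 0 j * slot4 x 0 j
  + toC eps * g (forget_angle x) + toC eps ^+ 4 * f x.

Definition HD (c : crd) y : Cx R :=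
  'D_(slot1 (dirc c)) h (slot1 (emb J0 y))
  + toC eps * \sum_j Om j (rvecC J0) * quad' j c y + pert' eps J0 Om g f c y.

Lemma zw_quad j y : slot3 (emb J0 y) 0 j * slot4 (emb J0 y) 0 j = quad j y.
Proof.
rewrite /quad -isq2_sq /slot3 /slot4 /= !mxE.
have ii : 'i * 'i = -1 :> Cx R by rewrite -expr2 sqrCi.
move: (y (cv j)) (y (cu j)) => v u; move: isq2 => s.
have -> : s * (v + 'i * u) * (s * (v - 'i * u)) = s * s * (v * v - 'i * 'i * (u * u)) by ring.
by rewrite ii mulN1r opprK.
Qed.

Lemma Ham_emb y : Ham (emb J0 y) = h (slot1 (emb J0 y)) +
  toC eps * \sum_j Fom J0 Om j y * quad j y + toC eps * Fg J0 g y + toC eps ^+ 4 * Ff J0 f y.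
Proof.
rewrite /Ham /Fg /Ff; congr (_ + _ * _ + _ + _).
by apply: eq_bigr => j _; rewrite -mulrA zw_quad.
Qed.

Lemma HD_regroup (e e4 d : Cx R) (a b q q' : 'I_2 -> Cx R) (o : 'I_2 -> Cx R) (x z : Cx R) :
  d + e * (\sum_j (a j * q j + b j * q' j)) + e * x + e4 * z =
  d + e * (\sum_j o j * q' j) + (e * (\sum_j (a j * q j + (b j - o j) * q' j)) + e * x + e4 * z).
Proof.
have -> : \sum_j (a j * q j + b j * q' j) =
    \sum_j o j * q' j + \sum_j (a j * q j + (b j - o j) * q' j).
  by rewrite -big_split /=; apply: eq_bigr => j _; ring.
by move: (\sum_j _) (\sum_j (_ + _)) => ? ?; ring.
Qed.

Lemma Ham_cder y c : pdom ang big y -> cder (fun w => Ham (emb J0 (cbump y c w))) 0 (HD c y).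
Proof.
move=> Hy; have [dh _ _ _ _] := ln_act L Hy.
have Dh : cder (fun w => h (slot1 (emb J0 (cbump y c w)))) 0 ('D_(slot1 (dirc c)) h (slot1 (emb J0 y))).
  apply: cder_ext (derive_cder_diff (slot1 (dirc c)) dh) => w.
  by rewrite emb_cbump.
have Dz : cder (fun w => \sum_j Fom J0 Om j (cbump y c w) * quad j (cbump y c w)) 0
    (\sum_j (Fom' J0 Om j c y * quad j y + Fom J0 Om j y * quad' j c y)).
  apply: (@cder_sum _ _ _ (fun j w => Fom J0 Om j (cbump y c w) * quad j (cbump y c w))) => j.
  by have := cderM (Fom_holo L j c Hy) (quad_cder j y c); rewrite !cbump0.
have := cderD (cderD (cderD Dh (cderZ (toC eps) Dz)) (cderZ (toC eps) (Fg_holo L c Hy)))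
  (cderZ (toC eps ^+ 4) (Ff_holo L c Hy)).
rewrite (HD_regroup _ _ _ _ _ _ _ (fun j => Om j (rvecC J0))); apply: cder_ext => w.
by rewrite Ham_emb.
Qed.

Lemma Ham_dir y c : pdom ang big y -> 'D_(dirc c) Ham (emb J0 y) = HD c y.
Proof.
move=> Hy; apply: derive_cder; apply: cder_ext (Ham_cder c Hy) => w.
by rewrite emb_cbump.
Qed.

Lemma Ham_diff y : pdom ang big y -> differentiable Ham (emb J0 y).
Proof.
move=> Hy; have [dh _ dO _ _] := ln_act L Hy; have [dg _] := ln_g L Hy; have [df _] := ln_f L Hy.
apply: differentiableD; last by apply: differentiableM => //; exact: differentiable_cst.
apply: differentiableD; last first.
  apply: differentiableM; first exact: differentiable_cst.
  by apply: (differentiable_comp (g := g)) => //; exact: forget_angle_diff.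
apply: differentiableD.
  by apply: (differentiable_comp (g := h)) => //; exact: slot1_diff.
apply: differentiableM; first exact: differentiable_cst.
rewrite (_ : (fun _ => _) = \sum_j (fun x : phase (Cx R) => Om j (slot1 x) * slot3 x 0 j * slot4 x 0 j)); last first.
  by apply/funext => x; rewrite fct_sumE.
apply: differentiable_sum => j.
apply: differentiableM; first apply: differentiableM.
- by apply: (differentiable_comp (g := Om j)) => //; exact: slot1_diff.
- by apply: (differentiable_comp (g := fun z : 'rV[Cx R]_2 => z 0 j)); [exact: slot3_diff|exact: differentiable_coord].
- by apply: (differentiable_comp (g := fun z : 'rV[Cx R]_2 => z 0 j)); [exact: slot4_diff|exact: differentiable_coord].
Qed.

(** This is [d/dz = (d/dv - i d/du) / sqrt 2] for independent [z] and [w]. Combining directions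
    linearly uses full differentiability of [Ham], beyond that of its coordinate slices. *)
Lemma Ham_dir3 y j : pdom ang big y ->
  'D_(dir3 _ j) Ham (emb J0 y) = isq2 * HD (cv j) y - isq2 * 'i * HD (cu j) y.
Proof.
move=> Hy; rewrite -!Ham_dir// -mulNr -derive_lin; last exact: Ham_diff.
congr ('D_ _ Ham _).
have ii : 'i * 'i = -1 :> Cx R by rewrite -expr2 sqrCi.
have E := @isq2_sq R.
have hh : 2^-1 + 2^-1 = 1 :> Cx R by field.
have e1 : - (isq2 * 'i) * (isq2 * 'i) = 2^-1 :> Cx R.
  by rewrite -E; move: isq2 => s; rewrite -[RHS]mulr1 -[1]opprK -ii; ring.
rewrite /dirc /= !scalerDr !scalerA E e1 addrACA -scalerDl hh scale1r -scalerDl.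
have -> : 2^-1 + - (isq2 * 'i) * - (isq2 * 'i) = 0 :> Cx R.
  by rewrite mulrN e1 subrr.
by rewrite scale0r addr0.
Qed.

Lemma Ham_dir4 y j : pdom ang big y ->
  'D_(dir4 _ j) Ham (emb J0 y) = isq2 * HD (cv j) y + isq2 * 'i * HD (cu j) y.
Proof.
move=> Hy; rewrite -!Ham_dir// -derive_lin; last exact: Ham_diff.
congr ('D_ _ Ham _).
have ii : 'i * 'i = -1 :> Cx R by rewrite -expr2 sqrCi.
have E := @isq2_sq R.
have hh : 2^-1 + 2^-1 = 1 :> Cx R by field.
have e1 : (isq2 * 'i) * (isq2 * 'i) = - 2^-1 :> Cx R.
  rewrite -E; move: isq2 => s; rewrite -[RHS]mulr1 -[1]opprK -ii; ring.
rewrite /dirc /= !scalerDr !scalerA E e1 addrACA -!scalerDl mulrN e1 opprK hh subrr scale0r add0r.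
by rewrite scale1r.
Qed.
End HamiltonianField.

(** An odd multiple of [pi] is at least [pi] in modulus: this separates two orbits whose phases
    differ by half a turn across the flow. *)
Lemma odd_norm_ge1 (R : realType) (m : int) : 1 <= `|1 - 2 * m%:~R| :> R.
Proof.
have Z : 1 <= `|1 - 2 * m| by lia.
have E : (1 - 2 * m)%:~R = 1 - 2 * m%:~R :> R by rewrite intrB intrM.
by rewrite -E -intr_norm (ler_int R 1).
Qed.

Lemma pconst_nonneg (R : realType) (th B q : R) : 0 < th -> 0 <= B -> 0 <= q -> 0 <= pconst th B q.
Proof. by move=> t0 b0 q0; rewrite /pconst /piece_const; nonneg. Qed.

Lemma lip_freq_nonneg (R : realType) (th B lmin q : R) : 0 < th -> 0 <= B -> 0 < lmin -> 0 <= q ->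
  0 <= lip_freq th B lmin q.
Proof.
move=> t0 b0 l0 q0; have l2 : 0 < lmin / 2 by rewrite divr_gt0.
by rewrite /lip_freq; nonneg.
Qed.

(** * The normal form near the torus as a perturbed quadratic Hamiltonian *)

Section RealField.
Context {R : realType}.
Variables (eps th B chi : R) (J0 : 'rV[R]_2) (h k : 'rV[Cx R]_2 -> Cx R).
Variables (Om : 'I_2 -> 'rV[Cx R]_2 -> Cx R) (g : phase_nopsi (Cx R) -> Cx R).
Variable f : phase (Cx R) -> Cx R.
Hypothesis L : local_nf eps th B chi J0 h k Om g f.
Variables (ka : 'I_2 -> R) (kmin lmin lmax q : R).
Hypothesis kmin0 : 0 < kmin.
Hypothesis ka_bd : forall j, kmin <= ka j <= 1.
Hypothesis lmin0 : 0 < lmin.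
Hypothesis J0_bd : forall j, lmin <= J0 0 j <= lmax.
Hypothesis kD : forall J : 'rV[R]_2, (forall i, 0 < J 0 i) -> forall j,
  'D_(unit_vec (Cx R) j) k (rvecC J) = toC (ka j * (J 0 j)^-1 ^+ 3).
Hypothesis q1 : 1 <= q.
Let se := Num.sqrt eps.
Hypothesis qs : 3 * q * se <= th.
Hypothesis et : eps <= th.
Hypothesis ql : q * eps <= lmin / 2.
Variable Jeps : 'rV[R]_2.
Hypothesis Jeps_near : nearJ0 J0 ((q - 1) * eps) Jeps.
Hypothesis Jeps_freq : forall j, gh h j Jeps = freq0 J0 ka j.

Let big : crd -> R := crad (3 * (th * se)) (3 * th) (3 * th).
Local Notation HDf := (HD eps J0 h Om g f).
Local Notation pert := (pert' eps J0 Om g f).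
Local Notation Hm := (Ham eps h Om g f).
Implicit Types x : crd -> R.

(** Moves the origin of the actions to [Jeps], so that real coordinates are deviations from the
    torus while [emb] keeps its centre [J0]. *)
Definition ctr (c : crd) : R := if isa c then Jeps 0 c.2.2 - J0 0 c.2.2 else 0.
Definition rl x (c : crd) : Cx R := toC (x c + ctr c).
Definition xdom x : Prop := forall c, ~~ ang c -> `|x c| <= wt eps c.

Lemma csize_toC c (r : R) : csize ang c (toC r) = if ang c then 0 else `|r|.
Proof. by rewrite /csize; case: ifP => _; rewrite ?imC_toC ?normr0 ?absC_toC. Qed.

Lemma rl_sdom x : xdom x -> sdom eps th q (rl x).
Proof.
move=> Hx c; rewrite csize_toC; have e0 := ltW (eps_gt0 L); have t0 := ltW (th_gt0 L).
case: ifP => ac; first by rewrite /crad; case: ifP => _; [exact: exprn_ge0|case: ifP => _ //;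
  rewrite mulr_ge0// (le_trans ler01 q1)].
apply: (le_trans (ler_normD _ _)); move: ac (Hx c); rewrite /ctr.
have e3 : eps ^+ 3 <= eps by exact: (eps_pow_le L (i := 3) (j := 1)).
move: c; apply: crd_cases => j; rewrite /ang /isa /crad /wt /crad; cbn [fst snd negb andb] => // _ /(_ isT) H.
- apply: (le_trans (lerD H (Jeps_near j))).
  rewrite mulrBl mul1r; lra.
- by rewrite normr0 addr0.
- by rewrite normr0 addr0.
Qed.

Lemma rl_big x c (t : R) : xdom x -> `|t| <= th * se -> pdom ang big (rl (rbump x c t)).
Proof.
move=> /rl_sdom Hx ht i; have := Hx i; rewrite !csize_toC.
have [t0 s0] := (ltW (th_gt0 L), ltW (se_gt0 L)).
have ts0 : 0 <= th * se by exact: mulr_ge0.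
have tst : th * se <= th by rewrite ler_piMr// (se_le1 L).
have qe := qeps_le L q1 qs; have e2 := eps2_le_th L et.
case: ifP => ai H.
  by rewrite /big /crad; case: ifP => _; [|case: ifP => _]; rewrite mulr_ge0.
have H2 : `|rbump x c t i + ctr i| <= crad (q * eps) th (eps ^+ 2) i + th * se.
  rewrite /rbump; case: eqP => _; last by apply: (le_trans H); rewrite lerDl.
  by rewrite addrAC; apply: (le_trans (ler_normD _ _)); apply: lerD.
apply: (le_trans H2); rewrite /big /crad; case: ifP => _; last case: ifP => _.
- lra.
- lra.
- rewrite -/se in qe; lra.
Qed.

Lemma rl_cbump x c t : rl (rbump x c t) = cbump (rl x) c (toC t).
Proof.
apply/funext => i; rewrite /rl /cbump /rbump; case: eqP => // _.
by rewrite -toCD addrAC.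
Qed.

Lemma rl_big0 x : xdom x -> pdom ang big (rl x).
Proof.
move=> Hx; have := @rl_big x (ca 0) 0 Hx; rewrite normr0 => /(_ _).
rewrite (_ : rbump x _ 0 = x); last by apply/funext => i; rewrite /rbump addr0; case: eqP.
by apply; rewrite mulr_ge0 ?(ltW (th_gt0 L)) ?(ltW (se_gt0 L)).
Qed.

Lemma imC_sum (I : Type) (r : seq I) (F : I -> Cx R) : (forall i, imC (F i) = 0) ->
  imC (\sum_(i <- r) F i) = 0.
Proof. by move=> H; elim: r => [|i r IH]; rewrite ?big_nil// big_cons imCD H IH addr0. Qed.

Lemma imCM0 (a b : Cx R) : imC a = 0 -> imC b = 0 -> imC (a * b) = 0.
Proof. by move=> ha hb; rewrite imCM ha hb mulr0 mul0r addr0. Qed.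

Lemma imCX0 (a : Cx R) n : imC a = 0 -> imC (a ^+ n) = 0.
Proof. by move=> ha; elim: n => [|n IH]; rewrite ?expr0// exprS imCM0. Qed.

Lemma Ham_real (y : crd -> R) : pdom ang big (fun c => toC (y c)) ->
  imC (Hm (emb J0 (fun c => toC (y c)))) = 0.
Proof.
move=> /(ln_real L)[h0 o0 g0 f0]; rewrite Ham_emb.
rewrite !imCD h0 imCM0 ?imC_toC//; last first.
  apply: imC_sum => j; apply: imCM0; first exact: o0.
  rewrite /quad -!toCM -toCD; apply: imCM0 => //.
  have -> : 2^-1 = toC 2^-1 :> Cx R.
    by rewrite -isq2_sq /isq2 -toCM -invfM -expr2 sqr_sqrtr.
  exact: imC_toC.
by rewrite imCM0 ?imC_toC// (imCM0 _ f0) ?addr0//; apply: imCX0; exact: imC_toC.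
Qed.

Lemma HD_real x c : xdom x -> imC (HDf c (rl x)) = 0 /\
  is_derive (0 : R) (1 : R) (fun t => reC (Hm (emb J0 (rl (rbump x c t))))) (reC (HDf c (rl x))).
Proof.
move=> Hx; have ts0 : 0 < th * se by rewrite mulr_gt0 ?(th_gt0 L) ?(se_gt0 L).
have H := cder_real ts0 _ (Ham_cder L c (rl_big0 Hx)).
rewrite (_ : (fun t => _) = fun t => reC (Hm (emb J0 (cbump (rl x) c (toC t))))); last first.
  by apply/funext => t; rewrite rl_cbump.
apply: H => t ht; rewrite -rl_cbump; apply: Ham_real.
exact: rl_big (ltW ht).
Qed.

Definition Jof x : 'rV[R]_2 := \row_j (Jeps 0 j + x (ca j)).

Lemma slot1_rl x : slot1 (emb J0 (rl x)) = rvecC (Jof x).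
Proof.
apply/rowP => j; rewrite /slot1 /= !mxE /rl /ctr /isa /= -toCD; congr toC; ring.
Qed.

Lemma Jof_near x : xdom x -> nearJ0 J0 (q * eps) (Jof x).
Proof.
move=> Hx j; rewrite mxE.
have -> : Jeps 0 j + x (ca j) - J0 0 j = x (ca j) + ctr (ca j) by rewrite /ctr /isa /=; ring.
by have := rl_sdom Hx (ca j); rewrite csize_toC.
Qed.

Definition omr j : R := reC (Om j (rvecC J0)).

Lemma slot1_0 : slot1 (emb J0 (fun=> toC 0)) = rvecC J0.
Proof. by apply/rowP => j; rewrite /slot1 /= !mxE toC0 addr0. Qed.

Lemma zero_big : pdom ang big (fun=> toC 0).
Proof.
have [t0 s0] := (ltW (th_gt0 L), ltW (se_gt0 L)).
move=> c; rewrite csize_toC normr0 if_same /big /crad.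
by case: ifP => _; [|case: ifP => _]; rewrite ?mulr_ge0.
Qed.

Lemma Om_real j : Om j (rvecC J0) = toC (omr j).
Proof.
have [_ o0 _ _] := ln_real L (y := fun=> 0) zero_big.
by apply: toC_re; have := o0 j; rewrite slot1_0.
Qed.

Lemma omr_le j : omr j <= B.
Proof.
have [_ _ _ _ o0] := ln_act L (y := fun=> toC 0) zero_big.
have := o0 j; rewrite slot1_0; apply: le_trans.
exact: le_trans (ler_norm _) (re_le_absC _).
Qed.

Lemma omr_ge j : chi <= omr j. Proof. exact: ln_low L j. Qed.

Definition beta (c : crd) : R :=
  if c.2.1 then eps * omr c.2.2 else if c.1 then 0 else twist J0 ka c.2.2.
Definition omv (c : crd) : R := if ang c then freq0 J0 ka c.2.2 else 0.
(** The gradient minus its linear-flow and quadratic parts. The frequency is attached to the angle,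
    hence enters the derivative in the conjugate action. *)
Definition Gf (c : crd) x : R := reC (HDf c (rl x)) - omv (cj c) - beta c * x c.
Definition phi (c : crd) (s : R) : R := omv (cj c) * s + beta c / 2 * s ^+ 2.
Definition Pf x : R := reC (Hm (emb J0 (rl x))) - \sum_c phi c (x c).
(** The nonlinear part of the frequency map about [Jeps]. Its linear part uses the twist at [J0];
    the discrepancy with the Hessian at [Jeps] stays here and only costs a Lipschitz constant of
    order [se]. *)
Definition kep (c : crd) x : R :=
  if isa c then gh h c.2.2 (Jof x) - gh h c.2.2 Jeps - twist J0 ka c.2.2 * x c else 0.

Lemma beta_neq0 c : (beta c != 0) = ~~ ang c.
Proof.
have e0 := eps_gt0 L; have o0 j : 0 < omr j := lt_le_trans (ln_chi L) (omr_ge j).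
have tw j := twist_neq0 kmin0 ka_bd lmin0 J0_bd j.
by move: c; apply: crd_cases => j; rewrite /beta /ang; cbn [fst snd negb andb];
  rewrite ?eqxx ?tw// gt_eqF ?mulr_gt0.
Qed.

Lemma quad'_sum (F : 'I_2 -> Cx R) c y : \sum_j F j * quad' j c y =
  if c.2.1 then F c.2.2 * y c else 0.
Proof.
rewrite (bigD1 c.2.2)//= big1 ?addr0 => [|i ic]; last first.
  rewrite /quad'; case: eqP => [e|_]; first by move: ic; rewrite e eqxx.
  by case: eqP => [e|_]; [move: ic; rewrite e eqxx|rewrite mulr0].
move: c; apply: crd_cases => j; rewrite /quad' /ca /cps /cv /cu; cbn [fst snd];
  rewrite !xpair_eqE /= ?mulr0//; by rewrite !eqxx.
Qed.

Lemma Gf_split c x : xdom x -> Gf c x = kep c x + reC (pert c (rl x)).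
Proof.
move=> Hx; rewrite /Gf /HD quad'_sum /kep /beta /omv.
move: (pert c (rl x)) => p.
have toCr (a : R) : reC (toC a) = a by [].
move: c p; apply: crd_cases => j p; rewrite /ang /isa slot1_dirc /isa; cbn [fst snd negb andb cj ca cps cv cu];
  rewrite ?derive_dir0 ?slot1_rl reCD.
- by rewrite mulr0 addr0 -/(gh h j (Jof x)) Jeps_freq; ring.
- by rewrite mulr0 addr0 add0r subr0 mul0r subr0.
- by rewrite Om_real /rl /ctr /isa /=; ring.
- by rewrite Om_real /rl /ctr /isa /=; ring.
Qed.

Definition Gconst : R := lip_freq th B lmin q + 3 * pconst th B q.
Definition eta (c : crd) : R := Gconst * ebd eps c.

Lemma B_ge0 : 0 <= B. Proof. exact: ltW (B_gt0 L). Qed.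

Lemma lip_freq_ge0 : 0 <= lip_freq th B lmin q.
Proof. exact: lip_freq_nonneg (th_gt0 L) B_ge0 lmin0 (le_trans ler01 q1). Qed.

Lemma pconst_ge0 : 0 <= pconst th B q.
Proof. exact: pconst_nonneg (th_gt0 L) B_ge0 (le_trans ler01 q1). Qed.

Lemma ebd_ge0 c : 0 <= ebd eps c.
Proof. by rewrite ltW// crad_gt0 ?mulr_gt0 ?exprn_gt0 ?(eps_gt0 L) ?(se_gt0 L). Qed.

Lemma wt_gt0 c : 0 < wt eps c.
Proof. by rewrite crad_gt0 ?exprn_gt0 ?(eps_gt0 L). Qed.

Lemma eta_ge0 c : 0 <= eta c.
Proof.
by rewrite mulr_ge0 ?ebd_ge0// addr_ge0 ?lip_freq_ge0// mulr_ge0 ?pconst_ge0.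
Qed.

Lemma kep_lip c x x' d : xdom x -> xdom x' -> 0 <= d ->
  (forall i, `|x i - x' i| <= d * wt eps i) ->
  `|kep c x - kep c x'| <= lip_freq th B lmin q * ebd eps c * d.
Proof.
move=> Hx Hx' d0 H; rewrite /kep; case: ifP => ic; last first.
  by rewrite subrr normr0 !mulr_ge0 ?lip_freq_ge0 ?ebd_ge0.
have e3 : ebd eps c = eps ^+ 3 * se.
  by move: ic; rewrite /isa /ebd /crad => /andP[/negbTE -> /negbTE ->].
have HJ i : `|Jof x 0 i - Jof x' 0 i| <= d * eps ^+ 3.
  rewrite !mxE opprD addrACA subrr add0r; exact: H.
have cE : c = ca c.2.2.
  by move: ic; rewrite /isa; case: (c) => [b1 [b2 j]] /=; case: b1 => //; case: b2.
have := gh_lip L kmin0 ka_bd lmin0 J0_bd kD q1 (qeps_le L q1 qs) ql c.2.2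
  (Jof_near Hx) (Jof_near Hx') HJ.
have -> : Jof x 0 c.2.2 - Jof x' 0 c.2.2 = x c - x' c.
  by rewrite !mxE opprD addrACA subrr add0r -cE.
move: (gh h _ (Jof x)) (gh h _ (Jof x')) (gh h _ Jeps) (twist _ _ _) (lip_freq _ _ _ _).
move=> u v w t l; rewrite e3.
have -> : u - w - t * x c - (v - w - t * x' c) = u - v - t * (x c - x' c) by ring.
by have -> : l * (eps ^+ 3 * se) * d = l * se * (d * eps ^+ 3) by ring.
Qed.

Lemma kep0 c x : xdom x -> kep c (fun=> 0) = 0.
Proof.
move=> _; rewrite /kep; case: ifP => // _.
by rewrite (_ : Jof (fun=> 0) = Jeps) ?subrr ?mulr0 ?subr0//; apply/rowP => i; rewrite mxE addr0.
Qed.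

Lemma reCB_le (a b : Cx R) : `|reC a - reC b| <= absC (a - b).
Proof. by rewrite -reCN -reCD; exact: re_le_absC. Qed.

Lemma Gf_lip c x x' d : xdom x -> xdom x' -> 0 <= d ->
  (forall i, `|x i - x' i| <= d * wt eps i) -> `|Gf c x - Gf c x'| <= eta c * d.
Proof.
move=> Hx Hx' d0 H; rewrite !Gf_split//.
have K := kep_lip c Hx Hx' d0 H.
have P1 := pert_lip L q1 qs et c d0 (rl_sdom Hx') (rl_sdom Hx).
have {}P1 : absC (pert c (rl x) - pert c (rl x')) <= 3 * pconst th B q * ebd eps c * d.
  apply: P1 => i; rewrite /rl -toCB absC_toC.
  by rewrite (_ : x i + ctr i - (x' i + ctr i) = x i - x' i)//; ring.
rewrite /eta /Gconst; move: (lip_freq _ _ _ _) (3 * pconst _ _ _) (kep c x) (kep c x')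
  (pert c (rl x)) (pert c (rl x')) K P1 => l a r r' p p' K P1.
have -> : r + reC p - (r' + reC p') = r - r' + (reC p - reC p') by ring.
rewrite !mulrDl; apply: (le_trans (ler_normD _ _)); apply: lerD => //.
exact: le_trans (reCB_le _ _) P1.
Qed.

Lemma Gf_bd c x : xdom x -> `|Gf c x| <= eta c.
Proof.
move=> Hx; rewrite Gf_split//.
have x0 : xdom (fun=> 0) by move=> i _; rewrite normr0 ltW ?wt_gt0.
(* The bound on [kep] is the Lipschitz bound at weighted distance 1 from the origin. Angles, which
   have no bound, are set to zero before comparing, since [kep] does not depend on them. *)
pose x' i := if ang i then 0 else x i.
have x'x : kep c x = kep c x'.
  rewrite /kep; case: ifP => // ic.
  have -> : Jof x' = Jof x by apply/rowP => j; rewrite !mxE.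
  have -> // : x' c = x c.
  by move: ic; rewrite /x' /isa /ang => /andP[/negbTE -> _].
have Hx' : xdom x' by move=> i ai; rewrite /x' (negbTE ai); exact: Hx.
have K : `|kep c x'| <= lip_freq th B lmin q * ebd eps c.
  have := @kep_lip c x' (fun=> 0) 1 Hx' x0 ler01.
  rewrite (kep0 c Hx) subr0 mulr1; apply => i; rewrite subr0 mul1r /x'.
  by case: ifP => ai; [rewrite normr0 ltW ?wt_gt0|apply: Hx; rewrite ai].
have P1 := pert_bound L q1 qs et c (rl_sdom Hx).
rewrite x'x /eta /Gconst; move: (lip_freq _ _ _ _) (3 * pconst _ _ _) (pert c (rl x)) (kep c x') K P1.
move=> l a p r K P1; rewrite mulrDl; apply: (le_trans (ler_normD _ _)); apply: lerD => //.
exact: le_trans (re_le_absC _) P1.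
Qed.

Lemma phi_deriv c (s e : R) : 0 < e -> exists2 dl, 0 < dl & forall t, `|t| < dl ->
  `|phi c (s + t) - phi c s - (omv (cj c) + beta c * s) * t| <= e * `|t|.
Proof.
move=> e0; have b0 : 0 < `|beta c| + 1 by rewrite ltr_wpDl.
exists (e / (`|beta c| + 1)) => [|t ht]; first exact: divr_gt0.
rewrite /phi; have -> : omv (cj c) * (s + t) + beta c / 2 * (s + t) ^+ 2 -
  (omv (cj c) * s + beta c / 2 * s ^+ 2) - (omv (cj c) + beta c * s) * t = (beta c / 2 * t) * t by field.
rewrite normrM ler_wpM2r// normrM normrM.
have h1 : `|beta c| * `|(2 : R)^-1| <= `|beta c| + 1.
  have : `|(2 : R)^-1| <= 1 by rewrite ger0_norm ?invr_ge0// invf_le1// ler1n.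
  move=> /(ler_wpM2l (normr_ge0 (beta c))); rewrite mulr1 => /le_trans; apply.
  by rewrite lerDl.
apply: (le_trans (ler_wpM2r (normr_ge0 t) h1)).
by rewrite mulrC -ler_pdivlMr// ltW.
Qed.

Lemma sum_rbump c x t : \sum_i phi i (rbump x c t i) =
  \sum_i phi i (x i) + (phi c (x c + t) - phi c (x c)).
Proof.
rewrite (bigD1 c)//= [X in _ = X + _](bigD1 c)//= {1}/rbump eqxx.
rewrite (eq_bigr (fun i => phi i (x i))) => [|i ic]; last by rewrite /rbump (negbTE ic).
by move: (\sum_(i | i != c) phi i (x i)) => S; ring.
Qed.

Lemma Pf_deriv x c : xdom x -> is_derive (0 : R) (1 : R) (fun t => Pf (rbump x c t)) (Gf c x).
Proof.
move=> Hx; have [_ D1] := HD_real c Hx.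
have -> : Gf c x = reC (HDf c (rl x)) - (omv (cj c) + beta c * x c).
  by rewrite /Gf; move: (reC _) => r; ring.
apply: is_deriveB; apply: is_derive_eps => e e0.
have [dl dl0 K] := phi_deriv c (x c) e0; exists dl => // t /K.
rewrite !sum_rbump add0r addr0 subrr addr0; move: (\sum_i _) => S.
by rewrite [S + _]addrC addrK.
Qed.

Lemma xdom_box y y' z : xdom y -> xdom y' ->
  (forall i, exists2 s : R, 0 <= s <= 1 & z i = y i + s * (y' i - y i)) -> xdom z.
Proof.
move=> Hy Hy' H c ac; have [s /andP[s0 s1] ->] := H c.
have -> : y c + s * (y' c - y c) = (1 - s) * y c + s * y' c by ring.
apply: (le_trans (ler_normD _ _)); rewrite !normrM (ger0_norm s0) (@ger0_norm _ (1 - s)) ?subr_ge0//.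
have -> : wt eps c = (1 - s) * wt eps c + s * wt eps c by ring.
apply: lerD; apply: ler_wpM2l; rewrite ?subr_ge0//; [exact: Hy|exact: Hy'].
Qed.

Lemma Pf_taylor y y' d : xdom y -> xdom y' -> 0 <= d ->
  (forall i, `|y' i - y i| <= d * wt eps i) ->
  `|Pf y' - Pf y - \sum_c Gf c y * (y' c - y c)| <= (\sum_c eta c * wt eps c) * d ^+ 2.
Proof.
exact: (coordinate_taylor xdom_box (fun y c => @Pf_deriv y c) (fun c y y' d => @Gf_lip c y y' d)).
Qed.

Definition turn x (n : crd -> int) : crd -> R := fun i => x i + 2 * pi * (n i)%:~R.
Definition angles_only (n : crd -> int) : Prop := forall c, ~~ ang c -> n c = 0.

Lemma turn_na x n c : angles_only n -> ~~ ang c -> turn x n c = x c.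
Proof. by move=> H ac; rewrite /turn H// mulr0 addr0. Qed.

Lemma turn_dom x n : angles_only n -> xdom x -> xdom (turn x n).
Proof. by move=> Hn Hx c ac; rewrite turn_na// Hx. Qed.

Lemma emb_turn_shift x n c w : angles_only n ->
  emb J0 (cbump (rl (turn x n)) c w) =
  shift_angle (emb J0 (cbump (rl x) c w)) (rvecC ((2 * pi) *: ivec R (\row_j n (cps j)))).
Proof.
move=> Hn.
have E i : ~~ ang i -> cbump (rl (turn x n)) c w i = cbump (rl x) c w i.
  by move=> ai; rewrite /cbump /rl turn_na.
apply: phase_eq; apply/rowP => j; rewrite /slot1 /slot2 /slot3 /slot4 /= !mxE.
- by rewrite E.
- by rewrite /cbump /rl /turn; case: eqP => _; rewrite !toCD; ring.
- by rewrite !E.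
- by rewrite !E.
Qed.

Lemma emb_turn0 x n : angles_only n -> emb J0 (rl (turn x n)) =
  shift_angle (emb J0 (rl x)) (rvecC ((2 * pi) *: ivec R (\row_j n (cps j)))).
Proof. by move=> Hn; have := @emb_turn_shift x n (ca 0) 0 Hn; rewrite !cbump0. Qed.

Lemma Hm_turn x n : angles_only n -> xdom x -> Hm (emb J0 (rl (turn x n))) = Hm (emb J0 (rl x)).
Proof.
move=> Hn Hx; have P1 := ln_per L (rl_big0 Hx) (\row_j n (cps j)).
by rewrite emb_turn0// /Ham P1.
Qed.

(** The slices through the two points agree near 0 by periodicity of [f] on the domain, so their
    complex derivatives agree by uniqueness. *)
Lemma Ff'_turn c x n : angles_only n -> xdom x -> Ff' J0 f c (rl (turn x n)) = Ff' J0 f c (rl x).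
Proof.
move=> Hn Hx.
have ts0 : 0 < th * se by rewrite mulr_gt0 ?(th_gt0 L) ?(se_gt0 L).
apply: (@cder_unique _ (fun w => Ff J0 f (cbump (rl x) c w)) 0); last first.
  exact: Ff_holo L _ c (rl_big0 Hx).
apply: (cder_local ts0 _ (Ff_holo L c (rl_big0 (turn_dom Hn Hx)))) => w hw.
rewrite add0r /Ff emb_turn_shift//; apply: (ln_per L).
move=> i; apply: (le_trans (y := csize ang i (rl x i) + absC w)).
  rewrite /cbump; case: eqP => _; last by rewrite lerDl absC_ge0.
  by apply: (le_trans (csizeD _ _ _ _)); rewrite lerD2l csize_le.
have := rl_sdom Hx i; have [t0 s0] := (ltW (th_gt0 L), ltW (se_gt0 L)).
have tst : th * se <= th by rewrite ler_piMr// (se_le1 L).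
have qe := qeps_le L q1 qs; have e2 := eps2_le_th L et.
move: (csize _ _ _) (absC w) hw => u v hw; rewrite -/se in qe.
by rewrite /crad -/se; case: ifP => _; [|case: ifP => _] => H; lra.
Qed.

Lemma Gf_turn c x n : angles_only n -> xdom x -> Gf c (turn x n) = Gf c x.
Proof.
move=> Hn Hx; rewrite (Gf_split c Hx) (Gf_split c (turn_dom Hn Hx)).
have Jx : Jof (turn x n) = Jof x.
  by apply/rowP => j; rewrite !mxE turn_na.
have Kx : kep c (turn x n) = kep c x.
  rewrite /kep Jx; case: ifP => // ic; rewrite turn_na//.
  by move: ic; rewrite /isa /ang => /andP[/negbTE -> _].
have na i : ~~ ang i -> rl (turn x n) i = rl x i by move=> ai; rewrite /rl turn_na.
have Ez : forget_angle (emb J0 (rl (turn x n))) = forget_angle (emb J0 (rl x)).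
  by rewrite emb_turn0.
have E1 : slot1 (emb J0 (rl (turn x n))) = slot1 (emb J0 (rl x)) by rewrite emb_turn0.
have eg : Fg' J0 g c (rl (turn x n)) = Fg' J0 g c (rl x) by rewrite /Fg' Ez.
have eo : Fo' J0 Om c (rl (turn x n)) = Fo' J0 Om c (rl x).
  rewrite /Fo'; apply: eq_bigr => j _; rewrite /Fom' /Fom E1.
  have -> : quad j (rl (turn x n)) = quad j (rl x) by rewrite /quad !na.
  by have -> : quad' j c (rl (turn x n)) = quad' j c (rl x) by rewrite /quad' !na.
rewrite /pert' Kx eg eo (Ff'_turn c Hn Hx); reflexivity.
Qed.

Lemma Pf_turn x n : angles_only n -> xdom x -> Pf (turn x n) = Pf x.
Proof.
move=> Hn Hx; rewrite /Pf Hm_turn//; congr (_ - _).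
apply: eq_bigr => c _; case: (boolP (ang c)) => ac; last by rewrite turn_na.
have b0 : beta c = 0 by apply/eqP; rewrite -[_ == _]negbK beta_neq0 ac.
rewrite /phi b0 !mul0r /omv (_ : ang (cj c) = false) ?mul0r//.
by move: ac; rewrite /ang /cj /= => /andP[-> _].
Qed.

Variables (T c1 : R) (kk : 'I_2 -> int).
Hypothesis T0 : 0 < T.
Hypothesis kkT : forall j, freq0 J0 ka j * T = 2 * pi * (kk j)%:~R.
Hypothesis Teps : c1 * (eps * T) <= 1.
Hypothesis c1_G : 8 * Gconst <= c1.
Hypothesis c1_twist : 4 * (twist_max lmin + Gconst) <= c1.
Hypothesis c1_B : 8 * (B + Gconst) <= c1.
Hypothesis se_twist : 4 * Gconst * se <= twist_min kmin lmax.
Hypothesis se_chi : 4 * Gconst * se <= chi.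

(** For actions and elliptic coordinates the mean term gains a factor [se], small with [eps], and
    the oscillation a factor [eps * T], small with [1 / c1]; each takes a quarter of the weight. For
    angles division by [beta c = 0] gives 0, and the oscillation takes the whole half. *)
Lemma eta_small c : eta c / `|beta c| + 2 * T * kap beta (wt eps) eta (cj c) <= wt eps c / 2.
Proof.
have e0 := eps_gt0 L; have s0 := se_gt0 L; have G0 : 0 <= Gconst.
  by rewrite addr_ge0 ?lip_freq_ge0// mulr_ge0 ?pconst_ge0.
have b0 := B_ge0; have t0 := ltW T0; have s1 := se_le1 L.
have tm0 : 0 <= twist_max lmin.
  by rewrite /twist_max; nonneg.
have ET0 : 0 <= eps * T by rewrite mulr_ge0 ?(ltW e0).
have cG : 8 * Gconst * (eps * T) <= 1 := le_trans (ler_wpM2r ET0 c1_G) Teps.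
have cT : 4 * (twist_max lmin + Gconst) * (eps * T) <= 1 := le_trans (ler_wpM2r ET0 c1_twist) Teps.
have cB : 8 * (B + Gconst) * (eps * T) <= 1 := le_trans (ler_wpM2r ET0 c1_B) Teps.
have tmin j : twist_min kmin lmax <= `|twist J0 ka j| by exact: twist_ge kmin0 ka_bd lmin0 J0_bd j.
have tmax j : `|twist J0 ka j| <= twist_max lmin by exact: twist_le kmin0 ka_bd lmin0 J0_bd j.
have tm : 0 < twist_min kmin lmax := twist_min_gt0 kmin0 lmin0 J0_bd.
have o1 := omr_le; have o2 := omr_ge; have ch := ln_chi L.
rewrite /kap /eta; move: (Gconst) G0 cG cT cB se_twist se_chi => C G0 cG cT cB st sc.
move: c; apply: crd_cases => j; rewrite /beta /cj /ebd /wt /crad; cbn [fst snd negb andb ca cps cv cu].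
- rewrite normr0 mul0r add0r.
  have tj := lt_le_trans tm (tmin j).
  have H1 : C * (eps ^+ 3 * se) / `|twist J0 ka j| <= eps ^+ 3 / 4.
    rewrite ler_pdivrMr//.
    have -> : C * (eps ^+ 3 * se) = eps ^+ 3 / 4 * (4 * C * se) by field.
    by rewrite ler_wpM2l ?divr_ge0 ?exprn_ge0 ?(ltW e0)//; exact: le_trans st (tmin j).
  have H2 : 2 * T * (C * eps ^+ 4) <= eps ^+ 3 / 4.
    have -> : 2 * T * (C * eps ^+ 4) = eps ^+ 3 / 4 * (8 * C * (eps * T)) by field.
    by rewrite ler_piMr ?divr_ge0 ?exprn_ge0 ?(ltW e0).
  by apply: (le_trans (lerD H1 H2)); rewrite -mulrDr; apply: ler_wpM2l; [rewrite exprn_ge0 ?(ltW e0)|lra].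
- rewrite normr0 invr0 mulr0 add0r.
  have H2 : `|twist J0 ka j| * eps ^+ 3 + C * (eps ^+ 3 * se) <= (twist_max lmin + C) * eps ^+ 3.
    rewrite mulrDl; apply: lerD; first by rewrite ler_wpM2r ?exprn_ge0 ?(ltW e0).
    by rewrite ler_wpM2l// ler_piMr ?exprn_ge0 ?(ltW e0).
  have t20 : 0 <= 2 * T by rewrite mulr_ge0.
  apply: (le_trans (ler_wpM2l t20 H2)).
  have -> : 2 * T * ((twist_max lmin + C) * eps ^+ 3) =
    eps ^+ 2 / 2 * (4 * (twist_max lmin + C) * (eps * T)) by field.
  by rewrite ler_piMr ?divr_ge0 ?exprn_ge0 ?(ltW e0).
all: have oj : 0 < omr j := lt_le_trans ch (o2 j).
all: rewrite gtr0_norm ?mulr_gt0//.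
all: have H1 : C * (eps ^+ 3 * se) / (eps * omr j) <= eps ^+ 2 / 4 by
  rewrite ler_pdivrMr ?mulr_gt0//;
  rewrite (_ : C * (eps ^+ 3 * se) = eps ^+ 3 / 4 * (4 * C * se)); [|by field];
  rewrite (_ : eps ^+ 2 / 4 * (eps * omr j) = eps ^+ 3 / 4 * omr j); [|by field];
  rewrite ler_wpM2l ?divr_ge0 ?exprn_ge0 ?(ltW e0)//; exact: le_trans sc (o2 j).
all: have H2 : eps * omr j * eps ^+ 2 + C * (eps ^+ 3 * se) <= (B + C) * eps ^+ 3 by
  rewrite mulrDl; apply: lerD;
  [rewrite (_ : eps * omr j * eps ^+ 2 = omr j * eps ^+ 3);
    [by rewrite ler_wpM2r ?exprn_ge0 ?(ltW e0)|by ring]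
  |by rewrite ler_wpM2l// ler_piMr ?exprn_ge0 ?(ltW e0)].
all: have H3 : 2 * T * (eps * omr j * eps ^+ 2 + C * (eps ^+ 3 * se)) <= eps ^+ 2 / 4 by
  apply: (@le_trans _ _ (2 * T * ((B + C) * eps ^+ 3)));
  [apply: ler_wpM2l => //; rewrite mulr_ge0
  |rewrite (_ : 2 * T * ((B + C) * eps ^+ 3) = eps ^+ 2 / 4 * (8 * (B + C) * (eps * T)));
    [by rewrite ler_piMr ?divr_ge0 ?exprn_ge0 ?(ltW e0)|by field]].
all: by apply: (le_trans (lerD H1 H3)); rewrite -mulrDr; apply: ler_wpM2l;
  [rewrite exprn_ge0 ?(ltW e0)|lra].
Qed.

Definition kwt (c : crd) : int := if ang c then kk c.2.2 else 0.
Local Notation w := (wt eps).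

Lemma adom_xdom y : adom beta w y <-> xdom y.
Proof. by split=> H c; move: (H c); rewrite beta_neq0. Qed.

Lemma angles_onlyP n : angle_shift beta n <-> angles_only n.
Proof. by split=> H c; move: (H c); rewrite beta_neq0. Qed.

Lemma omv_cj c : beta c != 0 -> omv c = 0.
Proof. by rewrite beta_neq0 /omv => /negbTE ->. Qed.

Lemma exists_motions : exists x : (crd -> R) -> crd * R -> R,
  (forall ps, base beta ps -> loops T beta w eta (x ps)) /\
  exists ps1 ps2, [/\ base beta ps1, base beta ps2, moves beta omv Gf x ps1, moves beta omv Gf x ps2 &
  (forall ps, base beta ps -> moves beta omv Gf x ps) \/
  ~ exists tau, forall t, exists2 n, angle_shift beta n & forall c,
    Xt omv ps2 (x ps2) t c = Xt omv ps1 (x ps1) (t + tau) c + 2 * pi * (n c)%:~R].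
Proof.
apply: (@two_periodic_solutions R dof T beta omv w eta kwt Gf Pf (\sum_c eta c * w c)) => //.
- exact: wt_gt0.
- exact: eta_ge0.
- by move=> [b j]; rewrite beta_neq0.
- exact: omv_cj.
- by move=> c; rewrite /omv /kwt; case: ifP => // _; rewrite mulr0 mul0r.
- by move=> c y /adom_xdom; exact: Gf_bd.
- by move=> c y y' d /adom_xdom Hy /adom_xdom Hy'; exact: Gf_lip.
- by move=> c y n /adom_xdom Hy /angles_onlyP Hn; exact: Gf_turn.
- by move=> y n /adom_xdom Hy /angles_onlyP Hn; exact: Pf_turn.
- by move=> y y' d /adom_xdom Hy /adom_xdom Hy'; exact: Pf_taylor.
- by apply: sumr_ge0 => c _; rewrite mulr_ge0 ?eta_ge0// ltW ?wt_gt0.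
- exact: eta_small.
Qed.

Definition state_of (X : crd -> R) : state R :=
  (Jof X, \row_j X (cps j), \row_j (isq2 * (toC (X (cv j)) + 'i * toC (X (cu j))))).

Lemma conj_uv (a b : R) : (isq2 * (toC a + 'i * toC b))^* = isq2 * (toC a - 'i * toC b) :> Cx R.
Proof. by apply/eqP; rewrite eq_complex /=; apply/andP; split; apply/eqP; ring. Qed.

Lemma stateC_of X : stateC (state_of X) = emb J0 (rl X).
Proof.
have nc i : rl X (cv i) = toC (X (cv i)) /\ rl X (cu i) = toC (X (cu i)).
  by rewrite /rl /ctr /isa /= !addr0.
apply: phase_eq; rewrite /stateC /nf_point /mkphase.
- by rewrite slot1_rl.
- by apply/rowP => j; rewrite /slot2 /= !mxE /rl /ctr /isa /= addr0.
- by apply/rowP => j; have [e1 e2] := nc j; rewrite /slot3 /= !mxE e1 e2.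
- by apply/rowP => j; have [e1 e2] := nc j; rewrite /slot4 /= !mxE e1 e2 conj_uv.
Qed.

Lemma same_state_turn X X' n : angles_only n -> (forall c, X c = X' c + 2 * pi * (n c)%:~R) ->
  same_state (state_of X) (state_of X').
Proof.
move=> Hn H; have na c : ~~ ang c -> X c = X' c by move=> ac; rewrite H Hn// mulr0 addr0.
split.
- by apply/rowP => j; rewrite !mxE na.
- exists (\row_j n (cps j)); apply/rowP => j; by rewrite !mxE H.
- by apply/rowP => j; rewrite !mxE !na.
Qed.

Lemma same_stateP X X' : same_state (state_of X) (state_of X') ->
  exists2 n, angles_only n & forall c, X c = X' c + 2 * pi * (n c)%:~R.
Proof.
move=> [eJ [n ePsi] eZ].
have s2 : (Num.sqrt 2)^-1 != 0 :> R by rewrite invr_eq0 gt_eqF// sqrtr_gt0.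
exists (fun c => if ang c then n 0 c.2.2 else 0) => [c /negbTE -> //|].
apply: crd_cases => j; rewrite /ang; cbn [fst snd negb andb cj ca cps cv cu]; rewrite ?mulr0 ?addr0.
- have := congr1 (fun v : 'rV[R]_2 => v 0 j) eJ; rewrite !mxE; exact: addrI.
- by have := congr1 (fun v : 'rV[R]_2 => v 0 j) ePsi; rewrite !mxE.
- have := congr1 (fun v : 'rV[Cx R]_2 => reC (v 0 j)) eZ.
  rewrite !mxE /= => H; apply: (mulfI s2); move: H; lra.
- have := congr1 (fun v : 'rV[Cx R]_2 => imC (v 0 j)) eZ.
  rewrite !mxE /= => H; apply: (mulfI s2); move: H; lra.
Qed.

(** * From loops to periodic orbits of the normal form *)

Section Orbits.
Variable x : (crd -> R) -> crd * R -> R.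
Hypothesis x_loops : forall ps, base beta ps -> loops T beta w eta (x ps).

Definition zeta ps (t : R) : state R := state_of (Xt omv ps (x ps) t).

Lemma base_na ps c : base beta ps -> ~~ ang c -> ps c = 0.
Proof. by move=> H ac; apply: H; rewrite beta_neq0. Qed.

Lemma Xt_na ps t c : base beta ps -> ~~ ang c -> Xt omv ps (x ps) t c = x ps (c, t).
Proof.
by move=> H ac; rewrite /Xt (base_na H ac) omv_cj ?beta_neq0// mul0r !add0r.
Qed.

Lemma x_le ps t c : base beta ps -> `|x ps (c, t)| <= w c.
Proof. by move=> /x_loops /(_ c)[_ + _]; exact. Qed.

Lemma Xt_dom ps t : base beta ps -> xdom (Xt omv ps (x ps) t).
Proof. by move=> H c ac; rewrite Xt_na//; exact: x_le. Qed.

Lemma zeta_periodic ps : base beta ps -> periodic_traj T (zeta ps).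
Proof.
move=> H t; apply: (@same_state_turn _ _ kwt) => [c /negbTE|c]; first by rewrite /kwt => ->.
have [per _ _] := x_loops H c; rewrite /Xt per mulrDr.
have -> : omv c * T = 2 * pi * (kwt c)%:~R.
  by rewrite /omv /kwt; case: ifP => // _; rewrite mulr0 mul0r.
ring.
Qed.

Lemma Xt_deriv ps t c : base beta ps -> moves beta omv Gf x ps ->
  is_derive t (1 : R) (fun s => Xt omv ps (x ps) s c)
    (sg c * reC (HDf (cj c) (rl (Xt omv ps (x ps) t)))).
Proof.
move=> H /(_ c t) M.
have E : sg c * reC (HDf (cj c) (rl (Xt omv ps (x ps) t))) =
    omv c + sg c * Fv beta omv Gf ps (x ps) (cj c) t.
  rewrite /Fv /Gf cjK; move: (reC _) => r.
  case: (boolP (ang (cj c))) => ac.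
    have -> : beta (cj c) = 0 by apply/eqP; rewrite -[_ == _]negbK beta_neq0 ac.
    have -> : omv c = 0 by rewrite /omv (_ : ang c = false)//; move: ac; rewrite /ang /cj; case: c.1.
    by rewrite !mul0r add0r !subr0 add0r.
  rewrite Xt_na//; case: (boolP (ang c)) => ac'.
    have -> : sg c = 1 :> R by move: ac'; rewrite /ang /sg; case: c.1.
    by ring.
  by rewrite omv_cj ?beta_neq0//; ring.
rewrite E; apply: is_deriveD => //.
apply: is_derive_eps => e e0; exists 1 => // s _.
by rewrite (_ : _ - _ = 0) ?normr0 ?mulr_ge0 ?(ltW e0)//; ring.
Qed.

Lemma is_derive_scale (F : R -> R) (t d a : R) : is_derive t (1 : R) F d ->
  is_derive t (1 : R) (fun s => a * F s) (a * d).
Proof. by move=> H; apply: is_deriveZ. Qed.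

Lemma is_derive_shiftc (F : R -> R) (t d a : R) : is_derive t (1 : R) F d ->
  is_derive t (1 : R) (fun s => a + F s) d.
Proof.
move=> H; rewrite -[d]add0r; apply: is_deriveD.
Qed.

Lemma is_derive_0 (t a : R) : is_derive t (1 : R) (fun=> a) 0.
Proof. exact: is_derive_cst. Qed.

Lemma slot3_val X j : slot3 (emb J0 (rl X)) 0 j = isq2 * (toC (X (cv j)) + 'i * toC (X (cu j))).
Proof. by rewrite /slot3 /= !mxE /rl /ctr /isa /= !addr0. Qed.
Lemma slot4_val X j : slot4 (emb J0 (rl X)) 0 j = isq2 * (toC (X (cv j)) - 'i * toC (X (cu j))).
Proof. by rewrite /slot4 /= !mxE /rl /ctr /isa /= !addr0. Qed.

Lemma re_im_uv (a b : R) : let r := (Num.sqrt 2)^-1 in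
  [/\ reC (isq2 * (toC a + 'i * toC b)) = r * a, imC (isq2 * (toC a + 'i * toC b)) = r * b,
      reC (isq2 * (toC a - 'i * toC b)) = r * a & imC (isq2 * (toC a - 'i * toC b)) = - r * b].
Proof. by split=> /=; ring. Qed.

Lemma field_z (p s : R) : let r := (Num.sqrt 2)^-1 in
  [/\ reC ('i * (isq2 * toC p + isq2 * 'i * toC s)) = r * - s,
      imC ('i * (isq2 * toC p + isq2 * 'i * toC s)) = r * p,
      reC (- ('i * (isq2 * toC p - isq2 * 'i * toC s))) = r * - s
    & imC (- ('i * (isq2 * toC p - isq2 * 'i * toC s))) = - r * p].
Proof. by split=> /=; ring. Qed.

Lemma is_derive_congr (F G : R -> R) (t d d' : R) : (forall s, F s = G s) -> d = d' ->
  is_derive t (1 : R) G d' -> is_derive t (1 : R) F d.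
Proof. by move=> /funext -> ->. Qed.

Lemma real_gradient : exists F : crd -> (crd -> R) -> R,
  (forall X j, xdom X ->
    [/\ 'D_(dir1 _ j) Hm (emb J0 (rl X)) = toC (F (ca j) X),
        'D_(dir2 _ j) Hm (emb J0 (rl X)) = toC (F (cps j) X),
        'D_(dir3 _ j) Hm (emb J0 (rl X)) = isq2 * toC (F (cv j) X) - isq2 * 'i * toC (F (cu j) X)
      & 'D_(dir4 _ j) Hm (emb J0 (rl X)) = isq2 * toC (F (cv j) X) + isq2 * 'i * toC (F (cu j) X)]) /\
  forall ps t c, base beta ps -> moves beta omv Gf x ps ->
    is_derive t (1 : R) (fun s => Xt omv ps (x ps) s c) (sg c * F (cj c) (Xt omv ps (x ps) t)).
Proof.
exists (fun c X => reC (HDf c (rl X))); split=> [X j HX|]; last exact: Xt_deriv.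
have bg := rl_big0 HX.
have Rl c : HDf c (rl X) = toC (reC (HDf c (rl X))) by apply: toC_re; have [] := HD_real c HX.
split.
- by rewrite -Rl -(Ham_dir L (ca j) bg).
- by rewrite -Rl -(Ham_dir L (cps j) bg).
- by rewrite (Ham_dir3 L j bg); congr (isq2 * _ - isq2 * 'i * _); [exact: (Rl (cv j))|exact: (Rl (cu j))].
- by rewrite (Ham_dir4 L j bg); congr (isq2 * _ + isq2 * 'i * _); [exact: (Rl (cv j))|exact: (Rl (cu j))].
Qed.

Lemma zeta_solution (D : set (phase (Cx R))) ps : base beta ps -> moves beta omv Gf x ps ->
  (forall X, xdom X -> D (emb J0 (rl X))) -> solution D Hm (zeta ps).
Proof.
move=> H M HDm t; rewrite /zeta; have XD := Xt_dom t H.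
split=> [|j]; first by rewrite stateC_of; exact: HDm.
have [F [/(_ _ j XD)[d1 d2 d3 d4] M']] := real_gradient.
rewrite /has_derivC !stateC_of d1 d2 d3 d4 {d1 d2 d3 d4}.
move: (M' ps t (ca j) H M) (M' ps t (cps j) H M) (M' ps t (cv j) H M) (M' ps t (cu j) H M).
rewrite /sg; cbn [cj ca cps cv cu fst snd negb].
move: (F _ _) (F _ _) (F _ _) (F _ _) => Hv Hu Ha Hp Da Dp Dv Du.
rewrite mulN1r in Da; rewrite mul1r in Dp; rewrite mulN1r in Dv; rewrite mul1r in Du.
have [f1 f2 f3 f4] := field_z Hv Hu.
have [s1 s2] : (forall s, slot1 (stateC (state_of (Xt omv ps (x ps) s))) 0 j =
    toC (Jeps 0 j + Xt omv ps (x ps) s (ca j))) /\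
  (forall s, slot2 (stateC (state_of (Xt omv ps (x ps) s))) 0 j = toC (Xt omv ps (x ps) s (cps j))).
  by split=> s; rewrite /slot1 /slot2 /= !mxE.
have s3 s : slot3 (stateC (state_of (Xt omv ps (x ps) s))) 0 j =
  isq2 * (toC (Xt omv ps (x ps) s (cv j)) + 'i * toC (Xt omv ps (x ps) s (cu j))).
  by rewrite stateC_of slot3_val.
have s4 s : slot4 (stateC (state_of (Xt omv ps (x ps) s))) 0 j =
  isq2 * (toC (Xt omv ps (x ps) s (cv j)) - 'i * toC (Xt omv ps (x ps) s (cu j))).
  by rewrite stateC_of slot4_val.
have uv s := re_im_uv (Xt omv ps (x ps) s (cv j)) (Xt omv ps (x ps) s (cu j)).
split; split.
- by apply: (is_derive_congr _ _ (is_derive_shiftc (Jeps 0 j) Da)) => [s|]; [rewrite s1|rewrite -toCN].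
- by apply: (is_derive_congr _ _ (is_derive_0 t 0)) => [s|]; [rewrite s1|rewrite -toCN].
- by apply: (is_derive_congr _ _ Dp) => [s|//]; rewrite s2.
- by apply: (is_derive_congr _ _ (is_derive_0 t 0)) => [s|//]; rewrite s2.
- apply: (is_derive_congr _ _ (is_derive_scale (Num.sqrt 2)^-1 Dv)) => [s|]; last exact: f1.
  by rewrite s3; have [-> _ _ _] := uv s.
- apply: (is_derive_congr _ _ (is_derive_scale (Num.sqrt 2)^-1 Du)) => [s|]; last exact: f2.
  by rewrite s3; have [_ -> _ _] := uv s.
- apply: (is_derive_congr _ _ (is_derive_scale (Num.sqrt 2)^-1 Dv)) => [s|]; last exact: f3.
  by rewrite s4; have [_ _ -> _] := uv s.
- apply: (is_derive_congr _ _ (is_derive_scale (- (Num.sqrt 2)^-1) Du)) => [s|]; last exact: f4.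
  by rewrite s4; have [_ _ _ ->] := uv s.
Qed.

Lemma sum_two (F : 'I_2 -> R) : \sum_j F j = F 0 + F 1.
Proof. by rewrite big_ord_recl big_ord1; congr (_ + F _); exact: val_inj. Qed.

Lemma enorm2_le (v : 'rV[R]_2) a : (forall j, `|v 0 j| <= a) -> enorm v ^+ 2 <= 2 * a ^+ 2.
Proof.
move=> H; rewrite /enorm /dotp sqr_sqrtr ?sumr_ge0// => [|j _]; last by rewrite -expr2 sqr_ge0.
rewrite sum_two; have Hj j : v 0 j * v 0 j <= a ^+ 2.
  by rewrite -expr2 -[v 0 j ^+ 2]real_normK ?num_real// ler_pXn2r ?nnegrE ?(le_trans (normr_ge0 _) (H j)).
by apply: (le_trans (lerD (Hj 0) (Hj 1))); rewrite mulr_natl.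
Qed.

Lemma enormC2_le (v : 'rV[Cx R]_2) a : (forall j, absC (v 0 j) <= a) -> enormC v ^+ 2 <= 2 * a ^+ 2.
Proof.
move=> H; rewrite /enormC sqr_sqrtr ?sumr_ge0// => [|j _]; last exact: sqr_ge0.
rewrite sum_two; have Hj j : absC (v 0 j) ^+ 2 <= a ^+ 2.
  by rewrite ler_pXn2r ?nnegrE ?absC_ge0 ?(le_trans (absC_ge0 _) (H j)).
by apply: (le_trans (lerD (Hj 0) (Hj 1))); rewrite mulr_natl.
Qed.

Lemma state_dist_le (X Y : state R) a b : (forall j, `|(stJ X - stJ Y) 0 j| <= a) ->
  (forall j, `|(stpsi X - stpsi Y) 0 j| <= b) -> (forall j, absC ((stz X - stz Y) 0 j) <= 2 * b) ->
  state_dist X Y <= 4 * (a + b).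
Proof.
move=> /[dup] H1 /enorm2_le h1 /[dup] H2 /enorm2_le h2 /enormC2_le h3.
have a0 : 0 <= a := le_trans (normr_ge0 _) (H1 0).
have b0 : 0 <= b := le_trans (normr_ge0 _) (H2 0).
have s0 : 0 <= 4 * (a + b) by rewrite mulr_ge0 ?addr_ge0.
rewrite /state_dist -(ger0_norm s0) -sqrtr_sqr; apply: ler_wsqrtr.
apply: (le_trans (lerD (lerD h1 h2) h3)).
have -> : (4 * (a + b)) ^+ 2 = 2 * a ^+ 2 + 2 * b ^+ 2 + 2 * (2 * b) ^+ 2 + (14 * a ^+ 2 + 32 * (a * b) + 6 * b ^+ 2) by ring.
by rewrite lerDl; nonneg.
Qed.

Lemma zeta_dist ps (J : 'rV[R]_2) r t : base beta ps -> (forall j, `|Jeps 0 j - J 0 j| <= r) ->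
  state_dist (zeta ps t) (quasi_traj J (\row_j ps (cps j)) (\row_j freq0 J0 ka j) t)
    <= 4 * (r + eps ^+ 3 + eps ^+ 2).
Proof.
move=> H HJ; have HX := Xt_dom t H.
apply: state_dist_le => j; rewrite /zeta /state_of /quasi_traj /stJ /stpsi /stz /=.
- rewrite !mxE addrAC; apply: (le_trans (ler_normD _ _)); apply: lerD; first exact: HJ.
  exact: (HX (ca j)).
- rewrite !mxE /Xt /omv /ang /=.
  have -> (a b c d : R) : a + b * c + d - (a + c * b) = d by ring.
  exact: (x_le t (cps j) H).
- rewrite subr0 mxE absCM.
  have v := HX (cv j) isT; have u := HX (cu j) isT.
  have -> : 2 * eps ^+ 2 = 1 * (eps ^+ 2 + eps ^+ 2) by ring.
  apply: ler_pM; rewrite ?absC_ge0 ?isq2_abs//.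
  apply: (le_trans (absCD _ _)); apply: lerD; first by rewrite absC_toC.
  rewrite absCM absC_toC (_ : absC ('i : Cx R) = 1) ?mul1r//.
  by rewrite absCE /= expr0n/= add0r expr1n sqrtr1.
Qed.

Hypothesis c1_l : (lmin^-1) ^+ 3 <= c1.
Hypothesis e1 : eps <= 1.

(** Frequencies are at most [lmin^-1 ^ 3 <= c1], so [2 * pi * |kk j| * eps <= c1 * eps * T <= 1].
    The winding numbers, which amplify the deviation [eps ^ 2] of the angles below, are thus
    [O(1 / eps)]. *)
Lemma kk_le j : `|(kk j)%:~R : R| * eps <= 1 / 4.
Proof.
have e0 := ltW (eps_gt0 L); have p2 := pi_ge2 R; have p0 : 0 < pi := pi_gt0 R.
have lj : `|freq0 J0 ka j| <= lmin^-1 ^+ 3.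
  have [/andP[k0 k1] /andP[l1 _]] := (ka_bd j, J0_bd j).
  have J0p := J0_gt0 lmin0 J0_bd j.
  rewrite /freq0 normrM normrX normfV (gtr0_norm J0p) ger0_norm ?(le_trans (ltW kmin0))//.
  rewrite -[leRHS]mul1r; apply: ler_pM; rewrite ?exprn_ge0 ?invr_ge0 ?(ltW J0p) ?(le_trans (ltW kmin0))//.
  by rewrite ler_pXn2r ?nnegrE ?invr_ge0 ?(ltW lmin0) ?(ltW J0p)// lef_pV2 ?posrE.
have E : `|freq0 J0 ka j| * T = 2 * pi * `|(kk j)%:~R : R|.
  have := congr1 Num.norm (kkT j); rewrite !normrM (gtr0_norm T0) (gtr0_norm p0).
  by rewrite (ger0_norm (ler0n _ 2)).
have H1 : 2 * pi * `|(kk j)%:~R : R| * eps <= 1.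
  apply: le_trans Teps; rewrite -E -mulrA [T * eps]mulrC; apply: ler_wpM2r; last exact: le_trans lj c1_l.
  by rewrite mulr_ge0 ?(ltW T0).
have k0 : 0 <= `|(kk j)%:~R : R| * eps by rewrite mulr_ge0.
have H2 : 4 * (`|(kk j)%:~R : R| * eps) <= 1.
  apply: le_trans H1; rewrite -[2 * pi * _ * eps]mulrA; apply: ler_wpM2r => //; lra.
lra.
Qed.

(** Lines of direction [omega] on the torus are told apart by the determinant of [kk] with the
    phase, modulo [2 * pi]. Bezout coefficients give a phase where it equals [pi], as far as
    possible from its value 0 at phase 0, and the deviations of orbits from straight lines cannot
    bridge this gap. *)
Lemma distinct_of_all : gcdz (kk 0) (kk 1) = 1 -> (forall ps, base beta ps -> moves beta omv Gf x ps) ->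
  exists ps1 ps2, [/\ base beta ps1, base beta ps2 & geom_distinct (zeta ps1) (zeta ps2)].
Proof.
move=> gk _; have [u [v uv]] := Bezoutz (kk 0) (kk 1); rewrite gk in uv.
pose ps (c : crd) : R := if ang c then pi * (if c.2.2 == 0 then - v else u)%:~R else 0.
have b0 : base beta (fun=> 0) by [].
have bp : base beta ps by move=> c; rewrite beta_neq0 /ps => /negbTE ->.
exists (fun=> 0), ps; split=> // -[tau /(_ 0) /same_stateP[n _ E]].
have p2 := pi_ge2 R; have e0 := ltW (eps_gt0 L).
have d_le j : `|x ps (cps j, 0) - x (fun=> 0) (cps j, 0 + tau)| <= 2 * eps ^+ 2.
  have A := x_le 0 (cps j) bp; have A' := x_le (0 + tau) (cps j) b0.
  by apply: (le_trans (ler_normB _ _)); rewrite mulr_natl; exact: lerD A A'.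
have [p0 p1] : ps (cps 0) = pi * (- v)%:~R /\ ps (cps 1) = pi * u%:~R by [].
have := (E (cps 0), E (cps 1)); rewrite /Xt p0 p1 [omv (cps 0)]/omv [omv (cps 1)]/omv [ang _]/= [ang _]/=.
case; move: (d_le 0) (d_le 1); rewrite !add0r mulr0 addr0 mulr0 addr0.
move: (x ps (cps 0, 0)) (x ps (cps 1, 0)) (x (fun=> 0) (cps 0, tau)) (x (fun=> 0) (cps 1, tau))
  (n (cps 0)) (n (cps 1)) => y0 y1 x0 x1 n0 n1 D0 D1 E0 E1.
have [K0 K1] := (kk_le 0, kk_le 1); have [F0 F1] := (kkT 0, kkT 1).
have uvR : (kk 0)%:~R * u%:~R + (kk 1)%:~R * v%:~R = 1 :> R.
  have := congr1 (fun z : int => z%:~R : R) uv; rewrite intrD !intrM => H.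
  by rewrite mulrC [_ * v%:~R]mulrC H.
have := odd_norm_ge1 R (kk 0 * n1 - kk 1 * n0); rewrite intrB !intrM => Nge.
rewrite intrN mulrN in E0.
move: (kk 0)%:~R (kk 1)%:~R u%:~R v%:~R n0%:~R n1%:~R K0 K1 F0 F1 uvR Nge E0 E1 => a0 a1 U V N0 N1.
move: (freq0 J0 ka 0) (freq0 J0 ka 1) => f0 f1 K0 K1 F0 F1 uvR Nge E0 E1.
have ff : a0 * f1 = a1 * f0.
  apply: (mulIf (lt0r_neq0 T0)); rewrite -!mulrA F0 F1; ring.
have C : pi * (1 - 2 * (a0 * N1 - a1 * N0)) = a1 * (y0 - x0) - a0 * (y1 - x1).
  have : a0 * (pi * U + y1) - a1 * (- (pi * V) + y0) =
     a0 * (f1 * tau + x1 + 2 * pi * N1) - a1 * (f0 * tau + x0 + 2 * pi * N0) by rewrite E0 E1.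
  have : pi * (a0 * U + a1 * V) = pi by rewrite uvR mulr1.
  have : a0 * f1 * tau = a1 * f0 * tau by rewrite ff.
  move=> h1 h2 h3; lra.
have p0' : 0 < pi := pi_gt0 R.
have : pi <= `|a1 * (y0 - x0) - a0 * (y1 - x1)|.
  by rewrite -C normrM gtr0_norm// ler_peMr// ltW.
(* Two such terms add up to at most 1, whereas [pi >= 2]. *)
have b (a y : R) : `|a| * eps <= 1 / 4 -> `|y| <= 2 * eps ^+ 2 -> `|a * y| <= 1 / 2.
  move=> ha hy; rewrite normrM; apply: (le_trans (ler_wpM2l (normr_ge0 a) hy)).
  have -> : `|a| * (2 * eps ^+ 2) = 2 * eps * (`|a| * eps) by ring.
  apply: (@le_trans _ _ (2 * (1 / 4))); last by lra.
  apply: ler_pM => //; [by rewrite mulr_ge0|by rewrite mulr_ge0|].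
  by rewrite -[leRHS]mulr1; apply: ler_wpM2l.
move=> pl; have := le_trans pl (le_trans (ler_normB _ _) (lerD (b _ _ K1 D0) (b _ _ K0 D1))).
by move=> /(le_trans p2); lra.
Qed.
End Orbits.

(** The contraction only matches real parts of the gradient; this turns its solution into one of the
    complex equation for [Jeps]. *)
Lemma gradient_real (J : 'rV[R]_2) j : nearJ0 J0 (q * eps) J ->
  'D_(unit_vec (Cx R) j) h (rvecC J) = toC (gh h j J).
Proof.
move=> HJ; apply: toC_re.
pose y0 (t : R) (c : crd) : R := (if isa c then J 0 c.2.2 - J0 0 c.2.2 else 0) + (if c == ca j then t else 0).
have [t0 s0] := (ltW (th_gt0 L), ltW (se_gt0 L)).
have ts0 : 0 <= th * se by exact: mulr_ge0.
have qe := qeps_le L q1 qs; rewrite -/se in qe.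
have yE t : (fun c => toC (y0 t c)) = cbump (yof J0 J) (ca j) (toC t).
  apply/funext => c; rewrite /y0 /cbump /yof toCD; case: eqP => _; case: ifP => _;
    by rewrite ?toC0 ?addr0.
have yb t : `|t| <= th * se -> pdom ang big (fun c => toC (y0 t c)).
  move=> ht c; rewrite csize_toC /big; case: ifP => ac.
    by rewrite /crad; case: ifP => _; [|case: ifP => _]; rewrite mulr_ge0.
  move: ac; move: c; apply: crd_cases => i; rewrite /ang /y0 /isa /crad; cbn [fst snd negb andb ca cps cv cu] => // _.
  - apply: (le_trans (ler_normD _ _)).
    have h1 : `|(if (false, (false, i)) == (false, (false, j)) then t else 0)| <= th * se.
      by case: ifP => _; rewrite ?normr0.
    have h2 := HJ i; lra.
  - by rewrite xpair_eqE /= add0r normr0 mulr_ge0.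
  - by rewrite xpair_eqE /= add0r normr0 mulr_ge0.
have b0 : pdom ang big (yof J0 J).
  by have := yb 0; rewrite normr0 yE toC0 cbump0; apply.
have [dh _ _ _ _] := ln_act L b0; rewrite slot1_yof in dh.
have ts1 : 0 < th * se by rewrite mulr_gt0 ?(th_gt0 L) ?(se_gt0 L).
have Dh : cder (fun w => h (slot1 (emb J0 (cbump (yof J0 J) (ca j) w)))) 0
    ('D_(unit_vec (Cx R) j) h (rvecC J)).
  apply: cder_ext (derive_cder_diff (unit_vec (Cx R) j) dh) => w.
  by rewrite emb_cbump -(slot1_yof J0 J).
have [] // := cder_real ts1 _ Dh => t ht.
have [hr _ _ _] := ln_real L (yb t (ltW ht)).
by move: hr; rewrite yE.
Qed.

Theorem two_distinct_orbits (D : set (phase (Cx R))) :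
  lmin^-1 ^+ 3 <= c1 -> gcdz (kk 0) (kk 1) = 1 -> (forall X, xdom X -> D (emb J0 (rl X))) ->
  exists (psi_p psi_m : 'rV[R]_2) (zeta_p zeta_m : R -> state R),
  [/\ solution D Hm zeta_p /\ solution D Hm zeta_m, periodic_traj T zeta_p /\ periodic_traj T zeta_m,
      geom_distinct zeta_p zeta_m
    & forall (J : 'rV[R]_2) r t, (forall j, `|Jeps 0 j - J 0 j| <= r) ->
      state_dist (zeta_p t) (quasi_traj J psi_p (\row_j freq0 J0 ka j) t) <= 4 * (r + eps ^+ 3 + eps ^+ 2) /\
      state_dist (zeta_m t) (quasi_traj J psi_m (\row_j freq0 J0 ka j) t) <= 4 * (r + eps ^+ 3 + eps ^+ 2)].
Proof.
move=> c1l gk HD; have [x [xl [ps1 [ps2 [b1 b2 m1 m2 alt]]]]] := exists_motions.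
have fin p1 p2 : base beta p1 -> base beta p2 -> moves beta omv Gf x p1 -> moves beta omv Gf x p2 ->
    geom_distinct (zeta x p1) (zeta x p2) ->
  exists (psi_p psi_m : 'rV[R]_2) (zeta_p zeta_m : R -> state R),
  [/\ solution D Hm zeta_p /\ solution D Hm zeta_m, periodic_traj T zeta_p /\ periodic_traj T zeta_m,
      geom_distinct zeta_p zeta_m
    & forall (J : 'rV[R]_2) r t, (forall j, `|Jeps 0 j - J 0 j| <= r) ->
      state_dist (zeta_p t) (quasi_traj J psi_p (\row_j freq0 J0 ka j) t) <= 4 * (r + eps ^+ 3 + eps ^+ 2) /\
      state_dist (zeta_m t) (quasi_traj J psi_m (\row_j freq0 J0 ka j) t) <= 4 * (r + eps ^+ 3 + eps ^+ 2)].
  move=> B1 B2 M1 M2 gd.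
  exists (\row_j p1 (cps j)), (\row_j p2 (cps j)), (zeta x p1), (zeta x p2); split.
  - by split; exact: zeta_solution.
  - by split; exact: zeta_periodic.
  - exact: gd.
  - by move=> J r t HJ; split; exact: zeta_dist.
case: alt => [all|nex]; last first.
  apply: (fin ps1 ps2) => // -[tau H]; apply: nex; exists tau => t.
  by have [n Hn E] := same_stateP (H t); exists n; [exact/angles_onlyP|exact: E].
have [p1 [p2 [B1 B2 gd]]] := distinct_of_all xl c1l (eps_le1 L) gk all.
by apply: (fin p1 p2) => //; exact: all.
Qed.
End RealField.

(** * From the three-body normal form to local bounds *)

Section NormBounds.
Context {R : realType}.

Lemma absC_enormC (v : 'rV[Cx R]_2) j : absC (v 0 j) <= enormC v.
Proof.
rewrite /enormC -[leLHS]ger0_norm ?absC_ge0// -sqrtr_sqr ler_wsqrtr//.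
by rewrite (bigD1 j)//= lerDl sumr_ge0// => i _; exact: sqr_ge0.
Qed.

Lemma enormC_rvecC (v : 'rV[R]_2) : enormC (rvecC v) = enorm v.
Proof.
rewrite /enormC /enorm /dotp; congr Num.sqrt; apply: eq_bigr => j _.
by rewrite mxE absC_toC real_normK ?num_real// expr2.
Qed.

Lemma norm_enorm (v : 'rV[R]_2) j : `|v 0 j| <= enorm v.
Proof. by rewrite -enormC_rvecC; have := absC_enormC (rvecC v) j; rewrite mxE absC_toC. Qed.

Lemma enorm_le (v : 'rV[R]_2) a : (forall j, `|v 0 j| <= a) -> enorm v <= 2 * a.
Proof. by move=> H; rewrite -enormC_rvecC; apply: enormC_le => j; rewrite mxE absC_toC. Qed.

Lemma sqrt_sum_le (a b : R) : 0 <= a -> 0 <= b -> Num.sqrt (a ^+ 2 + b ^+ 2) <= a + b.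
Proof.
move=> a0 b0; rewrite -[leRHS]ger0_norm ?addr_ge0// -sqrtr_sqr ler_wsqrtr//.
have -> : (a + b) ^+ 2 = a ^+ 2 + b ^+ 2 + 2 * (a * b) by ring.
by rewrite lerDl !mulr_ge0.
Qed.
End NormBounds.

Section NormalFormBounds.
Context {R : realType}.
Variables (c : constants R) (eps : R) (S : system R) (J0 : 'rV[R]_2) (th B : R).
Hypothesis hc : constants_ok c.
Hypothesis hS : three_body_normal_form c eps S.
Hypothesis e0 : 0 < eps.
Hypothesis e1 : eps <= 1.
Hypothesis HJ0 : Uset c eps S J0.
Hypothesis th0 : 0 < th.
Hypothesis th1 : th <= 1.
(** These margins hold the polydiscs with tripled radii: by the crude norm comparisons they extend
    to [6 * th * se] in the actions, [3 * th] in the imaginary parts of the angles and [24 * th] in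
    [(z, w)]. *)
Hypothesis th_r : 10 * th <= r_const c.
Hypothesis th_s : 4 * th <= s_nf c.
Hypothesis th_rho : 30 * th <= rho_nf c.
Hypothesis th_sig : 10 * th <= sigma0 c.
Hypothesis B_bnd : bnd c <= B.
Hypothesis B1 : 1 <= B.

Let se := Num.sqrt eps.
Let big : crd -> R := crad (3 * (th * se)) (3 * th) (3 * th).

Lemma sqrt_eps_gt0 : 0 < se. Proof. by rewrite sqrtr_gt0. Qed.
Lemma sqrt_eps_le1 : se <= 1. Proof. by rewrite -sqrtr1 ler_sqrt. Qed.

Lemma slot1_near y : pdom ang big y -> enormC (slot1 (emb J0 y) - rvecC J0) <= 6 * (th * se).
Proof.
move=> Hy; have -> : 6 * (th * se) = 2 * (3 * (th * se)) by ring.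
apply: enormC_le => j; rewrite /slot1 /= !mxE addrAC subrr add0r.
exact: (Hy (ca j)).
Qed.

Lemma big_act y : pdom ang big y -> cnbhd (Uset c eps S) (r_nf c eps) (slot1 (emb J0 y)).
Proof.
move=> Hy; exists J0 => //; apply: (le_lt_trans (slot1_near Hy)); rewrite /r_nf -/se mulrA.
rewrite ltr_pM2r ?sqrt_eps_gt0//. move: th_r th0 => a b; lra.
Qed.

Lemma big_sig y : pdom ang big y -> cnbhd (calI S) (sigma0 c) (slot1 (emb J0 y)).
Proof.
move=> Hy; exists J0; first by case: HJ0.
apply: (le_lt_trans (slot1_near Hy)).
have : th * se <= th by rewrite ler_piMr ?sqrt_eps_le1// ltW.
move: th_sig th0 => a b d; lra.
Qed.

Lemma big_cball y : pdom ang big y -> cball4 (rho_nf c) (slot3 (emb J0 y)) (slot4 (emb J0 y)).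
Proof.
move=> Hy; rewrite /cball4.
have H j := @emb_z_bound R eps th J0 y (3 * th) j Hy.
have z3 : enormC (slot3 (emb J0 y)) <= 2 * (2 * (3 * th)) by apply: enormC_le => j; case: (H j).
have z4 : enormC (slot4 (emb J0 y)) <= 2 * (2 * (3 * th)) by apply: enormC_le => j; case: (H j).
apply: (le_lt_trans (sqrt_sum_le (sqrtr_ge0 _) (sqrtr_ge0 _))).
by move: z3 z4 th_rho th0; rewrite /enormC => z3 z4 a b; lra.
Qed.

Lemma big_nf_dom y : pdom ang big y -> nf_dom c eps S (emb J0 y).
Proof.
move=> Hy; split; [exact: big_act|move=> j|exact: big_cball].
rewrite /slot2 /= mxE; have := Hy (cps j); rewrite /csize /ang /big /crad /= => H.
by apply: (le_lt_trans H); move: th_s th0 => a b; lra.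
Qed.

Lemma big_nopsi y : pdom ang big y -> cdom_nopsi (Uset c eps S) (r_nf c eps) (rho_nf c)
  (forget_angle (emb J0 y)).
Proof. by move=> Hy; split; [exact: big_act|exact: big_cball]. Qed.

Lemma emb_real (y : crd -> R) : emb J0 (fun a => toC (y a)) =
  nf_point (J0 + \row_j y (ca j)) (\row_j y (cps j))
    (\row_j (isq2 * (toC (y (cv j)) + 'i * toC (y (cu j))))).
Proof.
apply: phase_eq; rewrite /nf_point /mkphase; apply/rowP => j.
- by rewrite /slot1 /= !mxE toCD.
- by rewrite /slot2 /= !mxE.
- by rewrite /slot3 /= !mxE.
- by rewrite /slot4 /= !mxE conj_uv.
Qed.

Lemma normal_form_local : local_nf eps th B (chi0 c) J0 (heps S) (h0S c eps S) (Omt S) (g_nf S) (f_nf S).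
Proof.
have [tb _ nf] := hS; have [_ _ [hk _] _ _] := tb.
have [[hh hO hg hf per] real act low [gb fb]] := nf.
have [_ _ _ [_ ch0 _] _] := hc.
split.
- by rewrite e0.
- by rewrite th0.
- exact: B1.
- exact: ch0.
- move=> y Hy; have Ha := big_act Hy; have [_ gr _ _ Ob] := act _ Ha; split.
  + exact: hh.
  + exact: hk (big_sig Hy).
  + by move=> j; exact: hO.
  + move=> j; have := absC_enormC (grad (heps S) (slot1 (emb J0 y)) - grad (h0S c eps S) (slot1 (emb J0 y))) j.
    rewrite !mxE => H; apply: (le_trans H); apply: (le_trans gr).
    by rewrite ler_wpM2r// ltW.
  + by move=> j; exact: le_trans (Ob j) B_bnd.
- move=> y Hy; have Hn := big_nopsi Hy; split; first exact: hg.
  apply: (le_trans (gb _ _ _ Hn)); rewrite ler_wpM2r//.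
  by rewrite exprn_ge0// addr_ge0// sqrtr_ge0.
- move=> y Hy; have Hd := big_nf_dom Hy; split; first exact: hf.
  exact: le_trans (fb _ Hd) B_bnd.
- move=> y Hy; have Hd := big_nf_dom Hy; rewrite emb_real in Hd *.
  by have [r1 r2 r3 r4] := real _ _ _ Hd; split.
- by move=> y Hy n; apply: per; exact: big_nf_dom.
- by have [lo _] := low _ HJ0.
Qed.
End NormalFormBounds.

(** * Bounds on masses and actions uniform in [eps] *)

Section KeplerBounds.
Context {R : realType}.
Variables (c : constants R) (eps : R) (S : system R).
Hypothesis hc : constants_ok c.
Hypothesis hS : three_body_normal_form c eps S.
Hypothesis e0 : 0 < eps.
Hypothesis e1 : eps <= 1.

Lemma mass_bounds j : [/\ 0 < m_0 c, kappa_bar c * m_0 c <= mass S j / eps, mass S j / eps <= m_0 c,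
  0 < mass S j & mass S j <= m_0 c].
Proof.
have [[m0 _ _ _ _] _ _ _ _] := hc; have [[mo _ _ _ _] _ _] := hS.
have [mp ml mu] := mo j.
have mu' : mass S j <= eps * m_0 c by rewrite -ler_pdivrMr.
split=> //.
- by rewrite ler_pdivlMr// mulrAC -ler_pdivlMr.
- by rewrite ler_pdivrMr// mulrC.
- by apply: (le_trans mu'); rewrite ler_piMl// ltW.
Qed.

(** The cube of [mass S j / eps] lies between [(kappa_bar c * m_0 c) ^ 3] and [m_0 c ^ 3], and the
    denominator between [m_0 c ^ 3] and twice that, because planets are no heavier than the star. *)
Lemma kappa_bounds j : kappa_bar c ^+ 3 / 2 <= kappa (m_0 c) (mass S) eps j <= 1.
Proof.
have [m0 ml mu mp mm] := mass_bounds j; have [[_ kb0 kb1 _ _] _ _ _ _] := hc.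
rewrite /kappa; move: (mass S j) (mass S j / eps) (m_0 c) (kappa_bar c) m0 mp mm ml mu kb0 kb1.
move=> m x M K M0 mp mm ml mu K0 K1.
have D0 : 0 < M ^+ 2 * (M + m) by rewrite mulr_gt0 ?exprn_gt0 ?addr_gt0.
have KM : 0 <= K * M by rewrite mulr_ge0 ?ltW.
have x0 := le_trans KM ml.
rewrite mulrA mulr1 ler_pdivlMr// ler_pdivrMr// mul1r; apply/andP; split.
  apply: (@le_trans _ _ ((K * M) ^+ 3)); last by rewrite ler_pXn2r ?nnegrE.
  have -> : (K * M) ^+ 3 = K ^+ 3 / 2 * (M ^+ 2 * (M + M)) by field.
  apply: ler_wpM2l; first by rewrite divr_ge0 ?exprn_ge0 ?ltW.
  by apply: ler_wpM2l; [rewrite exprn_ge0 ?ltW|rewrite lerD2l].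
apply: (@le_trans _ _ (M ^+ 3)); first by rewrite ler_pXn2r ?nnegrE// ltW.
rewrite exprSr; apply: ler_wpM2l; first by rewrite exprn_ge0 ?ltW.
by rewrite lerDl ltW.
Qed.

Lemma kappa_star_bounds j : kappa_bar c / 2 <= kappa_star (m_0 c) (mass S) eps j <= 1.
Proof.
have [m0 ml mu mp mm] := mass_bounds j; have [[_ kb0 kb1 _ _] _ _ _ _] := hc.
rewrite /kappa_star; move: (mass S j) (mass S j / eps) (m_0 c) (kappa_bar c) m0 mp mm ml mu kb0 kb1.
move=> m x M K M0 mp mm ml mu K0 K1.
have KM : 0 <= K * M by rewrite mulr_ge0 ?ltW.
have x0 := le_trans KM ml; have Mn := ltW M0; have mn := ltW mp.
set D := Num.sqrt _.
have D0 : 0 < D by rewrite sqrtr_gt0 mulr_gt0 ?addr_gt0.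
have D1 : M <= D.
  rewrite -[leLHS]ger0_norm// -sqrtr_sqr ler_wsqrtr// expr2 ler_wpM2l// lerDl//.
have D2 : D <= 2 * M.
  rewrite -[leRHS]ger0_norm ?mulr_ge0// -sqrtr_sqr ler_wsqrtr//.
  have -> : (2 * M) ^+ 2 = M * (M + M + M + M) by ring.
  rewrite ler_wpM2l// -!addrA lerD2l; apply: (le_trans mm); rewrite lerDl addr_ge0//.
rewrite mulrA mulr1 ler_pdivlMr// ler_pdivrMr// mul1r (le_trans mu D1) andbT.
apply: le_trans ml; have -> : K * M = K / 2 * (2 * M) by field.
by apply: ler_wpM2l => //; rewrite divr_ge0 ?ltW.
Qed.

Lemma action_bounds (J : 'rV[R]_2) j : calI S J ->
  kappa_bar c / 2 * Num.sqrt (a_min c) <= J 0 j <= Num.sqrt (a_max c).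
Proof.
move=> HJ; have [[_ [_ _ sub] _ _ _] _ _] := hS; have [a [a0 a01 a1 aE]] := sub _ HJ.
have [[_ kb0 _ amin0 _] _ _ _ _] := hc.
have aj : a_min c <= a j <= a_max c.
  case: (unliftP 0 j) => [l ->|->]; last by rewrite a0 (le_trans (ltW a01)).
  by rewrite (ord1 l) (_ : lift 0 0 = 1) ?a1 ?(le_trans a0 (ltW a01))//; exact: val_inj.
have /andP[k0 k1] := kappa_star_bounds j; have /andP[h1 h2] := aj.
rewrite aE; apply/andP; split.
  by apply: ler_pM; [rewrite divr_ge0// ltW|exact: sqrtr_ge0|exact: k0|exact: ler_wsqrtr].
rewrite -[leRHS]mul1r; apply: ler_pM; [|exact: sqrtr_ge0|exact: k1|exact: ler_wsqrtr].
by apply: le_trans k0; rewrite divr_ge0// ltW.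
Qed.
End KeplerBounds.

Section OneSystem.
Context {R : realType}.
Variables (c : constants R) (eps : R) (S : system R) (J0 : 'rV[R]_2) (th B : R).
Hypothesis hc : constants_ok c.
Hypothesis hS : three_body_normal_form c eps S.
Hypothesis e0 : 0 < eps.
Hypothesis e1 : eps <= 1.
Hypothesis HJ0 : Uset c eps S J0.
Hypothesis th0 : 0 < th.
Hypothesis th1 : th <= 1.
Hypothesis th_r : 10 * th <= r_const c.
Hypothesis th_s : 4 * th <= s_nf c.
Hypothesis th_rho : 30 * th <= rho_nf c.
Hypothesis th_sig : 10 * th <= sigma0 c.
Hypothesis B_bnd : bnd c <= B.
Hypothesis B1 : 1 <= B.
Variables (kmin lmin lmax q T c1 cO : R) (k : 'rV[int]_2).
Let ka := kappa (m_0 c) (mass S) eps.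
Let se := Num.sqrt eps.
Let omega : 'rV[R]_2 := (2 * pi / T) *: ivec R k.
Hypothesis kmin0 : 0 < kmin.
Hypothesis ka_bd : forall j, kmin <= ka j <= 1.
Hypothesis lmin0 : 0 < lmin.
Hypothesis J0_bd : forall j, lmin <= J0 0 j <= lmax.
Hypothesis q1 : 1 <= q.
Hypothesis q_twist : 2 * B / twist_min kmin lmax <= q - 1.
Hypothesis q_inj : B / (3 * kmin * (2 * lmax)^-1 ^+ 4) <= q.
Hypothesis qs : 3 * q * se <= th.
Hypothesis ql : 2 * q * se <= lmin.
Hypothesis lip_small : 2 * lip_freq th B lmin q * se <= twist_min kmin lmax.
Hypothesis se_twist : 4 * Gconst th B lmin q * se <= twist_min kmin lmax.
Hypothesis se_chi : 4 * Gconst th B lmin q * se <= chi0 c.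
Hypothesis r_lmin : 2 * r_const c * se <= lmin.
Hypothesis T0 : 0 < T.
Hypothesis Teps : c1 * (eps * T) <= 1.
Hypothesis c1_G : 8 * Gconst th B lmin q <= c1.
Hypothesis c1_twist : 4 * (twist_max lmin + Gconst th B lmin q) <= c1.
Hypothesis c1_B : 8 * (B + Gconst th B lmin q) <= c1.
Hypothesis c1_l : lmin^-1 ^+ 3 <= c1.
Hypothesis c1_8 : 8 <= c1.
Hypothesis cO_q : 8 + 4 * q <= cO.
Hypothesis gk : gcdz (k 0 0) (k 0 1) = 1.
Hypothesis freqJ0 : grad (h0S c eps S) (rvecC J0) = rvecC omega.

Lemma local_at_J0 : local_nf eps th B (chi0 c) J0 (heps S) (h0S c eps S) (Omt S) (g_nf S) (f_nf S).
Proof. exact: normal_form_local. Qed.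

Lemma kepler_grad (J : 'rV[R]_2) : (forall i, 0 < J 0 i) -> forall j,
  'D_(unit_vec (Cx R) j) (h0S c eps S) (rvecC J) = toC (ka j * (J 0 j)^-1 ^+ 3).
Proof. by move=> Jp j; exact: h0_derive. Qed.

Lemma eps_se : eps = se * se.
Proof. by rewrite -expr2 sqr_sqrtr// ltW. Qed.

Lemma J0_pos i : 0 < J0 0 i.
Proof. by have /andP[h _] := J0_bd i; exact: lt_le_trans lmin0 h. Qed.

Lemma omega_freq j : freq0 J0 ka j = omega 0 j.
Proof.
have := congr1 (fun v : 'rV[Cx R]_2 => reC (v 0 j)) freqJ0.
by rewrite !mxE (kepler_grad J0_pos).
Qed.

Lemma omega_row : \row_j freq0 J0 ka j = omega.
Proof. by apply/rowP => j; rewrite mxE omega_freq. Qed.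

Lemma qeps_lmin : q * eps <= lmin / 2.
Proof.
have s0 : 0 <= se := sqrtr_ge0 _; have s1 := sqrt_eps_le1 e1.
rewrite eps_se; have h : q * (se * se) <= q * se.
  by rewrite ler_wpM2l ?(le_trans ler01 q1)// ler_piMr.
by apply: (le_trans h); move: ql => a; lra.
Qed.

Lemma eps_th : eps <= th.
Proof.
have s0 : 0 <= se := sqrtr_ge0 _; have s1 := sqrt_eps_le1 e1.
have h : eps <= se by rewrite eps_se ler_piMr.
apply: (le_trans h); move: qs; apply: le_trans.
by rewrite ler_peMl// mulr_ege1// ler1n.
Qed.

Lemma qeps_th : q * eps <= th * se.
Proof. by have := qeps_le local_at_J0 q1 qs. Qed.

Lemma lip_small' : lip_freq th B lmin q * se <= twist_min kmin lmax / 2.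
Proof. by move: lip_small; rewrite -mulrA => a; lra. Qed.

Lemma near_enorm (J : 'rV[R]_2) r : nearJ0 J0 r J -> enorm (J - J0) <= 2 * r.
Proof. by move=> H; apply: enorm_le => j; rewrite !mxE; exact: H. Qed.

(** Uniqueness is wanted in a ball of radius of order [se], the contraction works within order
    [eps]. A solution in the larger ball has Kepler frequency within [B * eps] of [omega], and
    quantitative injectivity of the inverse cube up to [2 * lmax] brings it into the smaller
    ball. *)
Lemma close_critical (J : 'rV[R]_2) : enorm (J - J0) < r_nf c eps ->
  grad (heps S) (rvecC J) = rvecC omega -> nearJ0 J0 (q * eps) J.
Proof.
move=> HJ HJg j.
have [_ _ [_ _ act _ _]] := hS.
have DJ : cnbhd (Uset c eps S) (r_nf c eps) (rvecC J).
  exists J0 => //; rewrite (_ : rvecC J - rvecC J0 = rvecC (J - J0)) ?enormC_rvecC//.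
  by apply/rowP => i; rewrite !mxE toCB.
have [_ gr _ _ _] := act _ DJ.
have Jd i : `|J 0 i - J0 0 i| <= lmin / 2.
  have := norm_enorm (J - J0) i; rewrite !mxE => h.
  apply: (le_trans h); apply: (le_trans (ltW HJ)); rewrite /r_nf -/se.
  by move: r_lmin => a; lra.
have Jb i : lmin / 2 <= J 0 i /\ J 0 i <= 2 * lmax.
  have := Jd i; have /andP[h1 h2] := J0_bd i; rewrite ler_norml => /andP[h3 h4].
  by move: lmin0 => h5; split; lra.
have Jp i : 0 < J 0 i by have [h _] := Jb i; apply: lt_le_trans h; rewrite divr_gt0.
have D : `|ka j * ((J0 0 j)^-1 ^+ 3 - (J 0 j)^-1 ^+ 3)| <= B * eps.
  have := absC_enormC (grad (heps S) (rvecC J) - grad (h0S c eps S) (rvecC J)) j.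
  have sub (u v : 'rV[Cx R]_2) : (u - v) 0 j = u 0 j - v 0 j by rewrite !mxE.
  have E1 : grad (h0S c eps S) (rvecC J) 0 j = toC (ka j * (J 0 j)^-1 ^+ 3).
    by rewrite mxE kepler_grad.
  have E2 : (rvecC omega) 0 j = toC (freq0 J0 ka j) by rewrite mxE omega_freq.
  rewrite sub HJg E1 E2 -toCB absC_toC.
  rewrite /freq0 -mulrBr => h; apply: (le_trans h); rewrite HJg in gr; apply: (le_trans gr).
  by rewrite ler_wpM2r// ltW.
have J0l : J0 0 j <= 2 * lmax.
  by have /andP[h1 h2] := J0_bd j; move: lmin0 => h5; lra.
have [_ Jl] := Jb j.
have I := inv_cube_inj (Jp j) (J0_pos j) Jl J0l.
have l0 : 0 < 2 * lmax := lt_le_trans (J0_pos j) J0l.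
have M0 : 0 < 3 * kmin * (2 * lmax)^-1 ^+ 4.
  by rewrite mulr_gt0 ?exprn_gt0 ?invr_gt0// mulr_gt0.
apply: (@le_trans _ _ (B / (3 * kmin * (2 * lmax)^-1 ^+ 4) * eps)); last first.
  by rewrite ler_wpM2r// ltW.
rewrite mulrAC ler_pdivlMr//; apply: le_trans D; rewrite normrM.
have /andP[k0 _] := ka_bd j.
rewrite distrC in I; rewrite (distrC (_ ^+ 3)) (ger0_norm (le_trans (ltW kmin0) k0)).
have -> : `|J 0 j - J0 0 j| * (3 * kmin * (2 * lmax)^-1 ^+ 4) =
  kmin * (3 * (2 * lmax)^-1 ^+ 4 * `|J0 0 j - J 0 j|) by rewrite distrC; ring.
apply: ler_pM; [exact: ltW| |exact: k0|exact: I].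
by rewrite mulr_ge0// mulr_ge0// exprn_ge0// invr_ge0 ltW.
Qed.

Lemma one_system : exists Jeps : 'rV[R]_2,
  [/\ enorm (Jeps - J0) < r_nf c eps,
      grad (heps S) (rvecC Jeps) = rvecC omega,
      forall J : 'rV[R]_2, enorm (J - J0) < r_nf c eps ->
        grad (heps S) (rvecC J) = rvecC omega -> J = Jeps
    & enorm (Jeps - J0) <= cO * eps] /\
  exists (psi_p psi_m : 'rV[R]_2) (zeta_p zeta_m : R -> state R),
  [/\ solution (nf_dom c eps S) (Hnf eps S) zeta_p
      /\ solution (nf_dom c eps S) (Hnf eps S) zeta_m,
      periodic_traj T zeta_p /\ periodic_traj T zeta_m,
      geom_distinct zeta_p zeta_m,
      (forall t, state_dist (zeta_p t) (quasi_traj Jeps psi_p omega t) <= c1 * eps ^+ 2)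
      /\ (forall t, state_dist (zeta_m t) (quasi_traj Jeps psi_m omega t) <= c1 * eps ^+ 2)
    & (forall t, 0 <= t -> t <= T ->
         state_dist (zeta_p t) (quasi_traj J0 psi_p omega t) <= cO * eps)
      /\ (forall t, 0 <= t -> t <= T ->
         state_dist (zeta_m t) (quasi_traj J0 psi_m omega t) <= cO * eps)].
Proof.
have [Jeps Jn Jf] := exists_Jeps local_at_J0 kmin0 ka_bd lmin0 J0_bd kepler_grad q1 qeps_th qeps_lmin
  q_twist lip_small'.
have q0 : 0 <= q := le_trans ler01 q1.
have en := ltW e0.
have Jn' : nearJ0 J0 (q * eps) Jeps.
  by move=> j; apply: (le_trans (Jn j)); rewrite ler_wpM2r// gerBl.
have Jg : grad (heps S) (rvecC Jeps) = rvecC omega.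
  by apply/rowP => j; rewrite !mxE (gradient_real local_at_J0 q1 qs j Jn') Jf omega_freq !mxE.
have s0 : 0 < se by rewrite sqrtr_gt0.
have ne := near_enorm Jn'.
exists Jeps; split.
  split=> //.
  - apply: (le_lt_trans ne); rewrite /r_nf -/se; apply: (@le_lt_trans _ _ (2 * (th * se))).
      by apply: ler_wpM2l => //; exact: qeps_th.
    by rewrite mulrA ltr_pM2r//; move: th_r th0 => a b; lra.
  - move=> J HJ HJg; have HJn := close_critical HJ HJg.
    apply: (Jeps_unique local_at_J0 kmin0 ka_bd lmin0 J0_bd kepler_grad q1 qeps_th qeps_lmin lip_small' HJn Jn').
    move=> j; rewrite Jf; have := congr1 (fun v : 'rV[Cx R]_2 => reC (v 0 j)) HJg.
    by rewrite [LHS]/= mxE /gh => ->; rewrite mxE omega_freq.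
  - apply: (le_trans ne); rewrite mulrA ler_wpM2r//; move: cO_q q0 => a b; lra.
have kkT j : freq0 J0 ka j * T = 2 * pi * (k 0 j)%:~R.
  by rewrite omega_freq !mxE mulrAC divfK// gt_eqF.
have sc : 4 * Gconst th B lmin q * Num.sqrt eps <= chi0 c by exact: se_chi.
have := @two_distinct_orbits R eps th B (chi0 c) J0 (heps S) (h0S c eps S) (Omt S) (g_nf S) (f_nf S) local_at_J0
  ka kmin lmin lmax q kmin0 ka_bd lmin0 J0_bd kepler_grad q1 qs eps_th qeps_lmin Jeps Jn Jf T c1
  (fun j => k 0 j) T0 kkT Teps c1_G c1_twist c1_B se_twist sc (nf_dom c eps S) c1_l gk.
case=> [X HX|psi_p [psi_m [zp [zm [sol per gd dist]]]]].
  apply: (@big_nf_dom R c eps S J0 th) => //.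
  have := rl_big0 local_at_J0 q1 qs eps_th Jn HX. by [].
exists psi_p, psi_m, zp, zm; rewrite omega_row in dist.
have p32 : eps ^+ 3 <= eps ^+ 2 by rewrite ler_wiXn2l.
have p21 : eps ^+ 2 <= eps by rewrite expr2 ler_piMl.
have d1 : 4 * (0 + eps ^+ 3 + eps ^+ 2) <= c1 * eps ^+ 2.
  rewrite add0r; apply: (@le_trans _ _ (8 * eps ^+ 2)).
    by move: (eps ^+ 3) (eps ^+ 2) p32 => u v uv; lra.
  by rewrite ler_wpM2r ?sqr_ge0.
have d2 : 4 * (q * eps + eps ^+ 3 + eps ^+ 2) <= cO * eps.
  apply: (@le_trans _ _ ((8 + 4 * q) * eps)); last by rewrite ler_wpM2r.
  have -> : (8 + 4 * q) * eps = 8 * eps + 4 * (q * eps) by ring.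
   move: (q * eps) (eps ^+ 3) (eps ^+ 2) p32 p21 => a u v uv ve; lra.
have D1 t := dist Jeps 0 t; have D2 t := dist J0 (q * eps) t Jn'.
have {}D1 t : state_dist (zp t) (quasi_traj Jeps psi_p omega t) <= c1 * eps ^+ 2 /\
              state_dist (zm t) (quasi_traj Jeps psi_m omega t) <= c1 * eps ^+ 2.
  have [|a b] := D1 t; first by move=> j; rewrite subrr normr0.
  by split; [exact: le_trans a d1|exact: le_trans b d1].
split=> //.
- by split=> t; have [] := D1 t.
- by split=> t _ _; have [a b] := D2 t; [exact: le_trans a d2|exact: le_trans b d2].
Qed.
End OneSystem.

(** * Choice of the constants *)

Lemma quot_le (R : realType) (a b se Q : R) : 0 < b -> 0 <= se -> a / b <= Q -> Q * se <= 1 -> a * se <= b.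
Proof.
move=> b0 s0 aQ Qs; have := le_trans (ler_wpM2r s0 aQ) Qs.
by rewrite mulrAC ler_pdivrMr// mul1r.
Qed.

Unset Implicit Arguments.

Theorem theorem6p1 (R : realType) (c : constants R) (S : R -> system R)
  (hc : constants_ok c)
  (hS : forall eps : R, 0 < eps -> eps <= eps0 c ->
        three_body_normal_form c eps (S eps)) :
  exists c1 eps1 cO : R, [/\ 0 < c1, 0 < eps1 & 0 < cO] /\
  forall (T : R) (k : 'rV[int]_2) (eps : R) (J0 : 'rV[R]_2),
  let omega : 'rV[R]_2 := (2 * pi / T) *: ivec R k in
  let H := Hnf eps (S eps) in
  0 < T -> gcdz (k 0 0) (k 0 1) = 1 ->
  0 < eps -> eps <= Num.min eps1 (1 / (c1 * T)) ->
  Uset c eps (S eps) J0 ->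
  grad (h0S c eps (S eps)) (rvecC J0) = rvecC omega ->
  exists Jeps : 'rV[R]_2,
  [/\ enorm (Jeps - J0) < r_nf c eps,
      grad (heps (S eps)) (rvecC Jeps) = rvecC omega,
      forall J : 'rV[R]_2, enorm (J - J0) < r_nf c eps ->
        grad (heps (S eps)) (rvecC J) = rvecC omega -> J = Jeps
    & enorm (Jeps - J0) <= cO * eps] /\
  exists (psi_p psi_m : 'rV[R]_2) (zeta_p zeta_m : R -> state R),
  [/\ solution (nf_dom c eps (S eps)) H zeta_p
      /\ solution (nf_dom c eps (S eps)) H zeta_m,
      periodic_traj T zeta_p /\ periodic_traj T zeta_m,
      geom_distinct zeta_p zeta_m,
      (forall t,
         state_dist (zeta_p t) (quasi_traj Jeps psi_p omega t)
           <= c1 * eps ^+ 2)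
      /\ (forall t,
         state_dist (zeta_m t) (quasi_traj Jeps psi_m omega t)
           <= c1 * eps ^+ 2)
    & (forall t, 0 <= t -> t <= T ->
         state_dist (zeta_p t) (quasi_traj J0 psi_p omega t) <= cO * eps)
      /\ (forall t, 0 <= t -> t <= T ->
         state_dist (zeta_m t) (quasi_traj J0 psi_m omega t) <= cO * eps)].
Proof.
have [[m0 kb0 kb1 amin0 aminmax] [sg0 _ _] [r0 sn0 rho0p] [_ ch0 bnd0] [ep0 ep1 _]] := hc.
have [th [th0 th1 [th_r th_s th_rho th_sig]]] : exists th : R, [/\ 0 < th, th <= 1 &
    [/\ 10 * th <= r_const c, 4 * th <= s_nf c, 30 * th <= rho_nf c & 10 * th <= sigma0 c]].
  exists (Num.min 1 (Num.min (r_const c / 10) (Num.min (s_nf c / 4) (Num.min (rho_nf c / 30) (sigma0 c / 10))))).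
  split; first by rewrite !lt_min ltr01 !divr_gt0.
    by rewrite ge_min lexx.
  by split; rewrite mulrC -ler_pdivlMr// !ge_min lexx ?orbT.
pose B := Num.max (bnd c) 1.
have B_bnd : bnd c <= B by rewrite le_max lexx.
have B1 : 1 <= B by rewrite le_max lexx orbT.
have B0 : 0 <= B := le_trans ler01 B1.
move: B B_bnd B1 B0 => B B_bnd B1 B0.
have kmin0 : 0 < kappa_bar c ^+ 3 / 2 by rewrite divr_gt0 ?exprn_gt0.
have lmin0 : 0 < kappa_bar c / 2 * Num.sqrt (a_min c) by rewrite mulr_gt0 ?divr_gt0 ?sqrtr_gt0.
have lmax0 : 0 < Num.sqrt (a_max c) by rewrite sqrtr_gt0 (lt_trans amin0).
have kbd e : 0 < e -> e <= 1 -> three_body_normal_form c e (S e) -> forall j,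
    kappa_bar c ^+ 3 / 2 <= kappa (m_0 c) (mass (S e)) e j <= 1.
  by move=> e0 e1 H j; exact: (kappa_bounds hc H e0 e1).
have abd e : 0 < e -> e <= 1 -> three_body_normal_form c e (S e) -> forall J j, calI (S e) J ->
    kappa_bar c / 2 * Num.sqrt (a_min c) <= J 0 j <= Num.sqrt (a_max c).
  by move=> e0 e1 H J j; exact: (action_bounds hc H e0 e1).
move: (kappa_bar c ^+ 3 / 2) (kappa_bar c / 2 * Num.sqrt (a_min c)) (Num.sqrt (a_max c))
  kmin0 lmin0 lmax0 kbd abd => kmin lmin lmax kmin0 lmin0 lmax0 kbd abd.
have tm0 : 0 < twist_min kmin lmax.
  by rewrite /twist_min; apply: mulr_gt0; [rewrite mulr_gt0|rewrite exprn_gt0 ?invr_gt0].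
have X0 : 0 < 3 * kmin * (2 * lmax)^-1 ^+ 4.
  by apply: mulr_gt0; [rewrite mulr_gt0|rewrite exprn_gt0 ?invr_gt0 ?mulr_gt0].
have q0a : 0 <= 2 * B / twist_min kmin lmax by apply: divr_ge0; [exact: mulr_ge0|exact: ltW].
have q0b : 0 <= B / (3 * kmin * (2 * lmax)^-1 ^+ 4) by apply: divr_ge0; [|exact: ltW].
have [q [q1 q_twist q_inj]] : exists q : R, [/\ 1 <= q, 2 * B / twist_min kmin lmax <= q - 1
    & B / (3 * kmin * (2 * lmax)^-1 ^+ 4) <= q].
  (* One summand for the initial Newton correction towards [Jeps], one for the localization of all
     competing solutions. *)
  exists (1 + 2 * B / twist_min kmin lmax + B / (3 * kmin * (2 * lmax)^-1 ^+ 4)).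
  move: q0a q0b; move: (2 * B / _) (B / _) => a b a0 b0; split; lra.
have qn : 0 <= q := le_trans ler01 q1.
have C0 : 0 <= Gconst th B lmin q.
  by rewrite /Gconst addr_ge0 ?lip_freq_nonneg// mulr_ge0 ?pconst_nonneg.
have lf0 := lip_freq_nonneg th0 B0 lmin0 qn.
have tM0 : 0 <= twist_max lmin by rewrite /twist_max mulr_ge0 ?exprn_ge0 ?invr_ge0 ?ltW.
have l30 : 0 <= lmin^-1 ^+ 3 by rewrite exprn_ge0 ?invr_ge0 ?ltW.
have [c1 [c1_G c1_twist c1_B c1_l c1_8]] : exists c1 : R,
    [/\ 8 * Gconst th B lmin q <= c1, 4 * (twist_max lmin + Gconst th B lmin q) <= c1,
      8 * (B + Gconst th B lmin q) <= c1, lmin^-1 ^+ 3 <= c1 & 8 <= c1].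
  (* A sum of nonnegative terms dominating each requirement, with [20 = 8 + 4 + 8]; the last 8 turns
     [4 * (eps ^ 3 + eps ^ 2)] into [c1 * eps ^ 2]. *)
  exists (4 * twist_max lmin + 8 * B + 20 * Gconst th B lmin q + lmin^-1 ^+ 3 + 8).
  move: (Gconst _ _ _ _) (twist_max _) (lmin^-1 ^+ 3) C0 tM0 l30 => C M l C0 M0 l0.
  by split; lra.
(* Every smallness condition on [eps] has the form [a * se <= b]; [Q] collects the quotients
   [a / b], so that [Q * se <= 1] implies all of them. *)
pose Q : R := 1 + 3 * q / th + 2 * q / lmin + 2 * lip_freq th B lmin q / twist_min kmin lmax
  + 4 * Gconst th B lmin q / twist_min kmin lmax + 4 * Gconst th B lmin q / chi0 c + 2 * r_const c / lmin.
have [Q1 Qa Qb [Qc Qd Qe Qf]] : [/\ 1 <= Q, 3 * q / th <= Q, 2 * q / lmin <= Q &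
    [/\ 2 * lip_freq th B lmin q / twist_min kmin lmax <= Q,
        4 * Gconst th B lmin q / twist_min kmin lmax <= Q,
        4 * Gconst th B lmin q / chi0 c <= Q & 2 * r_const c / lmin <= Q]].
  rewrite /Q.
  have a1 : 0 <= 3 * q / th by apply: divr_ge0; [exact: mulr_ge0|exact: ltW].
  have a2 : 0 <= 2 * q / lmin by apply: divr_ge0; [exact: mulr_ge0|exact: ltW].
  have a3 : 0 <= 2 * lip_freq th B lmin q / twist_min kmin lmax.
    by apply: divr_ge0; [exact: mulr_ge0|exact: ltW].
  have a4 : 0 <= 4 * Gconst th B lmin q / twist_min kmin lmax.
    by apply: divr_ge0; [exact: mulr_ge0|exact: ltW].
  have a5 : 0 <= 4 * Gconst th B lmin q / chi0 c.
    by apply: divr_ge0; [exact: mulr_ge0|exact: ltW].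
  have a6 : 0 <= 2 * r_const c / lmin by apply: divr_ge0; [apply: mulr_ge0 => //; exact: ltW|exact: ltW].
  move: (3 * q / _) (2 * q / _) (2 * lip_freq _ _ _ _ / _) (4 * Gconst _ _ _ _ / twist_min _ _)
    (4 * Gconst _ _ _ _ / chi0 c) (2 * r_const c / _) a1 a2 a3 a4 a5 a6.
  by move=> x1 x2 x3 x4 x5 x6 *; split; [lra|lra|lra|split; lra].
have Q0 : 0 < Q := lt_le_trans ltr01 Q1.
move: Q Q0 Q1 Qa Qb Qc Qd Qe Qf => Q Q0 Q1 Qa Qb Qc Qd Qe Qf.
have c10 : 0 < c1 by apply: lt_le_trans c1_8.
(* The bound [Q^-1 ^ 2] on [eps] is [Q * se <= 1]. The constant [8 + 4 * q] is [zeta_dist] with [J0]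
   in place of [Jeps], where the offset [q * eps] is added to the deviation of the orbit. *)
exists c1, (Num.min (eps0 c) (Q^-1 ^+ 2)), (8 + 4 * q); split.
  by split=> //; [rewrite lt_min ep0 exprn_gt0 ?invr_gt0|rewrite addr_gt0// mulr_gt0// (lt_le_trans ltr01)].
move=> T k eps J0 omega H T0 gk e0; rewrite !le_min => /andP[/andP[ee0 eQ] eT] HJ0 fJ0.
have e1 : eps <= 1 := le_trans ee0 ep1.
have hSe := hS eps e0 ee0.
have s0 : 0 <= Num.sqrt eps by exact: sqrtr_ge0.
have Qs : Q * Num.sqrt eps <= 1.
  rewrite -ler_pdivlMl// mulr1 -[leRHS]ger0_norm ?invr_ge0 ?(ltW Q0)// -sqrtr_sqr.
  exact: ler_wsqrtr.
have Teps : c1 * (eps * T) <= 1.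
  by move: eT; rewrite ler_pdivlMr ?mulr_gt0// mulrCA.
apply: (@one_system R c eps (S eps) J0 th B hc hSe e0 e1 HJ0 th0 th1 th_r th_s th_rho th_sig B_bnd B1
  kmin lmin lmax q T c1 (8 + 4 * q) k kmin0 (kbd _ e0 e1 hSe) lmin0) => //.
- by move=> j; apply: (abd _ e0 e1 hSe); case: HJ0.
- exact: quot_le th0 s0 Qa Qs.
- exact: quot_le lmin0 s0 Qb Qs.
- exact: quot_le tm0 s0 Qc Qs.
- exact: quot_le tm0 s0 Qd Qs.
- exact: quot_le ch0 s0 Qe Qs.
- exact: quot_le lmin0 s0 Qf Qs.
Qed.
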